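(* Let $\pi$ be a cyclic group of order $n$ and $R$ a semilocal Dedekind domain such that (i) $\operatorname{char}R=0$, (ii) every prime divisor of $n$ is not invertible in $R$, and (iii) every prime divisor $p$ of $n$ is unramified in $R$. Then $F_{R\pi}=\{0\}$, and every flabby $R\pi$-lattice is stably permutation: for every flabby $R\pi$-lattice $M$ there exist permutation $R\pi$-lattices $P_1,P_2$ with $M\oplus P_1\simeq P_2$.
   Context: An $R\pi$-lattice is a finitely generated left $R\pi$-module torsion-free over $R$; permutation lattices are $R$-free with an $R$-basis permuted by $\pi$; $M$ is flabby if the Tate cohomology $\hat H^{-1}(\pi',M)=0$ for all subgroups $\pi'\le\pi$. A prime $p$ is unramified in $R$ if $p$ is not invertible in $R$ and $pR$ is an intersection of maximal ideals of $R$. Flabby lattices $M_1,M_2$ are equivalent if $M_1\oplus P_1\simeq M_2\oplus P_2$ for permutation lattices $P_1,P_2$; $F_{R\pi}$ is the monoid of equivalence classes under direct sum, with $0$ the class of permutation lattices. *)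

(* Defs.v *)
From HB Require Import structures.
From mathcomp Require Import all_boot all_order all_algebra all_fingroup.
From mathcomp Require Import boolp classical_sets cardinality.

Set Implicit Arguments.
Unset Strict Implicit.
Unset Printing Implicit Defensive.

Import GRing.Theory.
Local Open Scope ring_scope.
Local Open Scope classical_set_scope.

Section Domains.
Variable R : idomainType.
Implicit Types I J : set R.

Definition ideal I : Prop :=
  [/\ I 0, forall x y, I x -> I y -> I (x + y) & forall a x, I x -> I (a * x)].

Definition prime_ideal I : Prop :=
  [/\ ideal I, ~ I 1 & forall x y, I (x * y) -> I x \/ I y].

Definition maximal_ideal I : Prop :=
  [/\ ideal I, ~ I 1 &
      forall J, ideal J -> ~ J 1 -> I `<=` J -> J = I].

Definition noetherian : Prop :=
  forall I, ideal I -> exists (k : nat) (a : 'I_k -> R),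
    I = [set \sum_(i < k) c i * a i | c in [set: 'I_k -> R]].

Definition integrally_closed : Prop :=
  forall x : {fraction R}, integralOver (@tofrac R) x ->
    exists a : R, x = tofrac a.

(* Fields count as Dedekind domains, as in the usual "dimension at most one"
   formulation. *)
Definition dedekind : Prop :=
  [/\ noetherian, integrally_closed &
      forall I, prime_ideal I -> I <> [set 0] -> maximal_ideal I].

Definition semilocal : Prop := finite_set [set I | maximal_ideal I].

Definition unramified (p : nat) : Prop :=
  p%:R \isn't a @GRing.unit R /\
  exists S : set (set R), (forall I, S I -> maximal_ideal I) /\
    [set p%:R * a | a in [set: R]] = \bigcap_(I in S) I.

End Domains.

(* {ffun gT -> R} already carries the pointwise ring structure, so the
   convolution ring lives on an alias inheriting only the R-module structure. *)
Definition group_alg (R : comNzRingType) (gT : finGroupType) : Type :=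
  {ffun gT -> R}.

Section GroupAlgebra.
Variables (R : comNzRingType) (gT : finGroupType).
Local Notation A := (group_alg R gT).

HB.instance Definition _ := GRing.Lmodule.copy A {ffun gT -> R^o}.

Definition grp_elt (g : gT) : A := [ffun h => (h == g)%:R].

Definition ga_mul (a b : A) : A :=
  [ffun g => \sum_(h : gT) a h * b (h^-1 * g)%g].

Lemma ga_mulA : associative ga_mul.
Proof.
move=> a b c; apply/ffunP => g; rewrite !ffunE.
under eq_bigr => h _ do rewrite ffunE mulr_sumr.
under [RHS]eq_bigr => h _ do rewrite ffunE mulr_suml.
rewrite [RHS]exchange_big /=; apply: eq_bigr => h _.
rewrite [RHS](reindex_inj (mulgI h)) /=; apply: eq_bigr => k _.
by rewrite mulrA mulKg invMg mulgA.
Qed.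

Lemma ga_mul1l : left_id (grp_elt 1) ga_mul.
Proof.
move=> a; apply/ffunP => g; rewrite ffunE (bigD1 1%g) //= big1 => [|h /negPf h1].
  by rewrite ffunE eqxx mul1r invg1 mul1g addr0.
by rewrite ffunE h1 mul0r.
Qed.

Lemma ga_mul1r : right_id (grp_elt 1) ga_mul.
Proof.
move=> a; apply/ffunP => g; rewrite ffunE (bigD1 g) //= big1 => [|h /negPf h1].
  by rewrite ffunE mulVg eqxx mulr1 addr0.
by rewrite ffunE -eq_mulVg1 h1 mulr0.
Qed.

Lemma ga_mulDl : left_distributive ga_mul +%R.
Proof.
move=> a b c; apply/ffunP => g; rewrite !ffunE -big_split /=.
by apply: eq_bigr => h _; rewrite ffunE mulrDl.
Qed.

Lemma ga_mulDr : right_distributive ga_mul +%R.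
Proof.
move=> a b c; apply/ffunP => g; rewrite !ffunE -big_split /=.
by apply: eq_bigr => h _; rewrite ffunE mulrDr.
Qed.

Lemma ga_oner_neq0 : grp_elt 1 != 0.
Proof.
by apply/eqP => /ffunP/(_ 1%g); rewrite !ffunE eqxx; apply/eqP; rewrite oner_eq0.
Qed.

HB.instance Definition _ := GRing.Zmodule_isNzRing.Build A
  ga_mulA ga_mul1l ga_mul1r ga_mulDl ga_mulDr ga_oner_neq0.

Lemma ga_scaleAl (r : R) (a b : A) : r *: (a * b) = r *: a * b.
Proof.
apply/ffunP => g; rewrite !ffunE scaler_sumr.
by apply: eq_bigr => h _; rewrite ffunE scalerAl.
Qed.

HB.instance Definition _ := GRing.Lmodule_isLalgebra.Build R A ga_scaleAl.

Lemma ga_scaleAr (r : R) (a b : A) : r *: (a * b) = a * (r *: b).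
Proof.
apply/ffunP => g; rewrite !ffunE scaler_sumr.
by apply: eq_bigr => h _; rewrite ffunE scalerAr.
Qed.

HB.instance Definition _ := GRing.Lalgebra_isAlgebra.Build R A ga_scaleAr.

Lemma grp_eltM (g h : gT) : grp_elt (g * h) = grp_elt g * grp_elt h.
Proof.
apply/ffunP => k; rewrite !ffunE (bigD1 g) //= big1 => [|x /negPf xg].
  by rewrite !ffunE eqxx mul1r addr0 -[in RHS](inj_eq (mulgI g)) mulKVg.
by rewrite ffunE xg mul0r.
Qed.

Lemma group_algE (a : A) : a = \sum_(g : gT) a g *: grp_elt g.
Proof.
apply/ffunP => h; rewrite sum_ffunE (bigD1 h) //= big1 => [|g /negPf gh].
  by rewrite !ffunE eqxx -[_ *: _]/(_ * _) mulr1 addr0.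
by rewrite !ffunE eq_sym gh scaler0.
Qed.

End GroupAlgebra.

Definition lmod_iso (A : nzRingType) (M N : lmodType A) : Prop :=
  exists f : {linear M -> N}, bijective f.

Section Lattices.
Variables (R : idomainType) (gT : finGroupType).
Local Notation A := (group_alg R gT).
Local Notation "[ 'elt' g ]" := (grp_elt R g) (at level 0).
Implicit Types (M N P : lmodType A) (H : {group gT}).

Definition finitely_generated M : Prop :=
  exists (k : nat) (e : 'I_k -> M),
    forall m, exists c : 'I_k -> A, m = \sum_(i < k) c i *: e i.

Definition torsion_free M : Prop :=
  forall (r : R) (m : M), (r%:A : A) *: m = 0 -> r = 0 \/ m = 0.

Definition lattice M : Prop := finitely_generated M /\ torsion_free M.

Definition R_basis M (k : nat) (e : 'I_k -> M) : Prop :=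
  forall m, exists! c : {ffun 'I_k -> R},
    m = \sum_(i < k) ((c i)%:A : A) *: e i.

Definition permutation_lattice M : Prop :=
  lattice M /\ exists (k : nat) (e : 'I_k -> M),
    R_basis e /\ forall g i, exists j, [elt g] *: e i = e j.

Definition norm_kernel H M : set M :=
  [set m | \sum_(g in H) [elt g] *: m = 0].

Arguments norm_kernel : clear implicits.

Definition augmentation_submodule H M : set M :=
  [set \sum_(g in H) ([elt g] - 1) *: y g | y in [set: gT -> M]].

Arguments augmentation_submodule : clear implicits.

(* \hat H^{-1}(H, M) is the quotient of the kernel of the norm of H on M by
   its subgroup I_H M, with I_H the augmentation ideal of H. *)
Definition tate_cohomN1_eq0 H M : Prop :=
  norm_kernel H M `<=` augmentation_submodule H M.

Definition flabby M : Prop := forall H, tate_cohomN1_eq0 H M.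

Lemma lmod_iso_of_fun M N (f : M -> N) : linear f -> bijective f -> lmod_iso M N.
Proof.
move=> fL fB; pose h := GRing.isLinear.Build _ _ _ _ f fL.
by exists (HB.pack_for {linear M -> N} f h).
Qed.

Lemma lmod_iso_refl M : lmod_iso M M.
Proof. by apply: (@lmod_iso_of_fun _ _ id) => //; exists id. Qed.

Lemma lmod_iso_sym M N : lmod_iso M N -> lmod_iso N M.
Proof.
case=> f fB; have [g fK gK] := fB; apply: (@lmod_iso_of_fun _ _ g).
  by move=> a u v; rewrite -{1}(gK u) -{1}(gK v) -linearP fK.
by exists f.
Qed.

Lemma lmod_iso_trans M N P : lmod_iso M N -> lmod_iso N P -> lmod_iso M P.
Proof.
case=> f fB [g gB]; apply: (@lmod_iso_of_fun _ _ (g \o f)).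
  by move=> a u v; rewrite /= !linearP.
exact: bij_comp.
Qed.

Lemma lmod_iso_sum (M1 M2 N1 N2 : lmodType A) :
  lmod_iso M1 N1 -> lmod_iso M2 N2 ->
  lmod_iso (M1 * M2)%type (N1 * N2)%type.
Proof.
case=> f [f' fK f'K] [g [g' gK g'K]].
apply: (@lmod_iso_of_fun _ _ (fun x => (f x.1, g x.2))).
  by move=> a [u u'] [v v'] /=; rewrite !linearP.
by exists (fun x => (f' x.1, g' x.2)) => -[x y] /=; rewrite ?(fK, gK, f'K, g'K).
Qed.

Lemma lmod_iso_sumC M N : lmod_iso (M * N)%type (N * M)%type.
Proof.
apply: (@lmod_iso_of_fun _ _ (fun x => (x.2, x.1))) => //.
by exists (fun x => (x.2, x.1)) => -[].
Qed.

Lemma lmod_iso_sumA M N P : lmod_iso (M * (N * P))%type (M * N * P)%type.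
Proof.
apply: (@lmod_iso_of_fun _ _ (fun x => (x.1, x.2.1, x.2.2))) => //.
by exists (fun x => (x.1.1, (x.1.2, x.2))) => [[? []]|[[]]].
Qed.

Lemma lmod_iso_sumACA (M N P Q : lmodType A) :
  lmod_iso ((M * N) * (P * Q))%type ((M * P) * (N * Q))%type.
Proof.
pose f (V1 V2 V3 V4 : lmodType A) (x : (V1 * V2) * (V3 * V4)) :=
  ((x.1.1, x.2.1), (x.1.2, x.2.2)).
apply: (@lmod_iso_of_fun _ _ (@f M N P Q)) => //.
by exists (@f M P N Q) => -[[? ?] [? ?]].
Qed.

Lemma pair_sum (I : finType) (D : {pred I}) M N (F : I -> M) (G : I -> N) :
  \sum_(i in D) ((F i, G i) : M * N) = (\sum_(i in D) F i, \sum_(i in D) G i).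
Proof.
by elim/big_rec3: _ => // i x y z _ ->.
Qed.

Definition pair_family M N (k l : nat) (e : 'I_k -> M) (f : 'I_l -> N)
    (i : 'I_(k + l)) : M * N :=
  match fintype.split i with inl i => (e i, 0) | inr j => (0, f j) end.

Lemma pair_familyE M N k l (e : 'I_k -> M) (f : 'I_l -> N) (c : 'I_(k + l) -> A) :
  \sum_i c i *: pair_family e f i =
  (\sum_i c (lshift l i) *: e i, \sum_j c (rshift k j) *: f j).
Proof.
rewrite big_split_ord /= /pair_family.
under eq_bigr => i _ do
  rewrite (unsplitK (inl i : 'I_k + 'I_l)) -[_ *: _]/(_, _) scaler0.
under [X in _ + X]eq_bigr => i _ do
  rewrite (unsplitK (inr i : 'I_k + 'I_l)) -[_ *: _]/(_, _) scaler0.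
rewrite !(pair_sum predT) /= !big1_eq.
by rewrite -[_ + _]/(_, _) /= addr0 add0r.
Qed.

Lemma lattice_sum M N : lattice M -> lattice N -> lattice (M * N)%type.
Proof.
move=> [[k [e eM]] tM] [[l [f fN]] tN]; split; last first.
  move=> r [x y] [/= /tM rx /tN ry].
  by case: rx => [|->]; [left|case: ry => [|->]; [left|right]].
exists (k + l)%N, (pair_family e f) => -[x y].
have [c ->] := eM x; have [d ->] := fN y.
exists (fun i => match fintype.split i with inl i => c i | inr j => d j end).
rewrite pair_familyE; congr (_, _); apply: eq_bigr => i _.
  by rewrite (unsplitK (inl i : 'I_k + 'I_l)).
by rewrite (unsplitK (inr i : 'I_k + 'I_l)).
Qed.

Lemma permutation_lattice_sum M N :
  permutation_lattice M -> permutation_lattice N ->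
  permutation_lattice (M * N)%type.
Proof.
move=> [lM [k [e [eB eP]]]] [lN [l [f [fB fP]]]].
split; first exact: lattice_sum.
exists (k + l)%N, (pair_family e f); split=> [[x y]|g i].
  have [c [cx cU]] := eB x; have [d [dy dU]] := fB y.
  exists [ffun i => match fintype.split i with inl i => c i | inr j => d j end].
  split=> [|b].
    rewrite (pair_familyE e f) {1}cx {1}dy.
    congr (_, _); apply: eq_bigr => i _; rewrite ffunE.
      by rewrite (unsplitK (inl i : 'I_k + 'I_l)).
    by rewrite (unsplitK (inr i : 'I_k + 'I_l)).
  rewrite (pair_familyE e f) => -[bx yb]; apply/ffunP => i; rewrite ffunE.
  have {}cU : c = [ffun i => b (lshift l i)].
    by apply: cU; rewrite bx; apply: eq_bigr => j _; rewrite ffunE.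
  have {}dU : d = [ffun i => b (rshift k i)].
    by apply: dU; rewrite yb; apply: eq_bigr => j _; rewrite ffunE.
  rewrite -[i in RHS]splitK.
  by case: (fintype.split i) => j /=; rewrite ?cU ?dU ffunE.
rewrite -[i]splitK /pair_family; case: (fintype.split i) => j; rewrite unsplitK.
  have [j' j'P] := eP g j; exists (lshift l j').
  rewrite (unsplitK (inl j' : 'I_k + 'I_l)).
  by rewrite -j'P -[_ *: _]/(_, _) scaler0.
have [j' j'P] := fP g j; exists (rshift k j').
rewrite (unsplitK (inr j' : 'I_k + 'I_l)).
by rewrite -j'P -[_ *: _]/(_, _) scaler0.
Qed.

Lemma flabby_sum M N : flabby M -> flabby N -> flabby (M * N)%type.
Proof.
move=> fM fN H [x y]; rewrite /norm_kernel /= => xy0.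
have [] : norm_kernel H M x /\ norm_kernel H N y.
  by move: xy0; rewrite (pair_sum (mem H)) => -[].
move=> /fM[u _ ux] /fN[v _ vy]; exists (fun g => (u g, v g)) => //.
by rewrite (pair_sum (mem H)) ux vy.
Qed.

Definition zero_lattice : lmodType A := 'rV[A]_0.

Lemma zero_lattice_eq0 (m : zero_lattice) : m = 0.
Proof. by apply/rowP => -[]. Qed.

Lemma lattice0 : lattice zero_lattice.
Proof.
split=> [|r m _]; last by right; exact: zero_lattice_eq0.
exists 0%N, (fun=> 0) => m; exists (fun=> 0).
by rewrite big_ord0; exact: zero_lattice_eq0.
Qed.

Lemma permutation_lattice0 : permutation_lattice zero_lattice.
Proof.
split; first exact: lattice0.
exists 0%N, (fun=> 0); split=> [m|g []//].
exists [ffun=> 0]; split; first by rewrite big_ord0; exact: zero_lattice_eq0.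
by move=> c _; apply/ffunP => -[].
Qed.

Lemma flabby0 : flabby zero_lattice.
Proof. by move=> H m _; exists (fun=> 0) => //; rewrite [LHS]zero_lattice_eq0 [m]zero_lattice_eq0. Qed.

Lemma lmod_iso_sum0 M : lmod_iso (zero_lattice * M)%type M.
Proof.
apply: (@lmod_iso_of_fun _ _ snd) => //.
by exists (fun x => (0, x)) => [[x y]|x] //; rewrite [x]zero_lattice_eq0.
Qed.

Record flabby_lattice := FlabbyLattice {
  fl_mod :> lmodType A;
  fl_lattice : lattice fl_mod;
  fl_flabby : flabby fl_mod
}.

Arguments fl_lattice : clear implicits.
Arguments fl_flabby : clear implicits.

Definition fl_sum (M N : flabby_lattice) : flabby_lattice :=
  FlabbyLattice (lattice_sum (fl_lattice M) (fl_lattice N))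
                (flabby_sum (fl_flabby M) (fl_flabby N)).

Definition fl_zero : flabby_lattice := FlabbyLattice lattice0 flabby0.

Definition flabby_equiv M N : Prop :=
  exists P1 P2 : lmodType A, [/\ permutation_lattice P1, permutation_lattice P2 &
    lmod_iso (M * P1)%type (N * P2)%type].

Lemma iso_flabby_equiv M N : lmod_iso M N -> flabby_equiv M N.
Proof.
move=> MN; exists zero_lattice, zero_lattice.
split; [exact: permutation_lattice0..|].
exact/lmod_iso_sum/lmod_iso_refl.
Qed.

Lemma flabby_equiv_sym M N : flabby_equiv M N -> flabby_equiv N M.
Proof. by case=> P [Q [hP hQ /lmod_iso_sym]]; exists Q, P. Qed.

Lemma flabby_equiv_trans M N P :
  flabby_equiv M N -> flabby_equiv N P -> flabby_equiv M P.
Proof.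
case=> [P1 [P2 [hP1 hP2 MN]]] [Q1 [Q2 [hQ1 hQ2 NP]]].
exists (P1 * Q1)%type, (Q2 * P2)%type.
split; [exact: permutation_lattice_sum..|].
apply: lmod_iso_trans (lmod_iso_sumA _ _ _) _.
apply: lmod_iso_trans (lmod_iso_sum MN (lmod_iso_refl _)) _.
apply: lmod_iso_trans (lmod_iso_sym (lmod_iso_sumA _ _ _)) _.
apply: lmod_iso_trans (lmod_iso_sum (lmod_iso_refl _) (lmod_iso_sumC _ _)) _.
apply: lmod_iso_trans (lmod_iso_sumA _ _ _) _.
apply: lmod_iso_trans (lmod_iso_sum NP (lmod_iso_refl _)) _.
exact/lmod_iso_sym/lmod_iso_sumA.
Qed.

Lemma flabby_equiv_sum (M1 M2 N1 N2 : lmodType A) :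
  flabby_equiv M1 N1 -> flabby_equiv M2 N2 ->
  flabby_equiv (M1 * M2)%type (N1 * N2)%type.
Proof.
case=> [P1 [P2 [hP1 hP2 MN]]] [Q1 [Q2 [hQ1 hQ2 NP]]].
exists (P1 * Q1)%type, (P2 * Q2)%type.
split; [exact: permutation_lattice_sum..|].
apply: lmod_iso_trans (lmod_iso_sumACA _ _ _ _) _.
apply: lmod_iso_trans (lmod_iso_sum MN NP) _.
exact: lmod_iso_sumACA.
Qed.

(* F_{R\pi} is the set of classes of flabby lattices.  It is not presented as a
   nmodType, since its carrier, ranging over all modules, is too large for the
   universe of the carriers of eqType. *)
Definition flabby_class_monoid : Type :=
  {C : flabby_lattice -> Prop | exists M : flabby_lattice,
     C = fun N : flabby_lattice => flabby_equiv M N}.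
Local Notation F := flabby_class_monoid.

Definition flabby_class (M : flabby_lattice) : F :=
  exist _ (fun N : flabby_lattice => flabby_equiv M N) (ex_intro _ M erefl).

Lemma flabby_classP (M N : flabby_lattice) :
  flabby_class M = flabby_class N <-> flabby_equiv M N.
Proof.
split=> [|MN].
  case=> /(congr1 (fun C : flabby_lattice -> Prop => C N)) ->.
  exact/iso_flabby_equiv/lmod_iso_refl.
apply: eq_exist; apply/funext => L; apply/propext; split.
  exact/flabby_equiv_trans/flabby_equiv_sym.
exact: flabby_equiv_trans.
Qed.

Lemma flabby_class_surj (x : F) : exists M : flabby_lattice, x = flabby_class M.
Proof. by case: x => C [M CM]; exists M; apply: eq_exist. Qed.

Definition fc_repr (x : F) : flabby_lattice := sval (cid (flabby_class_surj x)).

Lemma fc_reprK (x : F) : flabby_class (fc_repr x) = x.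
Proof. by rewrite /fc_repr; case: cid. Qed.

Definition fc_zero : F := flabby_class fl_zero.

Definition fc_add (x y : F) : F :=
  flabby_class (fl_sum (fc_repr x) (fc_repr y)).

Lemma flabby_classD (M N : flabby_lattice) :
  fc_add (flabby_class M) (flabby_class N) = flabby_class (fl_sum M N).
Proof.
apply/flabby_classP/flabby_equiv_sum; exact/flabby_classP/fc_reprK.
Qed.

Lemma fc_addA : associative fc_add.
Proof.
move=> x y z; have [M ->] := flabby_class_surj x.
have [N ->] := flabby_class_surj y; have [P ->] := flabby_class_surj z.
by rewrite !flabby_classD; apply/flabby_classP/iso_flabby_equiv/lmod_iso_sumA.
Qed.

Lemma fc_addC : commutative fc_add.
Proof.
move=> x y; have [M ->] := flabby_class_surj x.
have [N ->] := flabby_class_surj y.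
by rewrite !flabby_classD; apply/flabby_classP/iso_flabby_equiv/lmod_iso_sumC.
Qed.

Lemma fc_add0 : left_id fc_zero fc_add.
Proof.
move=> x; have [M ->] := flabby_class_surj x.
by rewrite flabby_classD; apply/flabby_classP/iso_flabby_equiv/lmod_iso_sum0.
Qed.

HB.instance Definition _ :=
  Monoid.isComLaw.Build F fc_zero fc_add fc_addA fc_addC fc_add0.

(* fc_zero, the class of the zero module, is the class of every permutation
   lattice. *)
Lemma flabby_class_permutation (P : flabby_lattice) :
  permutation_lattice P -> flabby_class P = fc_zero.
Proof.
move=> hP; apply/flabby_classP; exists zero_lattice, P.
by split=> //; [exact: permutation_lattice0 | exact: lmod_iso_sumC].
Qed.

End Lattices.

Arguments norm_kernel {R gT} H M.
Arguments augmentation_submodule {R gT} H M.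
Arguments flabby_class_monoid : clear implicits.
Arguments fc_zero {R gT}.

(* Main.v *)
(* The ring R is a principal ideal domain, so M is R-free and a generator of the
   group acts on it by a matrix A with A^n = 1. As no prime p dividing n is
   ramified, the cyclotomic polynomials of order d | n stay irreducible over the
   fraction field, whence the characteristic polynomial of A becomes a product
   of polynomials X^d - 1 after adding a permutation lattice P. Write M for the
   sum, and d_1, ..., d_k for the exponents.

   Flabbiness says that the kernel of A^d - 1 on M / tM lifts to M for every
   d | n and every maximal ideal tR; its dimension is then known. Comparing
   these dimensions, M / tM is a direct sum of the F[X]/(X^(d_i) - 1) (at t | p
   the bound on the corank of the cyclotomic blocks again needs p unramified),
   with generators that lift to kernel elements in M. The Chinese remainder
   theorem glues the lifts over the finitely many maximal ideals, and the
   vectors v_i A^r, r < d_i, have unit determinant: they form an R-basis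
   permuted by the group. *)

Require Import Defs.
From HB Require Import structures.
From mathcomp Require Import all_boot all_order all_algebra all_fingroup.
From mathcomp Require Import all_solvable all_field.
From mathcomp Require Import ring zify.
From mathcomp Require Import boolp classical_sets cardinality.

Set Implicit Arguments.
Unset Strict Implicit.
Unset Printing Implicit Defensive.

Import GRing.Theory.
Local Open Scope ring_scope.

(** * Semilocal Dedekind domains *)

Section Domains.
Variable R : idomainType.
Implicit Types I J m : set R.
Local Open Scope classical_set_scope.

(** Both uses of unramifiedness rest on one inequality. Let [t] generate a maximal ideal containing
    [p], and let [Phi_(p^(b+1))(B^m) = 0] for an [s] by [s] matrix [B]. Then
    [(B^m - 1)^w = - p h(B^m)] with [w = p^(b+1) - p^b] and [h(B^m)] invertible mod [t]. As [p] has
    valuation one at [t], determinants show that the corank of [B^m - 1] mod [t] is at most [s / w].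
    For companion matrices, this keeps complementary monic factors of [Phi_(p^(b+1))(X^m)] coprime
    mod [t], whence irreducibility; for sublattices of M, it makes the reduction free over
    [F[X]/((X^m - 1)^w)].

    The obstacle is that [F[X]/(X^d - 1)] need not be semisimple when [t] divides [p], so dimensions
    of kernels alone do not exhibit summands. Generators are therefore chosen one at a time, by
    decreasing p-part of [d_i]. The socle of a new summand must meet the span of the earlier ones
    trivially; room for it comes from a lower bound, for each irreducible factor [g] of [X^d - 1],
    on the rank of [((X^d - 1)/g)(A)] on the kernel of [A^d - 1]. That bound counts only the
    exponents whose p-part is at least that of [d], which imposes the order. *)

Lemma idealB I x y : ideal I -> I x -> I y -> I (x - y).
Proof.
by case=> _ ID IM Ix Iy; apply: ID => //; rewrite -mulN1r; apply: IM.
Qed.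

Lemma idealMl I a x : ideal I -> I x -> I (x * a).
Proof. by case=> _ _ IM Ix; rewrite mulrC; apply: IM. Qed.

Lemma ideal_sum I (k : nat) (c a : 'I_k -> R) :
  ideal I -> (forall i, I (a i)) -> I (\sum_(i < k) c i * a i).
Proof.
case=> I0 ID IM Ia; elim/big_ind: _ => // i _; exact: IM.
Qed.

(** Otherwise dependent choice produces a strictly increasing chain in [P]; its union is a finitely
    generated ideal, and the generators all occur at one stage, where the chain stops. *)
Lemma noetherian_maximal (P : set (set R)) : noetherian R ->
  (exists2 I, ideal I & P I) ->
  exists I, [/\ ideal I, P I & forall J, ideal J -> P J -> I `<=` J -> J = I].
Proof.
move=> nR [I0 iI0 PI0]; apply: contrapT => noM.
pose T := {I : set R | ideal I /\ P I}.
have step (x : T) : exists y : T, sval x `<=` sval y /\ sval y <> sval x.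
  case: x => I [iI PI] /=; apply: contrapT => noy; apply: noM.
  exists I; split=> // J iJ PJ IJ; apply: contrapT => JI; apply: noy.
  by exists (exist _ J (conj iJ PJ)).
have [next nextP] := choice step.
pose x0 : T := exist _ I0 (conj iI0 PI0).
pose s k := sval (iter k next x0).
have sS k : s k `<=` s k.+1 by case: (nextP (iter k next x0)).
have sN k : s k.+1 <> s k by case: (nextP (iter k next x0)).
have sM k l : (k <= l)%N -> s k `<=` s l.
  move=> /subnK <-; elim: (l - k)%N => [|j IH] // x /IH /sS; exact.
have si k : ideal (s k) by case: (svalP (iter k next x0)).
pose U := [set x | exists k, s k x].
have iU : ideal U.
  split=> [|x y [k kx] [l ly]|a x [k kx]].
  - by exists 0%N; case: (si 0%N).
  - exists (maxn k l); have [_ sD _] := si (maxn k l).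
    apply: sD; [exact: sM (leq_maxl k l) _ kx|exact: sM (leq_maxr k l) _ ly].
  - by exists k; have [_ _ sMl] := si k; apply: sMl.
have [k [a Ua]] := nR _ iU.
have aU i : U (a i).
  rewrite Ua /=; exists (fun j => (j == i)%:R) => //.
  rewrite (bigD1 i) //= eqxx mul1r big1 ?addr0 // => j /negPf ->.
  by rewrite mul0r.
have [l lP] := choice aU.
pose L := \max_i l i.
have UL x : U x -> s L x.
  rewrite Ua => -[c _ <-]; apply: ideal_sum => // i.
  exact: sM (leq_bigmax i) _ (lP i).
apply: (sN L); apply/seteqP; split=> x sx; last exact: sS.
by apply: UL; exists L.+1.
Qed.

Lemma ideal_sub_maximal I : noetherian R -> ideal I -> ~ I 1 ->
  exists2 m, maximal_ideal m & I `<=` m.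
Proof.
move=> nR iI I1.
have [|m [im [m1 Im] mM]] :=
  @noetherian_maximal [set J | ~ J 1 /\ I `<=` J] nR.
  by exists I => //; split.
exists m => //; split=> // J iJ J1 mJ; apply: mM => //; split=> //.
exact: subset_trans Im mJ.
Qed.

Lemma maximal_ideal_inv m x : maximal_ideal m -> ~ m x ->
  exists a, m (1 - a * x).
Proof.
move=> [im m1 mM] mx; have [m0 mD mMl] := im.
pose J := [set y | exists a, m (y - a * x)].
have iJ : ideal J.
  split=> [|y z [a ya] [b zb]|c y [a ya]].
  - by exists 0; rewrite mul0r subr0.
  - by exists (a + b); rewrite (_ : _ - _ = (y - a * x) + (z - b * x)); [exact: mD|ring].
  - by exists (c * a); rewrite (_ : _ - _ = c * (y - a * x)); [exact: mMl|ring].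
have mJ : m `<=` J by move=> y my; exists 0; rewrite mul0r subr0.
have Jx : J x by exists 1; rewrite mul1r subrr.
apply: contrapT => J1; apply: mx; rewrite -(mM J iJ _ mJ) //.
Qed.

Lemma maximal_ideal_prime m x y : maximal_ideal m -> m (x * y) -> m x \/ m y.
Proof.
move=> mm mxy; have [|nx] := pselect (m x); [by left|right].
have [a ma] := maximal_ideal_inv mm nx; have [im _ _] := mm.
have [m0 mD mM] := im.
rewrite (_ : y = y * (1 - a * x) + a * (x * y)); last by ring.
by apply: (mD); apply: mM.
Qed.

Lemma maximal_ideal_exp m x k : maximal_ideal m -> m (x ^+ k) -> m x.
Proof.
move=> mm; have [_ m1 _] := mm.
by elim: k => [|k IH]; [rewrite expr0|rewrite exprS => /(maximal_ideal_prime mm)[]].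
Qed.

(* Cayley-Hamilton: multiplication by [c / a] stabilises the finitely generated
   ideal [I], so [c / a] is integral over [R]. *)
Lemma integral_stabiliser I x0 a c : noetherian R -> integrally_closed R ->
  ideal I -> I x0 -> x0 != 0 -> a != 0 ->
  (forall r, I r -> exists2 r', I r' & c * r = a * r') -> exists b, c = a * b.
Proof.
move=> nR icR iI Ix0 x00 a0 stab; have [k [g Ig]] := nR _ iI.
have gI i : I (g i).
  rewrite Ig /=; exists (fun j => (j == i)%:R) => //.
  rewrite (bigD1 i) //= eqxx mul1r big1 ?addr0 // => j /negPf ->.
  by rewrite mul0r.
have /choice[B BP] i : exists b : 'I_k -> R, c * g i = a * \sum_j b j * g j.
  by have [r' + ->] := stab _ (gI i); rewrite Ig => -[b _ <-]; exists b.
have [j gj0] : exists j, g j != 0.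
  apply: contrapT => g0; move: x00; move: Ix0; rewrite Ig => -[d _ <-].
  rewrite big1 ?eqxx // => i _; have [->|gi] := eqVneq (g i) 0.
    by rewrite mulr0.
  by case: g0; exists i.
pose f := @tofrac R; pose M := \matrix_(i < k, j < k) B j i.
have : root (char_poly (map_mx f M)) (f c / f a).
  rewrite -eigenvalue_root_char; apply/eigenvalueP.
  exists (\row_i f (g i)); last first.
    by apply/eqP => /rowP/(_ j); rewrite !mxE => /eqP; rewrite tofrac_eq0 (negPf gj0).
  apply/rowP => i; rewrite !mxE.
  have fa0 : f a != 0 by rewrite tofrac_eq0.
  apply: (mulfI fa0); rewrite [RHS]mulrA [f a * (_ / _)]mulrC divfK // -rmorphM BP.
  rewrite rmorphM rmorph_sum /=; congr (_ * _); apply: eq_bigr => l _.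
  by rewrite !mxE rmorphM mulrC.
rewrite -map_char_poly => rt.
have [|b /esym bE] := icR (f c / f a).
  by exists (char_poly M) => //; exact: char_poly_monic.
exists b; apply/eqP; rewrite -tofrac_eq rmorphM /= bE mulrC divfK //.
by rewrite tofrac_eq0.
Qed.

(** Among the ideals [(a : c)] contained in [m], a maximal one is prime, hence equal to [m] by
    dimension one. If [c/a] mapped [m] into itself it would be integral, so in [R], and [1] would
    lie in [(a : c)]. Hence [c y = a z] for some [y] in [m] and [z] outside [m], and [y] generates
    [m] once [z] is inverted. *)
Lemma maximal_ideal_locally_principal m : dedekind R -> maximal_ideal m ->
  exists y z, [/\ m y, ~ m z & forall r, m r -> exists r', z * r = y * r'].
Proof.
move=> [nR icR dim1] mm; have [im m1 mM] := mm; have [m0 mD mMl] := im.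
have [mE0|[a ma a0]] : m = [set 0] \/ exists2 a, m a & a != 0.
  have [E|E] := pselect (m = [set 0]); [by left|right].
  apply: contrapT => na; apply: E; apply/seteqP; split=> x /=; last by move->.
  by move=> mx; apply/eqP/negPn/negP => x0; apply: na; exists x.
  exists 0, 1; split=> // r; rewrite mE0 => ->; exists 0; ring.
pose colon c := [set r | exists b, r * c = a * b].
have icolon c : ideal (colon c).
  split=> [|x y [b xb] [d yd]|e x [b xb]].
  - by exists 0; rewrite mul0r mulr0.
  - by exists (b + d); rewrite mulrDl xb yd mulrDr.
  - by exists (e * b); rewrite -mulrA xb mulrCA.
have [|p [ip [[c pc] pm] pM]] := @noetherian_maximal
    [set J | (exists c, J = colon c) /\ J `<=` m] nR.
  exists (colon 1); [exact: icolon|split; first by exists 1].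
  by move=> x [b]; rewrite mulr1 => ->; exact: idealMl.
have pp : prime_ideal p.
  split=> // [/pm //|x y]; rewrite {1}pc => -[b xyb].
  have [|npx] := pselect (p x); [by left|right].
  have cxp : p `<=` colon (c * x).
    by rewrite pc => r [d rd]; exists (d * x); rewrite mulrA rd mulrA.
  have cxy : colon (c * x) y by exists b; rewrite -xyb; ring.
  (* If [(a : c x)] stays inside [m], it equals [p] by maximality and contains [y]. Otherwise it
     contains some [s] outside [m]; then [(a : c s)] contains [x], and it is still inside [m]
     because [m] is prime, so it equals [p]. *)
  have [cxm|] := pselect (colon (c * x) `<=` m).
    rewrite -(pM (colon (c * x))) //; split=> //; by exists (c * x).
  move=> /existsNP[s /not_implyP[[d sd] ms]].
  exfalso; apply: npx.
  have csp : p `<=` colon (c * s).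
    by rewrite pc => r [e re]; exists (e * s); rewrite mulrA re mulrA.
  rewrite -(pM (colon (c * s))) //.
    by exists d; rewrite -sd; ring.
  split; first by exists (c * s).
  move=> r [e re]; have : p (r * s) by rewrite pc; exists e; rewrite -re; ring.
  by move=> /pm/(maximal_ideal_prime mm)[].
have pa : p a by rewrite pc; exists c.
have [_ _ pmax] : maximal_ideal p.
  by apply: dim1 => // pE; move: pa a0; rewrite pE /= => ->; rewrite eqxx.
have mp : m = p by apply: pmax.
have [y [my] [z [yz nz]]] : exists y, m y /\ exists z, c * y = a * z /\ ~ m z.
  apply: contrapT => ny.
  have [|b cb] := @integral_stabiliser m a a c nR icR im ma a0 a0.
    move=> r mr; have [b rb] : colon c r by rewrite -pc -mp.
    exists b; last by rewrite mulrC.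
    apply: contrapT => mb; apply: ny; exists r; split=> //; exists b.
    by rewrite mulrC.
  by apply: m1; rewrite mp pc; exists b; rewrite mul1r.
exists y, z; split=> // r; rewrite mp pc => -[b rb]; exists b.
by apply: (mulfI a0); rewrite mulrA -yz mulrCA -rb; ring.
Qed.

Lemma maximal_ideal_avoid m (s : seq (set R)) : maximal_ideal m ->
  (forall I, I \in s -> maximal_ideal I /\ I <> m) ->
  exists2 x, ~ m x & forall I, I \in s -> I x.
Proof.
move=> mm; have [im m1 mM] := mm.
elim: s => [|I s IH] sP.
  by exists 1 => // I; rewrite in_nil.
have [|x mx xP] := IH.
  by move=> J Js; apply: sP; rewrite inE Js orbT.
have [[iI I1 IM] Im] : maximal_ideal I /\ I <> m by apply: sP; rewrite mem_head.
have [z Iz mz] : exists2 z, I z & ~ m z.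
  apply: contrapT => nz; apply: Im; apply/esym/IM => // z Iz.
  by apply: contrapT => mz; apply: nz; exists z.
exists (z * x); first by case/(maximal_ideal_prime mm).
move=> J; rewrite inE => /orP[/eqP->|Js]; first exact: idealMl.
have [[iJ _ _] _] : maximal_ideal J /\ J <> m by apply: sP; rewrite inE Js orbT.
by have [_ _ JM] := iJ; apply: JM; apply: xP.
Qed.

Lemma semilocal_avoid m : semilocal R -> maximal_ideal m ->
  exists q, m (1 - q) /\ forall I, maximal_ideal I -> I <> m -> I q.
Proof.
move=> /finite_seqP[s sE] mm.
have sP I : (I \in s) = `[<maximal_ideal I>].
  have := congr1 (fun S : set (set R) => S I) sE => /= E.
  by apply/idP/asboolP; rewrite E.
have [|x mx xP] := @maximal_ideal_avoid m [seq I <- s | `[<I <> m>]] mm.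
  by move=> I; rewrite mem_filter sP => /andP[/asboolP ? /asboolP].
have [w mw] := maximal_ideal_inv mm mx.
exists (w * x); split=> // I mI Im; have [[_ _ IM] _ _] := mI.
apply: IM; apply: xP.
by rewrite mem_filter sP; apply/andP; split; apply/asboolP.
Qed.

(** The local generator [y] is corrected away from [m]: with [q] in [m] and [q] congruent to 1
    modulo every other maximal ideal, [t = y (1 - q^2) + q^2] is 1 modulo the others, while at [m]
    it is [y] times a unit because [q^2] lies in the square of [m]. So for [r] in [m] the ideal of
    all [s] with [s r] in [tR] is contained in no maximal ideal. *)
Lemma maximal_ideal_principal m : dedekind R -> semilocal R ->
  maximal_ideal m -> exists t, m = [set t * a | a in [set: R]].
Proof.
move=> dR sR mm; have [im m1 mM] := mm; have [m0 mD mMl] := im.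
have [y [z [my mz yz]]] := maximal_ideal_locally_principal dR mm.
have [q' [mq' q'P]] := semilocal_avoid sR mm.
pose q := 1 - q'; pose t := y * (1 - q ^+ 2) + q ^+ 2.
have mq : m q by [].
have mt : m t.
  by apply: mD; [exact: idealMl|rewrite expr2; exact: mMl].
exists t; apply/seteqP; split=> [r mr|_ [a _ <-]]; last exact: idealMl.
pose J := [set s | exists a, s * r = t * a].
have iJ : ideal J.
  split=> [|x x' [b xb] [d yd]|e x [b xb]].
  - by exists 0; rewrite mul0r mulr0.
  - by exists (b + d); rewrite mulrDl xb yd mulrDr.
  - by exists (e * b); rewrite -mulrA xb mulrCA.
have [[a]|J1] := pselect (J 1); first by rewrite mul1r => ->; exists a.
have [nR _ _] := dR.
have [I mI JI] := ideal_sub_maximal nR iJ J1; exfalso.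
have Jt : J t by exists r.
have [Im|Im] := pselect (I = m); last first.
  have [iI I1 _] := mI; have [_ ID IM] := iI; apply: I1.
  have Iq' := q'P _ mI Im.
  rewrite (_ : 1 = t + (1 - y) * (1 + q) * q'); last by rewrite /t /q; ring.
  by apply: ID; [exact: JI|exact: IM].
have [r' zr] := yz _ mr; have [s zq] := yz _ mq.
pose v := z ^+ 2 + y * (s ^+ 2 * (1 - y)).
have vt : z ^+ 2 * t = y * v.
  rewrite /t /v (_ : _ * (_ + _) = z ^+ 2 * y + (z * q) ^+ 2 * (1 - y)); last by ring.
  by rewrite zq; ring.
have mv : ~ m v.
  move=> mv; apply: mz; apply: (@maximal_ideal_exp m z 2 mm).
  rewrite (_ : _ ^+ 2 = v - y * (s ^+ 2 * (1 - y))); last by rewrite /v; ring.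
  apply: idealB => //; exact: idealMl.
have : m (v * z).
  rewrite -Im; apply: JI; exists (z ^+ 2 * r').
  by rewrite -mulrA zr mulrCA mulrA -vt; ring.
by move=> /(maximal_ideal_prime mm)[].
Qed.

Definition principal I := exists t, I = [set t * a | a in [set: R]].

(** A maximal non-principal ideal [J] lies in some [m = tR]. The ideal [t^-1 J] contains [J]
    strictly, since otherwise [1/t] would stabilise [J] and be integral; so it is principal, and [J]
    with it. *)
Lemma semilocal_dedekind_principal I : dedekind R -> semilocal R ->
  ideal I -> principal I.
Proof.
move=> dR sR iI; apply: contrapT => npI; have [nR icR _] := dR.
have [|J [iJ npJ JM]] := @noetherian_maximal [set J | ~ principal J] nR.
  by exists I.
have J1 : ~ J 1.
  move=> J1; apply: npJ; exists 1; apply/seteqP; split=> [x _|_ [a _ <-]].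
    by exists x => //; rewrite mul1r.
  by rewrite mul1r -[a]mulr1; have [_ _ JMl] := iJ; apply: JMl.
have [m mm Jm] := ideal_sub_maximal nR iJ J1.
have [t mt] := maximal_ideal_principal dR sR mm.
have [x Jx x0] : exists2 x, J x & x != 0.
  apply: contrapT => nx; apply: npJ; exists 0; apply/seteqP; split=> [y Jy|_ [a _ <-]].
    exists 0 => //; rewrite mul0r; apply/esym/eqP/negPn/negP => y0.
    by apply: nx; exists y.
  by rewrite mul0r; case: iJ.
have t0 : t != 0.
  apply: contraNneq x0 => t0; have := Jm _ Jx; rewrite mt t0 => -[a _ <-].
  by rewrite mul0r.
pose J' := [set s | J (t * s)].
have [J0 JD JMl] := iJ.
have iJ' : ideal J'.
  split=> [|y z|e y]; rewrite /J' /= ?mulr0 ?mulrDr //; first exact: JD.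
  by move=> Jy; rewrite mulrCA; apply: JMl.
have JJ' : J `<=` J' by move=> s Js; apply: JMl.
have [E|NE] := pselect (J' = J).
  have [|b tb] := @integral_stabiliser J x t 1 nR icR iJ Jx x0 t0.
    move=> r Jr; have := Jm _ Jr; rewrite mt => -[a _ ta].
    by exists a; [rewrite -E /J' /= ta|rewrite mul1r ta].
  have [_ m1 _] := mm; apply: m1; rewrite mt; exists b => //.
have [j jE] : principal J' by apply: contrapT => npJ'; apply: NE; apply: JM.
apply: npJ; exists (t * j); apply/seteqP; split=> [r Jr|_ [a _ <-]].
  have := Jm _ Jr; rewrite mt => -[a _ ta].
  have : J' a by rewrite /J' /= ta.
  by rewrite jE => -[b _ jb]; exists b => //; rewrite -ta -jb mulrA.
have : J' (j * a) by rewrite jE; exists a.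
by rewrite /J' /= mulrA.
Qed.

Definition pid := forall I, ideal I -> principal I.

(** The cofactors are comaximal even if [a = b = 0], so that [(a', b')] is always a row of a matrix
    of determinant one. *)
Lemma pid_bezout (a b : R) : pid ->
  exists g a' b' u v, [/\ a = g * a', b = g * b' & u * a' + v * b' = 1].
Proof.
move=> pidR; pose I := [set x | exists u v, x = u * a + v * b].
have [|g Ig] := pidR I.
  split=> [|_ _ [u [v ->]] [u' [v' ->]]|c _ [u [v ->]]].
  - by exists 0, 0; ring.
  - by exists (u + u'), (v + v'); ring.
  - by exists (c * u), (c * v); ring.
have /= : I a by exists 1, 0; ring.
rewrite Ig => -[a' _ aE].
have /= : I b by exists 0, 1; ring.
rewrite Ig => -[b' _ bE].
have /= : I g by rewrite Ig; exists 1 => //; rewrite mulr1.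
case=> u [v gE]; have [g0|g0] := eqVneq g 0.
  by exists 0, 1, 0, 1, 0; split; rewrite -?aE -?bE ?g0 ?mul0r //; ring.
exists g, a', b', u, v; split=> //; apply: (mulfI g0).
by rewrite mulr1 [RHS]gE -aE -bE; ring.
Qed.

End Domains.

(** * Residue fields at maximal ideals *)

Definition ideal_pred (R : idomainType) (m : set R) (mm : maximal_ideal m) :
  {pred R} := fun x => `[<m x>].

Section ResidueField.
Variables (R : idomainType) (m : set R) (mm : maximal_ideal m).
Local Notation I := (ideal_pred mm).

Fact ideal_pred_closed : idealr_closed I.
Proof.
have [[m0 mD mM] m1 _] := mm; split; rewrite ?unfold_in; first exact/asboolP.
  by apply/asboolP.
move=> a x y; rewrite !unfold_in => /asboolP mx /asboolP my.
by apply/asboolP/mD => //; apply: mM.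
Qed.

HB.instance Definition _ := isIdealr.Build R I ideal_pred_closed.

Definition max_idealr : idealr R := I.
Definition residue_ring := {ideal_quot max_idealr}.
HB.instance Definition _ := GRing.ComNzRing.on residue_ring.

Definition residue_map (x : R) : residue_ring := (\pi_({ideal_quot max_idealr}) x)%qT.

Fact residue_map_zmod_morphism : zmod_morphism residue_map.
Proof. by move=> x y; rewrite /residue_map rmorphB. Qed.

Fact residue_map_monoid_morphism : monoid_morphism residue_map.
Proof. by split=> [|x y]; rewrite /residue_map ?rmorph1 ?rmorphM. Qed.

HB.instance Definition _ :=
  GRing.isZmodMorphism.Build R residue_ring residue_map residue_map_zmod_morphism.
HB.instance Definition _ :=
  GRing.isMonoidMorphism.Build R residue_ring residue_map
    residue_map_monoid_morphism.

Lemma residue_map_eq0 x : residue_map x = 0 <-> m x.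
Proof.
have -> : residue_map x = 0 <-> residue_map x == residue_map 0.
  by rewrite rmorph0; split=> [->|/eqP].
rewrite /residue_map -Quotient.idealrBE subr0 unfold_in.
by split=> /asboolP.
Qed.

Lemma residue_map_surj y : exists x, residue_map x = y.
Proof. by elim/quotW: y => x; exists x. Qed.

Lemma residue_inv (y : residue_ring) : exists z : residue_ring, y != 0 -> z * y = 1.
Proof.
have [x <-] := residue_map_surj y.
have [->|x0] := eqVneq (residue_map x) 0; first by exists 0.
have [|a ma] := @maximal_ideal_inv _ m x mm.
  by move=> /residue_map_eq0/eqP; rewrite (negPf x0).
exists (residue_map a) => _; apply/eqP; rewrite -rmorphM eq_sym -subr_eq0.
by rewrite -(rmorph1 residue_map) -rmorphB; apply/eqP/residue_map_eq0.
Qed.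

Definition residue_ring_inv (y : residue_ring) : residue_ring :=
  if y == 0 then 0 else sval (cid (residue_inv y)).

Fact residue_ring_mulVf y : y != 0 -> residue_ring_inv y * y = 1.
Proof.
move=> y0; rewrite /residue_ring_inv ifN //.
by case: cid => z /= /(_ y0).
Qed.

Fact residue_ring_inv0 : residue_ring_inv 0 = 0.
Proof. by rewrite /residue_ring_inv ifT. Qed.

HB.instance Definition _ := GRing.ComNzRing_isField.Build residue_ring
  residue_ring_mulVf residue_ring_inv0.

End ResidueField.

(** A residue map whose kernel is generated by [t]. The value [t = 0] is allowed, and occurs exactly
    when [R] is a field. *)
Definition residue_at (R : idomainType) (F : fieldType)
    (rho : {rmorphism R -> F}) (t : R) : Prop :=
  (forall y, exists x, rho x = y) /\
  (forall x, rho x = 0 <-> exists a, x = t * a).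

Lemma maximal_ideal_residue (R : idomainType) (m : set R) :
  dedekind R -> semilocal R -> maximal_ideal m ->
  exists (F : fieldType) (rho : {rmorphism R -> F}) (t : R),
    residue_at rho t /\ forall x, rho x = 0 <-> m x.
Proof.
move=> dR sR mm; have [t mt] := maximal_ideal_principal dR sR mm.
exists (residue_ring mm), (@residue_map R m mm), t.
split; last exact: residue_map_eq0.
split; first exact: residue_map_surj.
move=> x; rewrite residue_map_eq0 mt; split=> [[a _ <-]|[a ->]]; exists a => //.
Qed.

Lemma notin_maximal_unit (R : idomainType) (x : R) : noetherian R ->
  (forall m, maximal_ideal m -> ~ m x) -> x \is a GRing.unit.
Proof.
move=> nR xP; pose J : set R := [set y | exists a, y = a * x]%classic.
have iJ : ideal J.
  split=> [|y z [b yb] [d zd]|e y [b yb]].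
  - by exists 0; rewrite mul0r.
  - by exists (b + d); rewrite mulrDl yb zd.
  - by exists (e * b); rewrite -mulrA yb.
have [[a a1]|J1] := pselect (J 1).
  by apply/unitrP; exists a; rewrite [x * a]mulrC a1.
have [I mI JI] := ideal_sub_maximal nR iJ J1.
by case: (xP I mI); apply: JI; exists 1; rewrite mul1r.
Qed.

Lemma nonunit_maximal (R : idomainType) (x : R) : noetherian R ->
  x \isn't a GRing.unit -> exists2 m, maximal_ideal m & m x.
Proof.
move=> nR xu; apply: contrapT => nm; move/negP: xu; apply.
by apply: notin_maximal_unit nR _ => m mm mx; apply: nm; exists m.
Qed.

Lemma semilocal_CRT (R : idomainType) : semilocal R ->
  exists (k : nat) (mx : 'I_k -> set R) (e : 'I_k -> R),
  [/\ forall i, maximal_ideal (mx i),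
      forall m, maximal_ideal m -> exists i, m = mx i,
      forall i, mx i (1 - e i) &
      forall i j, i != j -> mx j (e i)].
Proof.
move=> sR; have /finite_seqP[s0 s0E] := sR.
pose s := undup s0.
have sP I : (I \in s) = `[<maximal_ideal I>].
  have := congr1 (fun S : set (set R) => S I) s0E => /= E.
  by rewrite mem_undup; apply/idP/asboolP; rewrite E.
pose mx (i : 'I_(size s)) := nth set0 s i.
have mxP i : maximal_ideal (mx i) by apply/asboolP; rewrite -sP mem_nth.
have [e eP] := choice (fun i => semilocal_avoid sR (mxP i)).
exists (size s), mx, e; split=> // [m /asboolP|i|i j ij].
- rewrite -sP => ms; have ims : (index m s < size s)%N by rewrite index_mem.
  by exists (Ordinal ims); rewrite /mx /= nth_index.
- by case: (eP i).
- have [_] := eP i; apply=> // ji; case/negP: ij; apply/eqP/val_inj/eqP.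
  by rewrite -(nth_uniq set0 _ _ (undup_uniq s0)) ?ltn_ord //; apply/eqP/esym.
Qed.

(** An intersection of maximal ideals is radical. From [p = t^2 a] one gets [(t a)^2 = p a], so
    [t a] lies in [pR = t^2 a R], and cancelling [t a] makes [t] invertible. *)
Lemma unramified_squarefree (R : idomainType) (p : nat) (t a : R) :
  unramified R p -> p%:R != 0 :> R -> p%:R = t * (t * a) -> t \is a GRing.unit.
Proof.
move=> [_ [S [SM pS]]] p0 pta.
have : (\bigcap_(I in S) I)%classic (t * a).
  move=> I SI; have mI := SM I SI; apply: (@maximal_ideal_exp _ I _ 2 mI).
  have : (\bigcap_(I in S) I)%classic (p%:R * a) by rewrite -pS; exists a.
  rewrite (_ : (t * a) ^+ 2 = p%:R * a); first exact.
  by rewrite pta; ring.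
rewrite -pS => -[b _]; rewrite pta => tb.
have ta0 : t * a != 0 by apply: contraNneq p0 => ta0; rewrite pta ta0 mulr0.
apply/unitrP; exists b; rewrite mulrC.
suff -> : t * b = 1 by [].
by apply: (mulIf ta0); rewrite mul1r -[RHS]tb; ring.
Qed.

(** * Modules over principal ideal domains *)

(** Induction on [N]: the first coordinates of [S] form a principal ideal [gR], and a preimage [v0]
    of [g] completes a basis of the vectors of [S] with first coordinate zero, unless [g = 0]. *)
Lemma submodule_basis (R : idomainType) (N : nat) (S : 'rV[R]_N -> Prop) :
  pid R -> S 0 -> (forall u v, S u -> S v -> S (u + v)) ->
  (forall a v, S v -> S (a *: v)) ->
  exists (r : nat) (E : 'M[R]_(r, N)),
    (forall w : 'rV_r, w *m E = 0 -> w = 0) /\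
    forall v, S v <-> exists w : 'rV_r, v = w *m E.
Proof.
move=> pidR; elim: N S => [|N IH] S S0 SD SZ.
  exists 0%N, 0; split=> [w _|v]; first by rewrite thinmx0.
  by rewrite [v]thinmx0; split=> // _; exists 0; rewrite mulmx0.
rewrite -[N.+1]/(1 + N)%N in S S0 SD SZ *.
have SB u v : S u -> S v -> S (u - v).
  by move=> Su Sv; apply: SD => //; rewrite -scaleN1r; apply: SZ.
have [|u v Su Sv|a v Sv|r [E [Efree ES]]] :=
    IH (fun w => S (row_mx (0 : 'M_1) w : 'rV_(1 + N))).
- by rewrite row_mx0.
- by have := SD _ _ Su Sv; rewrite add_row_mx addr0.
- by have := SZ a _ Sv; rewrite scale_row_mx scaler0.
pose fst n (v : 'rV[R]_(1 + n)) : R := lsubmx v 0 0.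
have fstE n (v : 'rV[R]_(1 + n)) : lsubmx v = (fst n v)%:M.
  exact: mx11_scalar.
have fst0 n : fst n 0 = 0 by rewrite /fst linear0 mxE.
have fstD n u v : fst n (u + v) = fst n u + fst n v.
  by rewrite /fst linearD mxE.
have fstZ n a v : fst n (a *: v) = a * fst n v by rewrite /fst linearZ mxE.
have fst_row n (v : 'rV_n) : fst n (row_mx 0 v) = 0.
  by rewrite /fst row_mxKl mxE.
pose I : set R := [set x | exists2 v, S v & fst N v = x]%classic.
have [|g Ig] := pidR I.
  split=> [|x y [v Sv vx] [w Sw wy]|a x [v Sv vx]].
  - by exists 0.
  - by exists (v + w); [exact: SD|rewrite fstD vx wy].
  - by exists (a *: v); [exact: SZ|rewrite fstZ vx].
have [v0 Sv0 v0g] : I g by rewrite Ig; exists 1; rewrite ?mulr1.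
have Sfst0 v : S v -> fst N v = 0 -> exists w : 'rV_r, v = row_mx 0 (w *m E).
  move=> Sv vf; have vE : v = row_mx 0 (rsubmx v).
    by rewrite -[LHS]hsubmxK fstE vf raddf0.
  have /ES[w wE] : S (row_mx (0 : 'M_1) (rsubmx v)) by rewrite -vE.
  by exists w; rewrite -wE.
have [g0|g0] := eqVneq g 0.
  exists r, (row_mx 0 E); split=> [w|v].
    by rewrite mul_mx_row mulmx0 -[RHS]row_mx0 => /eq_row_mx[_ /Efree].
  split=> [Sv|[w ->]]; last first.
    by rewrite mul_mx_row mulmx0; apply/ES; exists w.
  have : I (fst N v) by exists v.
  rewrite Ig => -[a _]; rewrite g0 mul0r => /esym vf.
  by have [w ->] := Sfst0 v Sv vf; exists w; rewrite mul_mx_row mulmx0.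
exists (1 + r)%N, (col_mx v0 (row_mx 0 E)).
have mulE (w : 'rV[R]_(1 + r)) :
    w *m col_mx v0 (row_mx 0 E) = fst r w *: v0 + row_mx 0 (rsubmx w *m E).
  by rewrite -{1}[w]hsubmxK mul_row_col fstE mul_scalar_mx mul_mx_row mulmx0.
split=> [w|v].
  rewrite mulE => w0; have /eqP := congr1 (fst N) w0.
  rewrite fstD fstZ fst_row fst0 v0g addr0 mulf_eq0 (negPf g0) orbF => /eqP wf.
  move: w0; rewrite wf scale0r add0r -[RHS]row_mx0 => /eq_row_mx[_ /Efree w0].
  by rewrite -[w]hsubmxK fstE wf w0 raddf0 row_mx0.
split=> [Sv|[w ->]]; last first.
  by rewrite mulE; apply: SD; [exact: SZ|apply/ES; exists (rsubmx w)].
have : I (fst N v) by exists v.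
rewrite Ig => -[a _ va].
have [||w wE] := Sfst0 (v - a *: v0).
- by apply: SB => //; apply: SZ.
- by rewrite -scaleNr fstD fstZ v0g -va; ring.
exists (row_mx a%:M w); rewrite mul_row_col mul_scalar_mx mul_mx_row mulmx0 -wE.
by rewrite addrC subrK.
Qed.

Section TorsionFree.
Variables (R : idomainType) (V : lmodType R).
Hypotheses (pidR : pid R)
           (tfV : forall (r : R) (v : V), r *: v = 0 -> r = 0 \/ v = 0).

(* Gcd steps concentrate the relation with coefficients [c] on one vector. *)
Lemma relation_gcd k (e : 'I_k.+1 -> V) (c : 'I_k.+1 -> R) :
  exists (f : 'I_k -> V) (h : V) (g : R),
  [/\ forall i, exists (a : 'I_k -> R) b, e i = \sum_j a j *: f j + b *: h,
      \sum_i c i *: e i = g *: h & g = 0 -> forall i, c i = 0].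
Proof.
elim: k e c => [|k IH] e c.
  exists (fun=> 0), (e 0), (c 0); split=> [i||c0 i].
  - by exists (fun=> 0), 1; rewrite big_ord0 add0r scale1r [i]ord1.
  - by rewrite big_ord1.
  - by rewrite [i]ord1.
have [f [h [g [sp rel g0]]]] := IH (fun i => e (lift ord0 i))
  (fun i => c (lift ord0 i)).
have [g' [a [b [u [v [c0E gE uv]]]]]] := pid_bezout (c ord0) g pidR.
(* The pair [h', f0] comes from [e ord0, h] by the matrix with rows [(a, b)] and [(-v, u)], of
   determinant [u a + v b = 1]; hence the span is unchanged. *)
pose f0 := - v *: e ord0 + u *: h.
pose h' := a *: e ord0 + b *: h.
exists (fun i => if unlift ord0 i is Some j then f j else f0), h', g'.
have e0E : e ord0 = u *: h' - b *: f0.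
  rewrite /h' /f0 !scalerDr !scalerA opprD -!scaleNr addrACA -!scalerDl.
  transitivity (1 *: e ord0 + 0 *: h); first by rewrite scale1r scale0r addr0.
  by congr (_ *: _ + _ *: _); [rewrite -uv; ring|ring].
have hE : h = v *: h' + a *: f0.
  rewrite /h' /f0 !scalerDr !scalerA addrACA -!scalerDl.
  transitivity (0 *: e ord0 + 1 *: h); first by rewrite scale1r scale0r add0r.
  by congr (_ *: _ + _ *: _); [ring|rewrite -uv; ring].
split=> [i||g'0].
- case: (unliftP ord0 i) => [j ->|->].
    have [al [be ->]] := sp j.
    exists (fun i => if unlift ord0 i is Some l then al l else be * a), (be * v).
    rewrite big_ord_recl /= unlift_none.
    under [in RHS]eq_bigr => l _ do rewrite /= liftK.
    rewrite {1}hE scalerDr !scalerA.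
    by rewrite [be * v *: _ + _]addrC addrA [_ + be * a *: _]addrC.
  exists (fun i => if unlift ord0 i is Some l then 0 else - b), u.
  rewrite big_ord_recl /= unlift_none big1 ?addr0.
    by rewrite {1}e0E addrC scaleNr.
  by move=> l _; rewrite /= liftK scale0r.
- by rewrite big_ord_recl rel c0E {1}gE /h' scalerDr !scalerA.
- move=> i; case: (unliftP ord0 i) => [j ->|->].
    by apply: g0; rewrite gE g'0 mul0r.
  by rewrite c0E g'0 mul0r.
Qed.

(** A nontrivial relation among the generators can be concentrated into [g h = 0] with [g] nonzero;
    torsion-freeness gives [h = 0], and one generator is saved. *)
Lemma torsion_free_basis k (e : 'I_k -> V) :
  (forall v, exists c : 'I_k -> R, v = \sum_i c i *: e i) ->
  exists (r : nat) (f : 'I_r -> V),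
    (forall v, exists c : 'I_r -> R, v = \sum_i c i *: f i) /\
    (forall c : 'I_r -> R, \sum_i c i *: f i = 0 -> forall i, c i = 0).
Proof.
elim: k e => [|k IH] e gen.
  by exists 0%N, e; split=> // c _ [].
have [[c [rel [i ci]]]|free] :=
  pselect (exists c : 'I_k.+1 -> R, \sum_i c i *: e i = 0 /\ exists i, c i <> 0).
- have [f [h [g [sp]]]] := relation_gcd e c.
  rewrite rel => /esym/tfV[g0 /(_ g0)/(_ i)//|h0 _].
  apply: (IH f) => v; have [d ->] := gen v.
  have [a aE] := choice sp.
  exists (fun j => \sum_i d i * a i j).
  under [RHS]eq_bigr => j _ do rewrite scaler_suml.
  rewrite exchange_big /=; apply: eq_bigr => l _.
  have [b {1}->] := aE l; rewrite h0 scaler0 addr0 scaler_sumr.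
  by apply: eq_bigr => j _; rewrite scalerA.
- exists k.+1, e; split=> // c rel i; apply: contrapT => ci.
  by apply: free; exists c; split=> //; exists i.
Qed.

End TorsionFree.

(** * Polynomials in a matrix *)

(* [horner_mx] requires a positive dimension, while sublattices may be zero. *)
Definition hmx (R : comNzRingType) n : 'M[R]_n -> {poly R} -> 'M[R]_n :=
  if n is n'.+1 then fun A p => horner_mx A p else fun _ _ => 0.

Section HornerMatrix.
Variable R : comNzRingType.
Implicit Types p q : {poly R}.

Lemma hmx0 n (A : 'M[R]_n) : hmx A 0 = 0.
Proof. by case: n A => [|n] A //=; rewrite rmorph0. Qed.

Lemma hmxC n (A : 'M[R]_n) a : hmx A a%:P = a%:M.
Proof. by case: n A => [|n] A /=; [rewrite [RHS]thinmx0|rewrite horner_mx_C]. Qed.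

Lemma hmx1 n (A : 'M[R]_n) : hmx A 1 = 1%:M.
Proof. exact: hmxC. Qed.

Lemma hmxX n (A : 'M[R]_n) : hmx A 'X = A.
Proof. by case: n A => [|n] A /=; [rewrite [RHS]thinmx0|rewrite horner_mx_X]. Qed.

Lemma hmxD n (A : 'M[R]_n) p q : hmx A (p + q) = hmx A p + hmx A q.
Proof. by case: n A => [|n] A /=; [rewrite addr0|rewrite rmorphD]. Qed.

Lemma hmxN n (A : 'M[R]_n) p : hmx A (- p) = - hmx A p.
Proof. by case: n A => [|n] A /=; [rewrite oppr0|rewrite rmorphN]. Qed.

Lemma hmxB n (A : 'M[R]_n) p q : hmx A (p - q) = hmx A p - hmx A q.
Proof. by rewrite hmxD hmxN. Qed.

Lemma hmxM n (A : 'M[R]_n) p q : hmx A (p * q) = hmx A p *m hmx A q.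
Proof. by case: n A => [|n] A /=; [rewrite mulmx0|rewrite rmorphM]. Qed.

Lemma hmxZ n (A : 'M[R]_n) a p : hmx A (a *: p) = a *: hmx A p.
Proof. by rewrite -mul_polyC hmxM hmxC mul_scalar_mx. Qed.

Lemma hmxXn n (A : 'M[R]_n) p k : hmx A (p ^+ k) = hmx A p ^+ k.
Proof.
elim: k => [|k IH]; first by rewrite !expr0 hmx1.
by rewrite !exprS hmxM IH.
Qed.

Lemma hmx_Xn_sub1 n (A : 'M[R]_n) k : hmx A ('X^k - 1) = A ^+ k - 1%:M.
Proof. by rewrite hmxB hmxXn hmxX hmx1. Qed.

Lemma hmx_sum n (A : 'M[R]_n) (I : Type) (r : seq I) (P : pred I)
    (F : I -> {poly R}) :
  hmx A (\sum_(i <- r | P i) F i) = \sum_(i <- r | P i) hmx A (F i).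
Proof. by elim/big_rec2: _ => [|i x y _ <-]; rewrite (hmx0, hmxD). Qed.

Lemma hmx_comm n (A : 'M[R]_n) p q : hmx A p *m hmx A q = hmx A q *m hmx A p.
Proof. by rewrite -!hmxM mulrC. Qed.

Lemma hmx_commX n (A : 'M[R]_n) p : hmx A p *m A = A *m hmx A p.
Proof. by have := hmx_comm A p 'X; rewrite hmxX. Qed.

Lemma hmx_intertwine r n (E : 'M[R]_(r, n)) (A : 'M[R]_n) (B : 'M[R]_r) p :
  E *m A = B *m E -> E *m hmx A p = hmx B p *m E.
Proof.
move=> EA; elim/poly_ind: p => [|p c IH]; first by rewrite !hmx0 mulmx0 mul0mx.
rewrite !hmxD !hmxM !hmxX !hmxC mulmxDr mulmxDl mulmxA IH -!mulmxA EA.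
by rewrite scalar_mxC.
Qed.

Lemma Cayley_Hamilton_hmx n (A : 'M[R]_n) : hmx A (char_poly A) = 0.
Proof. by case: n A => [|n] A //=; exact: Cayley_Hamilton. Qed.

(* [G(X) - G(y)] is a multiple of [X - y]; take determinants. *)
Lemma char_poly_dvd_annihilator n (y : 'M[R]_n) G :
  hmx y G = 0 -> exists Q, G ^+ n = char_poly y * Q.
Proof.
move=> yG; suff [Q QE] : exists Q : 'M[{poly R}]_n,
    G%:M - map_mx polyC (hmx y G) = char_poly_mx y *m Q.
  exists (\det Q); rewrite -det_mulmx -QE yG map_mx0 subr0.
  by rewrite det_scalar.
elim/poly_ind: G {yG} => [|p c [Q IH]].
  by exists 0; rewrite hmx0 map_mx0 raddf0 subrr mulmx0.
exists ('X *: Q + map_mx polyC (hmx y p)).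
rewrite hmxD hmxM hmxX hmxC raddfD /= map_mxD map_mxM map_scalar_mx.
rewrite opprD addrACA subrr addr0 mulmxDr -scalemxAr -IH.
have cy : map_mx polyC (hmx y p) *m map_mx polyC y =
    map_mx polyC y *m map_mx polyC (hmx y p) :> 'M[{poly R}]_n.
  by rewrite -!map_mxM hmx_commX.
rewrite cy /char_poly_mx mulmxBl mul_scalar_mx scalerBr -scalemx1.
by rewrite -(scalemx1 _ p) scalerA [p * 'X]mulrC addrA subrK.
Qed.

End HornerMatrix.

Lemma map_hmx (R S : comNzRingType) (f : {rmorphism R -> S}) n (A : 'M[R]_n) p :
  map_mx f (hmx A p) = hmx (map_mx f A) (map_poly f p).
Proof.
case: n A => [|n] A /=; first by rewrite [LHS]thinmx0.
exact: map_horner_mx.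
Qed.

(** * Kernels of coprime polynomials over a field *)

Section FieldMatrix.
Variable F : fieldType.
Implicit Types p q : {poly F}.

Lemma char_poly_conj m n (U : 'M[F]_(m, n)) (A : 'M[F]_n) (B : 'M[F]_m) :
  row_free U -> m = n -> U *m A = B *m U -> char_poly A = char_poly B.
Proof.
move=> Ufree mn; case: _ / mn A => A in U Ufree *; rewrite row_free_unit in Ufree => UA.
pose V := map_mx polyC U.
have : V *m char_poly_mx A = char_poly_mx B *m V.
  by rewrite /char_poly_mx mulmxBr mulmxBl -!map_mxM UA scalar_mxC.
move/(congr1 determinant); rewrite !det_mulmx mulrC => /mulIf; apply.
by rewrite det_map_mx polyC_eq0 -unitfE -unitmxE.
Qed.

Lemma char_poly_block_diag (R : comNzRingType) m n (A : 'M[R]_m) (B : 'M[R]_n) :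
  char_poly (block_mx A 0 0 B) = char_poly A * char_poly B.
Proof. by rewrite /char_poly char_block_diag_mx det_ublock. Qed.

Lemma kermx_hmxM n (A : 'M[F]_n) p q : coprimep p q ->
  (kermx (hmx A (p * q)) :=: kermx (hmx A p) + kermx (hmx A q))%MS.
Proof.
case: n A => [|n] A; first by rewrite !thinmx0.
exact: kermxpolyM.
Qed.

Lemma hmx_dvd_eq0 m n (A : 'M[F]_n) (V : 'M_(m, n)) p q :
  p %| q -> V *m hmx A p = 0 -> V *m hmx A q = 0.
Proof.
by move=> /dvdpP[r ->] V0; rewrite mulrC hmxM mulmxA V0 mul0mx.
Qed.

Lemma hmx_gcd_eq0 m n (A : 'M[F]_n) (V : 'M_(m, n)) p q :
  V *m hmx A p = 0 -> V *m hmx A q = 0 -> V *m hmx A (gcdp p q) = 0.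
Proof.
move=> Vp Vq; have [[u v] uv] := Bezoutp p q.
have /hmx_dvd_eq0 : u * p + v * q %| gcdp p q by rewrite (eqp_dvdl _ uv).
apply; rewrite hmxD mulmxDr ![_ * p]mulrC ![_ * q]mulrC !hmxM !mulmxA Vp Vq.
by rewrite !mul0mx addr0.
Qed.

Lemma hmx_coprime_eq0 m n (A : 'M[F]_n) (V : 'M_(m, n)) p q : coprimep p q ->
  V *m hmx A p = 0 -> V *m hmx A q = 0 -> V = 0.
Proof.
move=> cpq Vp Vq; have := hmx_gcd_eq0 Vp Vq.
have gcd1 : gcdp p q %| 1 by rewrite dvdp1 -coprimep_def.
by move=> /(hmx_dvd_eq0 gcd1); rewrite hmx1 mulmx1.
Qed.

Lemma stablemx_hmx_ker n (A : 'M[F]_n) p : stablemx (kermx (hmx A p)) A.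
Proof.
by apply/sub_kermxP; rewrite -mulmxA -hmx_commX mulmxA mulmx_ker mul0mx.
Qed.

(** The kernels of [G] and [H] span the space and meet trivially, so [A] is conjugate to a block
    diagonal matrix with blocks [B] and [B']. The block [B] is killed by [G] and [B'] by [H], so
    their characteristic polynomials divide powers of [G] and [H]; coprimality separates the two
    factors of [G H]. *)
Lemma char_poly_ker_factor n r (A : 'M[F]_n) (G H : {poly F}) (E : 'M_(r, n)) B :
  char_poly A = G * H -> G \is monic -> H \is monic -> coprimep G H ->
  row_free E -> (E :=: kermx (hmx A G))%MS -> E *m A = B *m E ->
  char_poly B = G.
Proof.
move=> chiA Gm Hm cGH Efree EG EA.
pose E' := row_base (kermx (hmx A H)).
have E'free : row_free E' by apply: row_base_free.
have E'H : (E' :=: kermx (hmx A H))%MS by apply: eq_row_base.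
pose B' := E' *m A *m pinvmx E'.
have E'A : E' *m A = B' *m E'.
  rewrite mulmxKpV //; apply: submx_trans (submxMr _ _) _; first by rewrite E'H.
  by rewrite E'H stablemx_hmx_ker.
have EG0 : E *m hmx A G = 0 by apply/sub_kermxP; rewrite EG.
have E'H0 : E' *m hmx A H = 0 by apply/sub_kermxP; rewrite E'H.
pose U := col_mx E E'.
have UA : U *m A = block_mx B 0 0 B' *m U.
  by rewrite mul_col_mx EA E'A mul_block_col !mul0mx addr0 add0r.
have U1 : (U :=: 1%:M)%MS.
  apply: eqmx_trans (eqmx_sym (addsmxE _ _)) _.
  apply: eqmx_trans (adds_eqmx EG E'H) _.
  apply: eqmx_trans (eqmx_sym (kermx_hmxM A cGH)) _.
  by rewrite -chiA Cayley_Hamilton_hmx; exact: kermx0.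
have cap0 : (E :&: E' = 0)%MS.
  apply/eqP/rowV0P => v; rewrite sub_capmx EG E'H => /andP[/sub_kermxP v1 /sub_kermxP v2].
  exact: hmx_coprime_eq0 cGH v1 v2.
have rkU : \rank U = (r + \rank (kermx (hmx A H)))%N.
  rewrite -addsmxE mxrank_disjoint_sum // (eqP Efree); congr (_ + _)%N.
  by rewrite E'H.
have Ufree : row_free U by rewrite /row_free rkU.
have dimE : (r + \rank (kermx (hmx A H)))%N = n by rewrite -rkU U1 mxrank1.
have chi : G * H = char_poly B * char_poly B'.
  by rewrite -chiA (char_poly_conj Ufree dimE UA) char_poly_block_diag.
have [Q GQ] : exists Q, G ^+ r = char_poly B * Q.
  apply: char_poly_dvd_annihilator; apply: (row_free_inj Efree).
  by rewrite -(hmx_intertwine _ EA) EG0 mul0mx.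
have [Q' HQ] : exists Q, H ^+ \rank (kermx (hmx A H)) = char_poly B' * Q.
  apply: char_poly_dvd_annihilator; apply: (row_free_inj E'free).
  by rewrite -(hmx_intertwine _ E'A) E'H0 mul0mx.
apply/eqP; rewrite -eqp_monic ?char_poly_monic //; apply/andP; split.
  have : char_poly B %| G * H by rewrite chi dvdp_mulr.
  rewrite Gauss_dvdpl //; apply: coprimep_dvdr (coprimep_expl r cGH).
  by rewrite GQ dvdp_mulr.
have : G %| char_poly B * char_poly B' by rewrite -chi dvdp_mulr.
rewrite Gauss_dvdpl //.
apply: coprimep_dvdl (coprimep_expr (\rank (kermx (hmx A H))) cGH).
by rewrite HQ dvdp_mulr.
Qed.

Lemma rank_ker_factor n (A : 'M[F]_n) (G H : {poly F}) :
  char_poly A = G * H -> G \is monic -> H \is monic -> coprimep G H ->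
  \rank (kermx (hmx A G)) = (size G).-1.
Proof.
move=> chiA Gm Hm cGH; set K := kermx _; pose E := row_base K.
have EK : (E :=: K)%MS by apply: eq_row_base.
have EA : E *m A = (E *m A *m pinvmx E) *m E.
  rewrite mulmxKpV //; apply: submx_trans (submxMr _ _) _; first by rewrite EK.
  by rewrite EK stablemx_hmx_ker.
rewrite -(char_poly_ker_factor chiA Gm Hm cGH (row_base_free K) EK EA).
by rewrite size_char_poly.
Qed.

End FieldMatrix.

Lemma residue_lift_mx (R : idomainType) (F : fieldType) (rho : {rmorphism R -> F})
    (t : R) m n (A : 'M[F]_(m, n)) :
  residue_at rho t -> exists B : 'M[R]_(m, n), map_mx rho B = A.
Proof.
case=> rho_surj _; have [l lP] := choice rho_surj.
by exists (map_mx l A); apply/matrixP => i j; rewrite !mxE lP.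
Qed.

Lemma residue_mx_eq0 (R : idomainType) (F : fieldType) (rho : {rmorphism R -> F})
    (t : R) m n (A : 'M[R]_(m, n)) :
  residue_at rho t -> map_mx rho A = 0 -> exists B, A = t *: B.
Proof.
case=> _ rho0 A0.
have /choice[b bP] (ij : 'I_m * 'I_n) : exists a, A ij.1 ij.2 = t * a.
  by apply/rho0; have := congr1 (fun M : 'M_(_, _) => M ij.1 ij.2) A0; rewrite !mxE.
by exists (\matrix_(i, j) b (i, j)); apply/matrixP => i j; rewrite !mxE (bP (i, j)).
Qed.

Lemma prod_ord_ltn (R : comNzRingType) (t : R) s r : (r <= s)%N ->
  \prod_(i < s) (if (i < r)%N then 1 else t) = t ^+ (s - r).
Proof.
move=> /subnKC; move: (s - r)%N => k <-; rewrite big_split_ord /= big1 ?mul1r.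
  rewrite -[in RHS](card_ord k) -prodr_const; apply: eq_bigr => i _.
  by rewrite ltnNge leq_addr.
by move=> i _; rewrite ltn_ord.
Qed.

(** Row operations lifted from [F] make the rows of [C] below its rank vanish mod [t], and a factor
    [t] comes out of each of them. The determinant [u] of the lifted operations is nonzero in
    [F]. *)
Lemma corank_det (R : idomainType) (F : fieldType) (rho : {rmorphism R -> F})
    (t : R) s (C : 'M[R]_s) : residue_at rho t ->
  exists u d, rho u != 0 /\ u * \det C = t ^+ \rank (kermx (map_mx rho C)) * d.
Proof.
move=> res; set Cb := map_mx rho C; pose r := \rank Cb.
have [U UE] := residue_lift_mx (invmx (col_ebase Cb)) res.
have rs : (r <= s)%N by apply: rank_leq_row.
have UCb : map_mx rho (U *m C) = pid_mx r *m row_ebase Cb.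
  rewrite map_mxM UE -/Cb -{2}(mulmx_ebase Cb) -!mulmxA mulKmx //.
  exact: col_ebase_unit.
have [_ rho0] := res.
have /choice[c cP] (ij : 'I_s * 'I_s) :
    exists a, (r <= ij.1)%N -> (U *m C) ij.1 ij.2 = t * a.
  case: ij => i j /=; have [ir|ir] := ltnP i r; first by exists 0.
  suff /rho0[a aE] : rho ((U *m C) i j) = 0 by exists a.
  have := congr1 (fun M : 'M_(_, _) => M i j) UCb; rewrite !mxE => ->.
  rewrite big1 // => k _; rewrite !mxE; by rewrite ltnNge ir andbF mul0r.
pose C' := \matrix_(i, j) if (i < r)%N then (U *m C) i j else c (i, j).
have UC : U *m C = diag_mx (\row_i if (i < r)%N then 1 else t) *m C'.
  apply/matrixP => i j; rewrite mul_diag_mx !mxE; case: ltnP => ir.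
    by rewrite mul1r.
  by rewrite -(cP (i, j) ir) mxE.
exists (\det U), (\det C'); split.
  by rewrite -det_map_mx UE -unitfE -unitmxE unitmx_inv col_ebase_unit.
rewrite -det_mulmx UC det_mulmx det_diag mxrank_ker -/r; congr (_ * _).
rewrite -(prod_ord_ltn t rs); apply: eq_bigr => i _; by rewrite mxE.
Qed.

(** * Coranks at ramified primes *)

(** The quotient of [X^(a b) - 1] by [X^a - 1]. For [p] prime, [geo (p ^ b) p] is the cyclotomic
    polynomial of order [p^(b+1)], and [geo (m * p ^ b) p] is its value at [X^m]. *)
Definition geo (R : nzRingType) (a b : nat) : {poly R} := \sum_(j < b) 'X^(a * j).

Lemma geoE (R : comNzRingType) a b : ('X^a - 1) * geo R a b = 'X^(a * b) - 1.
Proof.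
rewrite exprM -[in RHS](expr1n _ b) subrXX; congr (_ * _).
rewrite /geo [in RHS](reindex_inj rev_ord_inj) /=; apply: eq_bigr => j _.
rewrite expr1n mulr1 exprM; congr (_ ^+ _).
by case: b j => [[]//|b] j; rewrite subSS subKn // -ltnS.
Qed.

Lemma map_geo (R S : nzRingType) (f : {rmorphism R -> S}) a b :
  map_poly f (geo R a b) = geo S a b.
Proof.
by rewrite /geo rmorph_sum; apply: eq_bigr => j _; rewrite rmorphXn /= map_polyX.
Qed.

Lemma geo_comp (R : comNzRingType) a b m :
  geo R a b \Po 'X^m = geo R (m * a) b.
Proof.
rewrite /geo rmorph_sum /=; apply: eq_bigr => j _.
by rewrite comp_Xn_poly -exprM mulnA.
Qed.

Lemma Xn_sub1_neq0 (R : nzRingType) n : (0 < n)%N -> 'X^n - 1 != 0 :> {poly R}.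
Proof. by move=> n0; rewrite -size_poly_eq0 size_XnsubC. Qed.

Lemma Xn_sub1_monic (R : nzRingType) n : (0 < n)%N -> 'X^n - 1 \is @monic R.
Proof. exact: monicXnsubC. Qed.

Lemma Xn_sub1_Frobenius (R : comNzRingType) (p a b : nat) : p \in [pchar R] ->
  ('X^a - 1 : {poly R}) ^+ (p ^ b) = 'X^(a * p ^ b) - 1.
Proof.
move=> pR; have pP : p \in [pchar {poly R}].
  by rewrite pchar_poly.
elim: b => [|b IH]; first by rewrite expn0 muln1 expr1.
rewrite expnSr exprM IH -(pFrobenius_autE pP) rmorphB rmorph1 /=.
by rewrite pFrobenius_autE -exprM mulnA.
Qed.

Lemma geo_pchar (R : idomainType) (p a b : nat) : p \in [pchar R] -> (0 < a)%N ->
  geo R (a * p ^ b) p = ('X^a - 1) ^+ (p ^ b.+1 - p ^ b).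
Proof.
move=> pR a0; have p_gt0 : (0 < p)%N by apply/prime_gt0/(pcharf_prime pR).
have nz : 'X^(a * p ^ b) - 1 != 0 :> {poly R}.
  by rewrite Xn_sub1_neq0 // muln_gt0 a0 expn_gt0 p_gt0.
apply: (mulfI nz); rewrite geoE -mulnA -expnSr -!Xn_sub1_Frobenius // -exprD.
by rewrite subnKC // leq_exp2l ?prime_gt1 // (pcharf_prime pR).
Qed.

(** The congruence mod [p] is Frobenius over the prime field. At [X = 1] the left side is [p] and
    the power of [X - 1] vanishes, so [p = p h(1)]. *)
Lemma geo_int_expansion (p b : nat) : prime p -> exists h : {poly int},
  geo int (p ^ b) p = ('X - 1) ^+ (p ^ b.+1 - p ^ b) + p%:R *: h /\ h.[1] = 1.
Proof.
move=> pp; pose w := (p ^ b.+1 - p ^ b)%N.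
pose D := geo int (p ^ b) p - ('X - 1) ^+ w.
have pF : p \in [pchar 'F_p] by apply: pchar_Fp.
have D0 : map_poly (intr : int -> 'F_p) D = 0.
  rewrite rmorphB /= map_geo rmorphXn rmorphB /= rmorph1 map_polyX.
  have := geo_pchar b pF (ltn0Sn 0); rewrite mul1n expr1 => ->.
  by rewrite subrr.
have /choice[h hP] i : exists c, D`_i = p%:R * c.
  have /eqP := congr1 (fun q : {poly 'F_p} => q`_i) D0.
  rewrite coef_map coef0 /= -(dvdz_pcharf pF) => /dvdzP[c ->].
  by exists c; rewrite mulrC natz.
have DE : D = p%:R *: \poly_(i < size D) h i.
  apply/polyP => i; rewrite coefZ coef_poly; case: ltnP => iD; first exact: hP.
  by rewrite nth_default // mulr0.
exists (\poly_(i < size D) h i); split; first by rewrite -DE addrC subrK.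
have := congr1 (horner^~ 1) DE.
rewrite hornerZ {1}/D hornerD hornerN horner_exp !hornerE subrr expr0n.
have -> : (w == 0%N) = false.
  apply/negbTE; rewrite -lt0n subn_gt0 ltn_exp2l //; exact: prime_gt1.
rewrite subr0 /geo horner_sum.
under eq_bigr => j _ do rewrite hornerXn expr1n.
have p0 : p%:R != 0 :> int by rewrite Num.Theory.pnatr_eq0 -lt0n prime_gt0.
by rewrite sumr_const card_ord -[X in X = _]mulr1 => /(mulfI p0).
Qed.

Lemma dvdp_comp_sub (R : idomainType) (h a b : {poly R}) :
  exists q, (h \Po a) - (h \Po b) = (a - b) * q.
Proof.
elim/poly_ind: h => [|h c [q IH]]; first by exists 0; rewrite !comp_poly0; ring.
exists (q * a + (h \Po b)).
rewrite !comp_polyD !comp_polyM !comp_polyX !comp_polyC.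
have -> : h \Po a = (h \Po b) + (a - b) * q by rewrite -IH; ring.
by ring.
Qed.

Section RamifiedLattice.
Variables (R : idomainType) (F : fieldType) (rho : {rmorphism R -> F}) (t p' : R).
Variable p : nat.
Hypotheses (res : residue_at rho t) (t0 : t != 0) (pp : prime p)
           (pE : p%:R = t * p') (rp' : rho p' != 0).

Lemma residue_prime0 : p%:R = 0 :> F.
Proof. by have [_ rho0] := res; rewrite -(rmorph_nat rho); apply/rho0; exists p'. Qed.

Lemma residue_pchar : p \in [pchar F].
Proof. by rewrite inE pp residue_prime0 eqxx. Qed.

Lemma residue_dvd_exp k l u d : rho u != 0 -> t ^+ k * d = t ^+ l * u ->
  (k <= l)%N.
Proof.
move=> ru E; rewrite leqNgt; apply: contra ru => lk.
have [_ rho0] := res; apply/eqP/rho0; exists (t ^+ (k - l.+1) * d).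
apply: (mulfI (expf_neq0 l t0)); rewrite -E !mulrA -exprSr -exprD.
by rewrite subnKC.
Qed.

(* With [T = B ^ m], [Phi_{p^(b+1)}(T) = 0] reads [(T - 1)^w = - p h(T)] with
   [h(T)] invertible at [t]; compare the [t]-valuations of the determinants. *)
Lemma ramified_corank s (B : 'M[R]_s) (m b : nat) :
  hmx B (geo R (m * p ^ b) p) = 0 ->
  (\rank (kermx (hmx (map_mx rho B) ('X^m - 1))) * (p ^ b.+1 - p ^ b) <= s)%N.
Proof.
set w := (p ^ b.+1 - p ^ b)%N => B0.
have [h [hE h1]] := geo_int_expansion b pp.
pose hR := map_poly (intr : int -> R) h \Po 'X^m.
have geoR : geo R (m * p ^ b) p = ('X^m - 1) ^+ w + p%:R *: hR.
  rewrite -geo_comp -(map_geo (intr : {rmorphism int -> R})) hE.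
  rewrite rmorphD rmorphXn rmorphB /= rmorph1 map_polyX map_polyZ /=.
  rewrite comp_polyD comp_polyZ rmorphXn /= rmorphB /= comp_polyX comp_polyC.
  by rewrite rmorph_nat.
have fw : hmx B ('X^m - 1) ^+ w = - p%:R *: hmx B hR.
  move/eqP: B0; rewrite geoR hmxD hmxXn hmxZ addr_eq0 => /eqP->.
  by rewrite scaleNr.
pose Bb := map_mx rho B; pose hF := map_poly rho hR.
(* Since [h(1) = 1], [hF] is 1 plus a multiple of [X^m - 1], hence coprime to the power
   [(X^m - 1)^w], which kills the reduction of [B]. *)
have uh : hmx Bb hF \in unitmx.
  have Bb0 : hmx Bb (('X^m - 1) ^+ w) = 0.
    have := congr1 (map_mx rho) B0.
    rewrite map_hmx map_geo map_mx0 /Bb => <-; congr hmx.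
    (* For [m = 0] the polynomial [geo] is the constant [p], which is zero in [F], and [(X^0 - 1)^w]
       is zero because [w] is positive. *)
    have m0 : (0 < m)%N \/ m = 0%N by case: (m) => [|?]; [right|left].
    case: m0 => [m0|->]; first by rewrite (geo_pchar _ residue_pchar m0).
    rewrite mul0n /geo expr0 subrr expr0n.
    have -> : (w == 0%N) = false.
      apply/negbTE; rewrite -lt0n subn_gt0 ltn_exp2l //; exact: prime_gt1.
    rewrite (eq_bigr (fun=> 1)) => [|j _ //].
    by rewrite sumr_const card_ord -(polyC_natr _ p) residue_prime0.
  have h'1 : map_poly (intr : int -> F) h \Po 1 = 1.
    by rewrite comp_polyCr -[X in _.[X]](rmorph1 (intr : int -> F)) horner_map h1 rmorph1.
  have [q hq] := dvdp_comp_sub (map_poly (intr : int -> F) h) 'X^m 1.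
  have hFE : hF = 1 + ('X^m - 1) * q.
    rewrite -hq /hF /hR map_comp_poly rmorphXn /= map_polyX.
    rewrite -[X in X \Po 'X^m]map_poly_comp.
    have -> : map_poly (rho \o intr) h = map_poly (intr : int -> F) h.
      by apply: eq_map_poly => x; rewrite /= rmorph_int.
    by rewrite h'1 addrC subrK.
  have cop : coprimep hF (('X^m - 1) ^+ w).
    apply: coprimep_expr; rewrite hFE coprimep_sym [1 + _]addrC [_ * q]mulrC.
    by rewrite coprimep_addl_mul coprimep1.
  have [[u v] /= uv] := Bezout_eq1_coprimepP _ _ cop.
  have : hmx Bb u *m hmx Bb hF = 1%:M.
    rewrite -hmxM -(hmx1 Bb) -uv hmxD [X in _ + X]hmxM.
    by rewrite Bb0 mulmx0 addr0.
  by move/mulmx1_unit => [].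
have [u [d [ru detE]]] := corank_det (hmx B ('X^m - 1)) res.
rewrite map_hmx rmorphB /= rmorphXn /= map_polyX rmorph1 in detE.
set k := \rank _ in detE *.
have detfw : \det (hmx B ('X^m - 1)) ^+ w = (- p%:R) ^+ s * \det (hmx B hR).
  rewrite -detZ -fw; elim: (w) => [|i IH]; first by rewrite !expr0 det1.
  by rewrite !exprS det_mulmx IH.
(* With [k] the corank, determinants in [fw] give [t^(k w) d^w = t^s] times an element that is
   nonzero mod [t], because [p = t p']. *)
apply: (@residue_dvd_exp _ _ (u ^+ w * (- p') ^+ s * \det (hmx B hR)) (d ^+ w)).
  rewrite !rmorphM !rmorphXn rmorphN !mulf_neq0 ?expf_neq0 ?oppr_eq0 //.
  by rewrite -det_map_mx map_hmx -unitfE -unitmxE.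
rewrite exprM -exprMn -detE exprMn detfw pE -mulrN exprMn; ring.
Qed.

End RamifiedLattice.

(** * Lattices in kernels of polynomials *)

Lemma fraction_of (R : idomainType) (x : {fraction R}) :
  exists a b : R, b != 0 /\ x * tofrac b = tofrac a.
Proof.
elim/quotW: x => r; exists (frac r).1, (frac r).2; split.
  exact: denom_ratioP.
rewrite !piE /=; apply/eqmodP; rewrite /= FracField.equivfE /FracField.mulf.
by rewrite !numden_Ratio ?mulf_neq0 ?oner_eq0 ?denom_ratioP // !mulr1 mulrC.
Qed.

Lemma clear_denominators (R : idomainType) n (v : 'rV[{fraction R}]_n) :
  exists2 c : R, c != 0 &
    exists u : 'rV[R]_n, tofrac c *: v = map_mx (@tofrac R) u.
Proof.
have /choice[ab abP] j : exists ab : R * R,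
    ab.2 != 0 /\ v 0 j * tofrac ab.2 = tofrac ab.1.
  by have [a [b abP]] := fraction_of (v 0 j); exists (a, b).
exists (\prod_j (ab j).2).
  by apply/prodf_neq0 => j _; case: (abP j).
exists (\row_j ((ab j).1 * \prod_(i | i != j) (ab i).2)); apply/rowP => j.
rewrite !mxE rmorphM /=; have [_ <-] := abP j.
rewrite (bigD1 j) //= rmorphM /= mulrC mulrA; congr (_ * _).
Qed.

Lemma clear_poly_denominators (R : idomainType) (f : {poly {fraction R}}) :
  exists2 c : R, c != 0 &
    exists g : {poly R}, tofrac c *: f = map_poly (@tofrac R) g.
Proof.
have [c c0 [u uE]] := clear_denominators (poly_rV f : 'rV_(size f)).
exists c => //; exists (rVpoly u).
rewrite map_rVpoly -uE linearZ /= poly_rV_K //.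
Qed.

Section KernelLattice.
Variable R : idomainType.
Hypothesis pidR : pid R.
Local Notation K := {fraction R}.
Local Notation toK := (@tofrac R).

Lemma tofrac_mx_inj m n : injective (map_mx toK : 'M_(m, n) -> 'M_(m, n)).
Proof.
move=> A B /matrixP AB; apply/matrixP => i j; apply/eqP.
by have := AB i j; rewrite !mxE => /eqP; rewrite tofrac_eq.
Qed.

Definition kernel_basis n r (A : 'M[R]_n) (h : {poly R}) (E : 'M[R]_(r, n)) :=
  (forall w : 'rV_r, w *m E = 0 -> w = 0) /\
  (forall v : 'rV_n, v *m hmx A h = 0 <-> exists w : 'rV_r, v = w *m E).

Lemma kernel_lattice n (A : 'M[R]_n) (h : {poly R}) :
  exists (r : nat) (E : 'M[R]_(r, n)) (B : 'M[R]_r),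
    kernel_basis A h E /\ E *m A = B *m E.
Proof.
have [|u v u0 v0|a v v0|r [E EP]] :=
    @submodule_basis R n (fun v => v *m hmx A h = 0) pidR.
- exact: mul0mx.
- by rewrite mulmxDl u0 v0 addr0.
- by rewrite -scalemxAl v0 scaler0.
have [Efree EK] := EP.
have /choice[b bE] i : exists w : 'rV_r, row i (E *m A) = w *m E.
  apply/EK; rewrite -row_mul -mulmxA -hmx_commX mulmxA !row_mul.
  by rewrite (iffRL (EK (row i E))) ?mul0mx //; exists (delta_mx 0 i); rewrite -rowE.
exists r, E, (\matrix_i b i); split=> //.
by apply/row_matrixP => i; rewrite bE row_mul rowK.
Qed.

Lemma kernel_basis_eq0 n r (A : 'M[R]_n) h (E : 'M[R]_(r, n)) :
  kernel_basis A h E -> E *m hmx A h = 0.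
Proof.
case=> _ EK; apply/row_matrixP => i; rewrite row_mul linear0.
by apply/EK; exists (delta_mx 0 i); rewrite -rowE.
Qed.

Lemma kernel_basis_fraction n r (A : 'M[R]_n) h (E : 'M[R]_(r, n)) :
  kernel_basis A h E -> row_free (map_mx toK E) /\
  (map_mx toK E :=: kermx (hmx (map_mx toK A) (map_poly toK h)))%MS.
Proof.
move=> kE; have [Efree EK] := kE; split.
  rewrite -kermx_eq0; apply/rowV0P => w /sub_kermxP wE.
  have [c c0 [u uE]] := clear_denominators w.
  have c0' : toK c != 0 by rewrite tofrac_eq0.
  apply: (scalerI c0'); rewrite scaler0 uE.
  rewrite (Efree u) ?map_mx0 //; apply: tofrac_mx_inj.
  by rewrite map_mxM -uE -scalemxAl wE scaler0 map_mx0.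
apply/eqmxP; apply/andP; split.
  apply/sub_kermxP; rewrite -map_hmx -map_mxM kernel_basis_eq0 //.
  exact: map_mx0.
apply/rV_subP => v /sub_kermxP vA.
have [c c0 [u uE]] := clear_denominators v.
have c0' : toK c != 0 by rewrite tofrac_eq0.
have /EK[w wE] : u *m hmx A h = 0.
  apply: tofrac_mx_inj.
  by rewrite map_mxM -uE map_hmx -scalemxAl vA scaler0 map_mx0.
rewrite -(scalerK c0' v) uE wE map_mxM scalemxAl; exact: submxMl.
Qed.

(** A kernel is a pure sublattice: if [t u] lies in it then so does [u]. So a combination of the
    rows of [E] divisible by [t] has coefficients divisible by [t]. *)
Lemma kernel_basis_residue (F : fieldType) (rho : {rmorphism R -> F}) (t : R)
    n r (A : 'M[R]_n) h (E : 'M[R]_(r, n)) :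
  residue_at rho t -> kernel_basis A h E -> row_free (map_mx rho E).
Proof.
move=> res [Efree EK]; rewrite -kermx_eq0; apply/rowV0P => v /sub_kermxP vE.
have [w wv] := residue_lift_mx v res.
have [|u uE] := @residue_mx_eq0 _ _ _ _ _ _ (w *m E) res.
  by rewrite map_mxM wv.
have [t0|t0] := eqVneq t 0.
  by rewrite -wv (Efree w) ?map_mx0 // uE t0 scale0r.
have /EK[x xE] : u *m hmx A h = 0.
  have : t *: (u *m hmx A h) = 0.
    rewrite scalemxAl -uE; apply/EK; by exists w.
  move/eqP; rewrite scalemx_eq0 (negPf t0) /= => /eqP //.
have -> : v = map_mx rho (t *: x).
  rewrite -wv; congr map_mx; apply/eqP; rewrite -subr_eq0; apply/eqP/Efree.
  by rewrite mulmxBl -scalemxAl -xE uE subrr.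
have [_ rho0] := res.
by rewrite map_mxZ (_ : rho t = 0) ?scale0r //; apply/rho0; exists 1; rewrite mulr1.
Qed.

(* Gauss's lemma: a coprime factor of a monic polynomial [g] over [R] is the
   characteristic polynomial of multiplication by [X] on a pure sublattice of
   [R[X]/(g)]. *)
Lemma monic_factor_integral (g : {poly R}) (f f' : {poly K}) :
  g \is monic -> f \is monic -> f' \is monic -> coprimep f f' ->
  map_poly toK g = f * f' ->
  exists2 f0 : {poly R}, f0 \is monic & f = map_poly toK f0.
Proof.
move=> gm fm f'm cff' gE; pose A := companionmx g.
have [c c0 [h hE]] := clear_poly_denominators f.
have c0' : toK c != 0 by rewrite tofrac_eq0.
have [r [E [B [kE EA]]]] := kernel_lattice A h.
have [Efree EK] := kernel_basis_fraction kE.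
have chiA : char_poly (map_mx toK A) = f * f'.
  by rewrite -map_char_poly companionmxK.
have EG : (map_mx toK E :=: kermx (hmx (map_mx toK A) f))%MS.
  apply: eqmx_trans EK _; rewrite -hE hmxZ.
  apply/eqmxP; apply/andP; split; apply/sub_kermxP.
    by apply: (scalerI c0'); rewrite scalemxAr mulmx_ker scaler0.
  by rewrite -scalemxAr mulmx_ker scaler0.
have EAK : map_mx toK E *m map_mx toK A = map_mx toK B *m map_mx toK E.
  by rewrite -!map_mxM EA.
exists (char_poly B); first exact: char_poly_monic.
rewrite map_char_poly.
exact: esym (char_poly_ker_factor chiA fm f'm cff' Efree EG EAK).
Qed.

End KernelLattice.

(** * Companion matrices *)

Section Companion.
Variable F : fieldType.

Lemma companion_cyclic (g r : {poly F}) (i0 : 'I_(size g).-1) :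
  i0 = 0%N :> nat -> (size r <= (size g).-1)%N ->
  delta_mx 0 i0 *m hmx (companionmx g) r = poly_rV r :> 'rV_(size g).-1.
Proof.
move=> i00 sr; have pow k (kP : (k < (size g).-1)%N) :
    delta_mx 0 i0 *m hmx (companionmx g) 'X^k =
    delta_mx 0 (Ordinal kP) :> 'rV_(size g).-1.
  elim: k kP => [|k IH] kP.
    rewrite expr0 hmx1 mulmx1; congr (delta_mx _ _); exact: val_inj.
  have k'P := ltnW kP.
  rewrite exprSr hmxM hmxX mulmxA (IH k'P) mulmx_delta_companion.
  by congr delta_mx; apply: val_inj.
rewrite -[in LHS](poly_rV_K sr) /rVpoly poly_def hmx_sum mulmx_sumr.
apply/rowP => j; rewrite summxE (bigD1 j) //= big1 ?addr0 => [|i ij].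
  rewrite valK hmxZ -scalemxAr (pow j (ltn_ord j)) !mxE eqxx /=.
  by rewrite -val_eqE /= eqxx mulr1.
rewrite valK hmxZ -scalemxAr (pow i (ltn_ord i)) !mxE eqxx /=.
suff -> : (j == Ordinal (ltn_ord i)) = false by rewrite mulr0.
by apply: contraNF ij => /eqP->; apply/eqP/val_inj.
Qed.

(** With [g = q' q], the classes of [X^i q'] for [i] below the degree of [q] are independent in
    [F[X]/(g)] and killed by [q]. *)
Lemma companion_corank (g q : {poly F}) : g \is monic -> q %| g ->
  ((size q).-1 <= \rank (kermx (hmx (companionmx g) q)))%N.
Proof.
move=> gm qg; set C := companionmx g; pose s := (size g).-1.
have g0 : g != 0 by apply: monic_neq0.
have [q1|q1] := leqP (size q).-1 0; first by apply: leq_trans q1 _.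
have s0 : (0 < s)%N.
  apply: leq_trans q1 _; rewrite -subn1 -[s]subn1 leq_sub2r //.
  exact: dvdp_leq.
pose q' : {poly F} := g %/ q; have gE : g = q' * q by rewrite divpK.
have q'0 : q' != 0 by apply: contraNneq g0 => q'0; rewrite gE q'0 mul0r.
have q0 : q != 0 by apply: contraNneq g0 => q0; rewrite gE q0 mulr0.
pose d := (size q).-1.
pose M := \matrix_(i < d) (poly_rV ('X^i * q') : 'rV_s).
have szM (i : 'I_d) : (size ('X^i * q')%R <= s)%N.
  rewrite size_monicM ?monicXn // size_polyXn.
  have aux (a b j : nat) :
    (0 < b -> j < a.-1 -> (j.+1 + b).-1 <= (b + a).-2)%N by lia.
  by rewrite /s gE size_mul //; apply: aux; rewrite ?size_poly_gt0 // ltn_ord.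
have Mfree : row_free M.
  rewrite -kermx_eq0; apply/rowV0P => w /sub_kermxP wM.
  have E : rVpoly w * q' = 0.
    have sz : (size (rVpoly w * q')%R <= s)%N.
      rewrite /rVpoly poly_def mulr_suml (leq_trans (size_sum _ _ _)) //.
      apply/bigmax_leqP => i _; rewrite -scalerAl.
      exact: leq_trans (size_scale_leq _ _) (szM i).
    rewrite -(poly_rV_K sz).
    suff -> : poly_rV (rVpoly w * q') = w *m M by rewrite wM linear0.
    rewrite mulmx_sum_row {1}/rVpoly poly_def mulr_suml linear_sum.
    by apply: eq_bigr => i _; rewrite valK rowK -scalerAl linearZ.
  move/eqP: E; rewrite mulf_eq0 (negPf q'0) orbF => /eqP w0.
  by rewrite -[w]rVpolyK w0 linear0.
have rM : \rank M = d by apply/eqP.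
rewrite -/d -rM.
apply: mxrankS; apply/row_subP => i; rewrite rowK.
rewrite -(@companion_cyclic g _ (Ordinal s0)) //.
apply/sub_kermxP; rewrite -mulmxA -hmxM -mulrA -gE hmxM.
have -> : hmx C g = 0
  by have := Cayley_Hamilton_hmx C; rewrite companionmxK.
by rewrite !mulmx0.
Qed.

End Companion.

Lemma size_map_monic (R S : nzRingType) (f : {rmorphism R -> S}) (g : {poly R}) :
  g \is monic -> size (map_poly f g) = size g.
Proof.
by move=> /monicP gm; rewrite size_map_poly_id0 // gm rmorph1 oner_neq0.
Qed.

Lemma rank_ker_hmx_cast (F : fieldType) a b (e : a = b) (A : 'M[F]_a) q :
  \rank (kermx (hmx (castmx (e, e) A) q)) = \rank (kermx (hmx A q)).
Proof. by case: b / e; rewrite castmx_id. Qed.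

Lemma map_companion_corank (R : comNzRingType) (F : fieldType)
    (rho : {rmorphism R -> F}) (g : {poly R}) (q : {poly F}) :
  g \is monic -> q %| map_poly rho g ->
  ((size q).-1 <= \rank (kermx (hmx (map_mx rho (companionmx g)) q)))%N.
Proof.
move=> gm qg; have e := size_map_monic rho gm.
have e' : (size (map_poly rho g)).-1 = (size g).-1 by rewrite e.
have -> : map_mx rho (companionmx g) =
    castmx (e', e') (companionmx (map_poly rho g)).
  apply/matrixP => i j; rewrite castmxE !mxE /= e'.
  by rewrite (fun_if rho) rmorphN rmorph_nat coef_map.
by rewrite rank_ker_hmx_cast companion_corank // monic_map.
Qed.

Lemma rank_ker_dvd (F : fieldType) n (A : 'M[F]_n) p q : p %| q ->
  (\rank (kermx (hmx A p)) <= \rank (kermx (hmx A q)))%N.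
Proof.
move=> pq; apply: mxrankS; apply/sub_kermxP; apply: hmx_dvd_eq0 pq _.
exact: mulmx_ker.
Qed.

(** * Irreducibility of cyclotomic polynomials *)

Lemma dvdp_mul_gcd (F : fieldType) (q f h : {poly F}) : q != 0 ->
  q %| f * h -> q %| gcdp q f * gcdp q h.
Proof.
move=> q0 qfh; set g := gcdp q f.
have g0 : g != 0 by rewrite gcdp_eq0 (negPf q0).
have qE : q = (q %/ g) * g by rewrite divpK // dvdp_gcdl.
have fE : f = (f %/ g) * g by rewrite divpK // dvdp_gcdr.
have cop : coprimep (q %/ g) (f %/ g).
  by apply: coprimep_div_gcd; rewrite q0.
rewrite {1}qE mulrC dvdp_mul2l // dvdp_gcd; apply/andP; split.
  by rewrite {2}qE dvdp_mulr.
rewrite -(Gauss_dvdpr _ cop) -(dvdp_mul2r _ _ g0) -qE.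
by rewrite mulrAC -fE.
Qed.

Section CoprimeReduction.
Variables (R : idomainType) (F : fieldType) (rho : {rmorphism R -> F}) (t p' : R).
Variable p : nat.
Hypotheses (res : residue_at rho t) (t0 : t != 0) (pp : prime p)
           (pE : p%:R = t * p') (rp' : rho p' != 0).
Variables (m b : nat).
Hypotheses (m0 : (0 < m)%N) (mF : m%:R != 0 :> F).
Let w := (p ^ b.+1 - p ^ b)%N.
Let q : {poly F} := 'X^m - 1.

Let w_gt0 : (0 < w)%N.
Proof. by rewrite subn_gt0 ltn_exp2l // prime_gt1. Qed.

Lemma map_geo_residue : map_poly rho (geo R (m * p ^ b) p) = q ^+ w.
Proof. by rewrite map_geo (geo_pchar _ (residue_pchar res pp pE) m0). Qed.

Let sep_q : separable_poly q.
Proof. exact: separable_Xn_sub_1. Qed.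

Let q0 : q != 0. Proof. exact: Xn_sub1_neq0. Qed.

(** The corank bound for the companion matrix of each factor gives [deg gcd(q, fb) * w <= deg f],
    and likewise for [h]. As the degrees of [f] and [h] add up to [m w], those of the two gcds add
    up to at most [m = deg q]; but [q] divides the product of the gcds. So this product is [q] up to
    a scalar, and the separability of [q] makes the gcds coprime. A common factor of [fb] and [hb]
    divides a power of [q], so it is trivial. *)
Lemma coprime_reduction (f h : {poly R}) : f \is monic -> h \is monic ->
  f * h = geo R (m * p ^ b) p -> coprimep (map_poly rho f) (map_poly rho h).
Proof.
move=> fm hm fh; set fb := map_poly rho f; set hb := map_poly rho h.
have fhb : fb * hb = q ^+ w by rewrite -rmorphM /= fh map_geo_residue.
have half (g : {poly R}) : g \is monic -> (exists g', g * g' = geo R (m * p ^ b) p) ->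
    ((size (gcdp q (map_poly rho g))).-1 * w <= (size g).-1)%N.
  move=> gm [g' gg'].
  have C0 : hmx (companionmx g) (geo R (m * p ^ b) p) = 0.
    have := Cayley_Hamilton_hmx (companionmx g); rewrite companionmxK // => C0.
    by rewrite -gg' hmxM C0 mul0mx.
  apply: leq_trans (ramified_corank res t0 pp pE rp' C0).
  rewrite leq_mul2r; apply/orP; right.
  apply: leq_trans (map_companion_corank gm (dvdp_gcdr q _)) _.
  by apply: rank_ker_dvd; apply: dvdp_gcdl.
have f1 := half f fm (ex_intro _ h fh).
have h1 : ((size (gcdp q hb)).-1 * w <= (size h).-1)%N.
  by apply: half => //; exists f; rewrite mulrC.
rewrite -/fb in f1.
have fb0 : fb != 0 by rewrite monic_neq0 // monic_map.
have hb0 : hb != 0 by rewrite monic_neq0 // monic_map.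
have szfh : ((size f).-1 + (size h).-1 = m * w)%N.
  rewrite -(size_map_monic rho fm) -(size_map_monic rho hm) -/fb -/hb.
  have : (size (fb * hb)).-1 = (m * w)%N.
    by rewrite fhb size_exp size_XnsubC.
  rewrite size_mul //; have : (0 < size fb)%N by rewrite size_poly_gt0.
  have : (0 < size hb)%N by rewrite size_poly_gt0.
  by move: (size fb) (size hb) => x y; clear; lia.
set g1 := gcdp q fb in f1 *; set g2 := gcdp q hb in h1.
have g10 : g1 != 0 by rewrite gcdp_eq0 (negPf q0).
have g20 : g2 != 0 by rewrite gcdp_eq0 (negPf q0).
have q12 : q %| g1 * g2.
  by apply: dvdp_mul_gcd => //; rewrite fhb -(prednK w_gt0) exprS dvdp_mulr.
have sz12 : size q == size (g1 * g2).
  rewrite eqn_leq dvdp_leq ?mulf_neq0 //= size_mul // size_XnsubC //.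
  have : ((size g1).-1 + (size g2).-1 <= m)%N.
    by rewrite -(leq_pmul2r w_gt0) mulnDl -szfh leq_add.
  have : (0 < size g1)%N by rewrite size_poly_gt0.
  have : (0 < size g2)%N by rewrite size_poly_gt0.
  by move: (size g1) (size g2) => x y; clear; lia.
have cop12 : coprimep g1 g2.
  apply: (separable_coprime sep_q).
  by move: sz12; rewrite (dvdp_size_eqp q12) => /andP[].
set c := gcdp fb hb.
have cq : coprimep c q.
  apply/coprimepP => d dc dq; move/coprimepP: cop12; apply.
    by rewrite dvdp_gcd dq (dvdp_trans dc (dvdp_gcdl _ _)).
  by rewrite dvdp_gcd dq (dvdp_trans dc (dvdp_gcdr _ _)).
have : coprimep c c.
  apply: coprimep_dvdl (coprimep_expr w cq).
  by rewrite -fhb dvdp_mulr // dvdp_gcdl.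
by rewrite coprimepp.
Qed.

End CoprimeReduction.

Lemma root_irreducible_dvd (K : fieldType) (L : idomainType)
    (iota : {rmorphism K -> L}) (f g : {poly K}) (z : L) :
  irreducible_poly f -> root (map_poly iota f) z -> root (map_poly iota g) z ->
  f %| g.
Proof.
move=> [f1 firr] fz gz.
have [cop|ncop] := boolP (coprimep f g).
  have [[u v] /= uv] := Bezout_eq1_coprimepP _ _ cop.
  have := congr1 (fun q => (map_poly iota q).[z]) uv.
  rewrite rmorphD !rmorphM rmorph1 hornerD !hornerM (rootP fz) (rootP gz).
  by rewrite !mulr0 addr0 hornerC => /eqP; rewrite eq_sym oner_eq0.
have := firr (gcdp f g) ncop (dvdp_gcdl _ _).
by move=> /andP[_ fg]; apply: dvdp_trans fg (dvdp_gcdr _ _).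
Qed.

Lemma geo_monic (R : idomainType) a b : (0 < a)%N -> (0 < b)%N ->
  geo R a b \is monic.
Proof.
move=> a0 b0; rewrite -(monicMl _ (Xn_sub1_monic R a0)) geoE.
by rewrite Xn_sub1_monic // muln_gt0 a0.
Qed.

Lemma tofrac_poly_inj (R : idomainType) : injective (map_poly (@tofrac R)).
Proof.
by apply: map_inj_poly; [move=> x y /eqP; rewrite tofrac_eq => /eqP|rewrite rmorph0].
Qed.

(** Division by a monic polynomial takes place over [R], and the remainder, of smaller degree, must
    vanish over the fraction field. *)
Lemma monic_dvd_fraction (R : idomainType) (f g : {poly R}) : f \is monic ->
  map_poly (@tofrac R) f %| map_poly (@tofrac R) g -> exists q, g = q * f.
Proof.
move=> fm fg; exists (g %/ f).
have gE := Pdiv.IdomainMonic.divp_eq fm g.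
suff r0 : g %% f = 0 by rewrite {1}gE r0 addr0.
apply: tofrac_poly_inj; rewrite rmorph0; apply/eqP; apply: contraLR fg => r0.
rewrite gE rmorphD rmorphM /= dvdp_addr ?dvdp_mull //.
apply: contra r0 => /dvdp_leq H; apply/negPn/negP => r0; move: (H r0).
rewrite size_map_monic // leqNgt.
rewrite (leq_ltn_trans (size_poly _ _)) //.
by rewrite ltn_modpN0 // monic_neq0.
Qed.

(* [p] has valuation one at some maximal ideal [tR]. *)
Definition unramified_at (R : idomainType) (p : nat) : Prop :=
  exists (F : fieldType) (rho : {rmorphism R -> F}) (t p' : R),
    [/\ residue_at rho t, t != 0, p%:R = t * p' & rho p' != 0].

Section Irreducibility.
Variable R : idomainType.
Hypotheses (pidR : pid R) (char0 : [pchar R] =i pred0).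
Local Notation K := {fraction R}.
Local Notation toK := (@tofrac R).

Lemma fraction_natr_eq0 k : (k%:R == 0 :> K) = (k == 0%N).
Proof.
rewrite -(rmorph_nat toK) tofrac_eq0; exact: (iffLR (pcharf0P R) char0).
Qed.

Lemma separable_Xn_sub1_fraction k : (0 < k)%N ->
  separable_poly ('X^k - 1 : {poly K}).
Proof. by move=> k0; apply: separable_Xn_sub_1; rewrite fraction_natr_eq0 -lt0n. Qed.

(** Write [geo = f f']. If [z^u] is not a root of [f], it is a root of [f'], so [f] divides
    [f'(X^u)]. Modulo [t] one has [X^u = X] modulo [X^m - 1], so a common factor of [fb] and
    [X^m - 1] divides the reduction of [f'], against [coprime_reduction]. Thus [fb] is coprime to
    [X^m - 1], while it divides a power of it: then [f] is constant. *)
Lemma root_prime_twist (L : fieldType) (iota : {rmorphism K -> L}) (f : {poly K})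
    (z : L) (p m b u : nat) :
  prime p -> ~~ (p %| m)%N -> unramified_at R p ->
  f \is monic -> irreducible_poly f -> f %| geo K (m * p ^ b) p ->
  (m * p ^ b.+1).-primitive_root z -> root (map_poly iota f) z ->
  ~~ (p %| u)%N -> u = 1 %[mod m] -> root (map_poly iota f) (z ^+ u).
Proof.
move=> pp pm [F [rho [t [p' [res t0 pE rp']]]]] fm firr fgeo zprim fz pu um.
have p0 := prime_gt0 pp.
have m0 : (0 < m)%N by rewrite lt0n; apply: contraNneq pm => ->; rewrite dvdn0.
have mpb0 : (0 < m * p ^ b)%N by rewrite muln_gt0 m0 expn_gt0 p0.
have mF : m%:R != 0 :> F by rewrite -(dvdn_pcharf (residue_pchar res pp pE)).
have [f' geoE'] := dvdpP _ _ fgeo; rewrite mulrC in geoE'.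
have f'm : f' \is monic by rewrite -(monicMl _ fm) -geoE' geo_monic.
have mapgeo : map_poly toK (geo R (m * p ^ b) p) = f * f'.
  by rewrite map_geo geoE'.
have sep : separable_poly (geo K (m * p ^ b) p).
  have /separable_Xn_sub1_fraction : (0 < m * p ^ b * p)%N by rewrite muln_gt0 mpb0.
  by apply: dvdp_separable; rewrite -geoE dvdp_mull.
have cop : coprimep f f' by apply: (separable_coprime sep); rewrite geoE'.
have gm := geo_monic R mpb0 p0.
have [f0 f0m fE] := monic_factor_integral pidR gm fm f'm cop mapgeo.
have [h0 h0m f'E] : exists2 h0 : {poly R}, h0 \is monic & f' = map_poly toK h0.
  apply: (monic_factor_integral pidR gm f'm fm); first by rewrite coprimep_sym.
  by rewrite mapgeo mulrC.
have fh0 : f0 * h0 = geo R (m * p ^ b) p.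
  by apply: tofrac_poly_inj; rewrite rmorphM /= -fE -f'E mapgeo.
have copF := coprime_reduction res t0 pp pE rp' m0 mF f0m h0m fh0.
have zn : z ^+ u ^+ (m * p ^ b * p) = 1.
  by rewrite -mulnA -expnSr exprAC (prim_expr_order zprim) expr1n.
have zn' : z ^+ u ^+ (m * p ^ b) != 1.
  rewrite -exprM -(prim_order_dvd zprim) expnSr mulnA [(u * _)%N]mulnC.
  by rewrite dvdn_pmul2l.
have : root (map_poly iota (f * f')) (z ^+ u).
  rewrite -geoE' map_geo; have := congr1 (horner^~ (z ^+ u)) (geoE L (m * p ^ b) p).
  rewrite hornerM !hornerE zn subrr => /eqP; rewrite mulf_eq0.
  by rewrite subr_eq0 (negPf zn').
rewrite rmorphM rootM => /orP[//|f'z].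
have : root (map_poly iota (f' \Po 'X^u)) z.
  rewrite map_comp_poly rmorphXn /= map_polyX /root horner_comp hornerXn.
  exact: f'z.
move=> /(root_irreducible_dvd firr fz).
rewrite fE f'E -(map_polyXn toK) -map_comp_poly.
move=> /(monic_dvd_fraction f0m)[q qE].
set fb := map_poly rho f0 in copF *; set hb := map_poly rho h0 in copF.
have fbhb : fb %| hb \Po 'X^u.
  by rewrite -(map_polyXn rho) -map_comp_poly qE rmorphM dvdp_mull.
have [r hr] := dvdp_comp_sub hb 'X^u 'X.
have qX : ('X^m - 1 : {poly F}) %| 'X^u - 'X.
  have u0 : (0 < u)%N by rewrite lt0n; apply: contraNneq pu => ->; rewrite dvdn0.
  have mu : (m %| u.-1)%N by rewrite -subn1 -eqn_mod_dvd // eq_sym um.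
  have -> : 'X^u - 'X = 'X * ('X^(u.-1) - 1) :> {poly F}.
    by rewrite mulrBr mulr1 -exprS prednK.
  by rewrite dvdp_mull // -(divnK mu) mulnC -geoE dvdp_mulr.
have : coprimep fb ('X^m - 1).
  apply/coprimepP => d df dq; move/coprimepP: copF; apply => //.
  rewrite -[hb]comp_polyXr; have -> : hb \Po 'X = (hb \Po 'X^u) - ('X^u - 'X) * r.
    by rewrite -hr; ring.
  have d1 : d %| hb \Po 'X^u := dvdp_trans df fbhb.
  have d2 : d %| 'X^u - 'X := dvdp_trans dq qX.
  by rewrite dvdp_sub // dvdp_mulr.
move=> /(coprimep_expr (p ^ b.+1 - p ^ b)).
rewrite -(map_geo_residue res pp pE b m0) -fh0 rmorphM coprimepMr coprimepp.
move=> /andP[/eqP]; rewrite size_map_monic // => f01.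
by move: firr => [+ _]; rewrite fE size_map_monic // f01.
Qed.

End Irreducibility.

Lemma coprime_congr a b m : a = b %[mod m] -> coprime a m = coprime b m.
Proof. by move=> ab; rewrite -coprime_modl ab coprime_modl. Qed.

Lemma congr_dvdn a b m d : (d %| m)%N -> a = b %[mod m] -> a = b %[mod d].
Proof. by move=> dm ab; rewrite -(modn_dvdm a dm) ab modn_dvdm. Qed.

Section CyclotomicIrreducible.
Variable R : idomainType.
Hypotheses (pidR : pid R) (char0 : [pchar R] =i pred0).
Local Notation K := {fraction R}.

Definition PhiK n : {poly K} := map_poly intr 'Phi_n.

Lemma PhiK_monic n : PhiK n \is monic.
Proof. exact/monic_map/Cyclotomic_monic. Qed.

Lemma size_PhiK n : size (PhiK n) = (totient n).+1.
Proof. by rewrite size_map_monic ?Cyclotomic_monic // size_Cyclotomic. Qed.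

Lemma prod_PhiK n : (0 < n)%N -> \prod_(d <- divisors n) PhiK d = 'X^n - 1.
Proof.
by move=> n0; rewrite -rmorph_prod prod_Cyclotomic // rmorphB /= map_polyXn rmorph1.
Qed.

Lemma PhiK_dvd n : (0 < n)%N -> PhiK n %| 'X^n - 1.
Proof.
move=> n0; rewrite -prod_PhiK // (big_rem n) ?dvdp_mulr //.
by rewrite -dvdn_divisors.
Qed.

Lemma PhiK_proper_dvd n d : (0 < n)%N -> (d %| n)%N -> (d < n)%N ->
  PhiK n * ('X^d - 1) %| 'X^n - 1.
Proof.
move=> n0 dn dltn; have d0 := dvdn_gt0 n0 dn.
rewrite -(prod_PhiK n0) -(prod_PhiK d0) [X in _ %| X](big_rem n) /=; last first.
  by rewrite -dvdn_divisors.
rewrite dvdp_mul2l ?monic_neq0 ?PhiK_monic //.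
set s := rem n _; rewrite [X in _ %| X](bigID (fun e => e %| d)%N) /= dvdp_mulr //.
have ps : perm_eq [seq e <- s | (e %| d)%N] (divisors d).
  apply: uniq_perm; rewrite ?filter_uniq ?rem_uniq ?divisors_uniq // => e.
  rewrite mem_filter mem_rem_uniq ?divisors_uniq // !inE -!dvdn_divisors //.
  apply/andP/idP => [[] //|ed]; rewrite ed (dvdn_trans ed dn) andbT; split=> //.
  by rewrite ltn_eqF // (leq_ltn_trans (dvdn_leq d0 ed)).
by rewrite -[X in _ %| X]big_filter (perm_big _ ps) dvdpp.
Qed.

Lemma PhiK_dvd_geo n p : (0 < n)%N -> prime p -> (p %| n)%N ->
  PhiK n %| geo K (n %/ p) p.
Proof.
move=> n0 pp pn; have np0 : (0 < n %/ p)%N by rewrite divn_gt0 ?prime_gt0 // dvdn_leq.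
have npn : (n %/ p < n)%N by rewrite ltn_Pdiv // prime_gt1.
have := PhiK_proper_dvd n0 (dvdn_div pn) npn.
rewrite -{3}(divnK pn) -geoE mulrC dvdp_mul2l // Xn_sub1_neq0 //.
Qed.

Section Roots.
Variables (L : fieldType) (inc : {rmorphism K -> L}).

Lemma root_PhiK_primitive n z : (0 < n)%N ->
  root (map_poly inc (PhiK n)) z -> n.-primitive_root z.
Proof.
move=> n0 zr.
have zn : z ^+ n = 1.
  have := dvdp_map inc (PhiK n) ('X^n - 1); rewrite PhiK_dvd // => /dvdpP[q].
  rewrite rmorphB /= map_polyXn rmorph1 => E.
  have := congr1 (horner^~ z) E; rewrite hornerM (rootP zr) mulr0 !hornerE.
  by move/eqP; rewrite subr_eq0 => /eqP.
have [d zprim dn] := prim_order_exists n0 zn.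
have := dvdn_leq n0 dn; rewrite leq_eqVlt => /orP[/eqP <- //|dltn].
have d0 := dvdn_gt0 n0 dn.
have cop : coprimep (PhiK n) ('X^d - 1).
  apply: separable_coprime (PhiK_proper_dvd n0 dn dltn).
  exact: separable_Xn_sub1_fraction.
have : coprimep (map_poly inc (PhiK n)) (map_poly inc ('X^d - 1)).
  by rewrite coprimep_map.
move=> /coprimep_root/(_ zr); rewrite rmorphB /= map_polyXn rmorph1 !hornerE.
by rewrite (prim_expr_order zprim) subrr eqxx.
Qed.

(** Induction on the unitary divisor [d] of [n] off which [u] is trivial; [d = n] is the case of
    interest. With [P] the p-part of [d], the Chinese remainder theorem writes [u = u' v] modulo
    [n], where [u'] is 1 modulo [m = n / P], so that [root_prime_twist] applies, and [v] is 1 modulo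
    [P], so that [d] may be replaced by [d / P]. *)
Lemma root_twist (f : {poly K}) n : (0 < n)%N ->
  (forall p, prime p -> (p %| n)%N -> unramified_at R p) ->
  f \is monic -> irreducible_poly f -> f %| PhiK n ->
  forall d, (d %| n)%N -> coprime d (n %/ d) ->
  forall z u, n.-primitive_root z -> root (map_poly inc f) z ->
    coprime u n -> u = 1 %[mod n %/ d] -> root (map_poly inc f) (z ^+ u).
Proof.
move=> n0 unr fm firr fPhi; elim/ltn_ind => d IH dn cd z u zprim fz un u1.
have d0 := dvdn_gt0 n0 dn.
have [d1|d1] := leqP d 1%N.
  have dE : d = 1%N by apply/eqP; rewrite eqn_leq d1.
  move: u1; rewrite dE divn1 => u1.
  have /eqP -> : z ^+ u == z ^+ 1 by rewrite (eq_prim_root_expr zprim) u1.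
  by rewrite expr1.
set p := pdiv d; have pp : prime p by apply: pdiv_prime.
have p0 := prime_gt0 pp; have pd : (p %| d)%N by apply: pdiv_dvd.
have [d' cpd' dE] := pfactor_coprime pp d0; set k := logn p d in dE.
have k0 : (0 < k)%N by rewrite logn_gt0 mem_primes pp d0.
set e := (n %/ d)%N in cd u1 *; pose m := (d' * e)%N; pose P := (p ^ k)%N.
have P0 : (0 < P)%N by rewrite expn_gt0 p0.
have nE : n = (m * P)%N by rewrite -(divnK dn) -/e dE /m /P; ring.
have cpe : coprime p e by apply: coprime_dvdl pd cd.
have cPm : coprime P m by rewrite coprimeXl // coprimeMr cpd'.
have pm : ~~ (p %| m)%N by rewrite -prime_coprime // coprimeMr cpd'.
have pn : (p %| n)%N := dvdn_trans pd dn.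
have npE : (n %/ p = m * p ^ k.-1)%N.
  by rewrite nE /P -(prednK k0) expnSr mulnA mulnK.
have PhiE : f %| geo K (m * p ^ k.-1) p.
  by rewrite -npE; apply: dvdp_trans fPhi _; apply: PhiK_dvd_geo.
have nE' : n = (m * p ^ k.-1.+1)%N by rewrite prednK.
pose u' := chinese P m u 1; pose v := chinese P m 1 u.
have u'P : u' = u %[mod P] := chinese_modl cPm u 1.
have u'm : u' = 1 %[mod m] := chinese_modr cPm u 1.
have vP : v = 1 %[mod P] := chinese_modl cPm 1 u.
have vm : v = u %[mod m] := chinese_modr cPm 1 u.
have pP : (p %| P)%N by rewrite /P -(prednK k0) expnS dvdn_mulr.
have [cum cuP] : coprime u m /\ coprime u P.
  by apply/andP; rewrite -coprimeMr -nE.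
have cu'n : coprime u' n.
  by rewrite nE coprimeMr (coprime_congr u'm) (coprime_congr u'P) coprime1n cuP.
have cvn : coprime v n.
  by rewrite nE coprimeMr (coprime_congr vm) (coprime_congr vP) coprime1n cum.
have pu' : ~~ (p %| u')%N.
  by rewrite -prime_coprime // coprime_sym; apply: coprime_dvdr pn cu'n.
have fz' : root (map_poly inc f) (z ^+ u').
  have zprim' : (m * p ^ k.-1.+1).-primitive_root z by rewrite -nE'.
  exact: (root_prime_twist pidR char0 pp pm (unr p pp pn) fm firr PhiE zprim' fz pu').
have zprim' : n.-primitive_root (z ^+ u') by rewrite prim_root_exp_coprime.
have d'0 : (0 < d')%N by move: d0; rewrite dE muln_gt0 => /andP[].
have d'd : (d' < d)%N.
  by rewrite [X in (_ < X)%N]dE ltn_Pmulr // -(expn0 p) ltn_exp2l ?prime_gt1.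
have nd' : (n %/ d' = e * P)%N by rewrite nE /m -mulnA mulKn.
have -> : z ^+ u = z ^+ u' ^+ v.
  apply/eqP; rewrite -exprM (eq_prim_root_expr zprim) nE mulnC.
  rewrite chinese_remainder // -(modnMm u' v P) u'P vP modnMm muln1 eqxx.
  by rewrite -(modnMm u' v m) u'm vm modnMm mul1n eqxx.
apply: (IH d') => //.
- by rewrite nE /m -mulnA dvdn_mulr.
- rewrite nd' coprimeMr; apply/andP; split.
    by apply: coprime_dvdl cd; rewrite dE dvdn_mulr.
  by rewrite coprimeXr // coprime_sym.
- rewrite nd'; apply/eqP; rewrite chinese_remainder; last by rewrite coprime_sym coprimeXl.
  rewrite vP eqxx andbT; apply/eqP; rewrite (congr_dvdn _ vm) ?dvdn_mull //.
Qed.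

(** The powers [z^k] with [k] prime to [n] are [totient n] distinct roots of [f]. *)
Lemma irreducible_PhiK_size (f : {poly K}) n z : (0 < n)%N ->
  (forall p, prime p -> (p %| n)%N -> unramified_at R p) ->
  f \is monic -> irreducible_poly f -> f %| PhiK n ->
  root (map_poly inc f) z -> (size (PhiK n) <= size f)%N.
Proof.
move=> n0 unr fm firr fPhi fz.
have zprim : n.-primitive_root z.
  apply: root_PhiK_primitive => //; have [q ->] := dvdpP _ _ fPhi.
  by rewrite rmorphM rootM fz orbT.
pose rs := [seq z ^+ k | k <- [seq k <- iota 0 n | coprime n k]].
have urs : uniq rs.
  rewrite map_inj_in_uniq ?filter_uniq ?iota_uniq // => i j.
  rewrite !mem_filter !mem_iota !add0n /= => /andP[_ ilt] /andP[_ jlt] /eqP.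
  by rewrite (eq_prim_root_expr zprim) !modn_small // => /eqP.
have szrs : size rs = totient n.
  rewrite size_map size_filter totient_count_coprime -sum1_count big_mkcond /=.
  by rewrite /index_iota subn0; apply: eq_bigr => i _; case: coprime.
have ars : all (root (map_poly inc f)) rs.
  apply/allP => x /mapP[k]; rewrite mem_filter => /andP[cnk _] ->.
  apply: (root_twist n0 unr fm firr fPhi (dvdnn n)) => //.
  - by rewrite divnn n0 coprimen1.
  - by rewrite coprime_sym.
  - by rewrite divnn n0 !modn1.
have f0 : map_poly inc f != 0 by rewrite map_poly_eq0 monic_neq0.
have := max_poly_roots f0 ars urs.
by rewrite szrs size_map_poly size_PhiK.
Qed.

End Roots.

Theorem irreducible_dvd_PhiK (f : {poly K}) n : (0 < n)%N ->
  (forall p, prime p -> (p %| n)%N -> unramified_at R p) ->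
  f \is monic -> irreducible_poly f -> f %| PhiK n -> f = PhiK n.
Proof.
move=> n0 unr fm firr fPhi; apply/eqP.
rewrite -eqp_monic ?PhiK_monic //.
have [L _ [z fz _]] := irredp_FAdjoin firr.
have sz := irreducible_PhiK_size n0 unr fm firr fPhi fz.
rewrite -(dvdp_size_eqp fPhi) eqn_leq sz andbT dvdp_leq //.
exact: monic_neq0 (PhiK_monic n).
Qed.

End CyclotomicIrreducible.

(** * Quotients of products of polynomials X^d - 1 *)

Lemma monic_irreducible_factor (K : fieldType) (g : {poly K}) :
  (1 < size g)%N -> exists f, [/\ f \is monic, irreducible_poly f & f %| g].
Proof.
have [s le_s] := ubnP (size g); elim: s g le_s => // s IH g le_s g1.
have [gi|gi] := pselect (irreducible_poly g).
  have g0 : lead_coef g != 0 by rewrite lead_coef_eq0 irredp_neq0.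
  exists ((lead_coef g)^-1 *: g); split.
  - by rewrite monicE lead_coefZ mulVf.
  - split; rewrite ?size_scale ?invr_eq0 // => q q1.
    by rewrite dvdpZr ?invr_eq0 // => /(gi.2 q q1); rewrite /eqp dvdpZr ?dvdpZl ?invr_eq0.
  - by rewrite dvdpZl ?invr_eq0.
have [q [q1 qg nqg]] : exists q : {poly K}, [/\ size q != 1%N, q %| g & ~~ (q %= g)].
  apply: contrapT => nq; apply: gi; split=> // q q1 qg.
  by apply: contrapT => /negP nqg; apply: nq; exists q.
have g0 : g != 0 by rewrite -size_poly_gt0 (ltn_trans _ g1).
have q0 : q != 0 by apply: contraNneq g0 => q0; rewrite -dvd0p -q0.
have q1' : (1 < size q)%N by rewrite ltn_neqAle eq_sym q1 size_poly_gt0.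
have qlt : (size q < s)%N.
  rewrite -ltnS; apply: leq_ltn_trans le_s.
  by rewrite ltn_neqAle dvdp_leq // andbT (dvdp_size_eqp qg).
have [f [fm fi fq]] := IH q qlt q1'.
by exists f; split=> //; apply: dvdp_trans fq qg.
Qed.

(** Up to multiplication, [g] is a quotient of products of polynomials [X^d - 1], the characteristic
    polynomials of the transitive permutation lattices; [l1] prescribes the permutation lattice to
    be added. *)
Definition stably_cyclic (K : fieldType) n (g : {poly K}) : Prop :=
  exists l1 l2 : seq nat,
  [/\ all (fun d => d %| n)%N l1, all (fun d => d %| n)%N l2 &
      g * \prod_(d <- l1) ('X^d - 1) = \prod_(d <- l2) ('X^d - 1)].

Section StablyCyclic.
Variables (K : fieldType) (n : nat).
Hypothesis n0 : (0 < n)%N.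

Lemma stably_cyclic1 : stably_cyclic n (1 : {poly K}).
Proof. by exists [::], [::]; rewrite !big_nil mul1r. Qed.

Lemma stably_cyclicM (g h : {poly K}) :
  stably_cyclic n g -> stably_cyclic n h -> stably_cyclic n (g * h).
Proof.
move=> [l1 [l2 [a1 a2 gE]]] [k1 [k2 [b1 b2 hE]]].
exists (l1 ++ k1), (l2 ++ k2); rewrite !all_cat a1 a2 b1 b2 !big_cat; split=> //=.
by rewrite -gE -hE; ring.
Qed.

Lemma stably_cyclic_cancel (g h : {poly K}) :
  stably_cyclic n (g * h) -> stably_cyclic n h -> stably_cyclic n g.
Proof.
move=> [l1 [l2 [a1 a2 gE]]] [k1 [k2 [b1 b2 hE]]].
exists (l1 ++ k2), (l2 ++ k1); rewrite !all_cat a1 a2 b1 b2 !big_cat; split=> //=.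
by rewrite -gE -hE; ring.
Qed.

End StablyCyclic.

Section StablyCyclicDomain.
Variables (R : idomainType) (n : nat).
Hypotheses (pidR : pid R) (char0 : [pchar R] =i pred0) (n0 : (0 < n)%N).
Hypothesis unr : forall p, prime p -> (p %| n)%N -> unramified_at R p.
Local Notation K := {fraction R}.

Lemma stably_cyclic_PhiK d : (d %| n)%N -> stably_cyclic n (PhiK R d).
Proof.
elim/ltn_ind: d => d IH dn; have d0 := dvdn_gt0 n0 dn.
pose s := rem d (divisors d).
apply: (@stably_cyclic_cancel _ _ _ (\prod_(e <- s) PhiK R e)).
  have -> : PhiK R d * \prod_(e <- s) PhiK R e = 'X^d - 1.
    by rewrite -(prod_PhiK R d0) [RHS](big_rem d) //= -dvdn_divisors.
  by exists [::], [:: d]; rewrite big_nil big_seq1 mulr1 /= dn.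
rewrite big_seq; elim/big_ind: _ => [||e]; first exact: stably_cyclic1.
  by move=> x y; apply: stably_cyclicM.
rewrite mem_rem_uniq ?divisors_uniq // !inE -dvdn_divisors // => /andP[ed edv].
apply: IH; last exact: dvdn_trans dn.
by rewrite ltn_neqAle ed dvdn_leq.
Qed.

(** Irreducible factors are stripped off one by one; each divides [X^n - 1], hence divides some
    [PhiK R d], and equals it by irreducibility. *)
Lemma stably_cyclic_dvd (g : {poly K}) k : g \is monic ->
  g %| ('X^n - 1) ^+ k -> stably_cyclic n g.
Proof.
have [s le_s] := ubnP (size g); elim: s g le_s => // s IH g le_s gm gX.
have g0 := monic_neq0 gm.
have [g1|g1] := leqP (size g) 1.
  have -> : g = 1.
    have := size1_polyC g1 => gE; move: gm; rewrite gE monicE lead_coefC => /eqP -> //.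
  exact: stably_cyclic1.
have [f [fm fi fg]] := monic_irreducible_factor g1.
have fX : f %| 'X^n - 1.
  rewrite -[_ %| _]negbK -irreducible_poly_coprime //; apply/negP => cop.
  have := coprimep_expr k cop; rewrite irreducible_poly_coprime //.
  by rewrite (dvdp_trans fg gX).
have [d dn fPhi] : exists2 d, (d %| n)%N & f %| PhiK R d.
  apply: contrapT => nd; move: fX; rewrite -prod_PhiK //; apply/negP.
  rewrite -irreducible_poly_coprime // big_seq.
  elim/big_ind: _ => [||d]; first exact: coprimep1.
    by move=> x y cx cy; rewrite coprimepMr cx.
  rewrite -dvdn_divisors // => dn; rewrite irreducible_poly_coprime //.
  by apply/negP => fd; apply: nd; exists d.
have d0 := dvdn_gt0 n0 dn.
have fE : f = PhiK R d.
  apply: irreducible_dvd_PhiK => // p pp pd.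
  by apply: unr => //; apply: dvdn_trans dn.
have [h gE] := dvdpP _ _ fg.
have hm : h \is monic by move: (gm); rewrite gE monicMr.
rewrite gE; apply: stably_cyclicM; last by rewrite fE; apply: stably_cyclic_PhiK.
apply: IH => //; last by apply: dvdp_trans gX; rewrite gE dvdp_mulr.
have f1 : (1 < size f)%N by case: fi.
rewrite -ltnS; apply: leq_ltn_trans le_s; rewrite gE (size_Mmonic (monic_neq0 hm) fm).
have := size_poly_gt0 h; rewrite (monic_neq0 hm) => h0.
by move: (size f) (size h) f1 h0 => x y; clear; lia.
Qed.

End StablyCyclicDomain.

(** * Ranks of kernels modulo a maximal ideal *)

Section KernelRanks.
Variable F : fieldType.
Implicit Types f g u : {poly F}.

Lemma rank_kerM n (B C : 'M[F]_n) :
  (\rank (kermx (B *m C)) <= \rank (kermx B) + \rank (kermx C))%N.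
Proof.
rewrite !mxrank_ker; have H := mxrank_mul_ker B C.
have H2 : (\rank (B :&: kermx C) <= \rank (kermx C))%N by rewrite mxrankS ?capmxSr.
have := rank_leq_row B; have := rank_leq_row C; move: H2 H; rewrite mxrank_ker.
move: (\rank (B *m C)) (\rank (B :&: kermx C)%MS) (\rank B) (\rank C).
by move=> a b c d; clear; lia.
Qed.

Lemma rank_ker_hmx_exp n (A : 'M[F]_n) g k :
  (\rank (kermx (hmx A (g ^+ k))) <= k * \rank (kermx (hmx A g)))%N.
Proof.
elim: k => [|k IH].
  rewrite expr0 hmx1 mul0n leqn0 mxrank_eq0 kermx_eq0 row_free_unit.
  exact: unitmx1.
by rewrite exprS hmxM mulSn (leq_trans (rank_kerM _ _)) // leq_add2l.
Qed.

Lemma rank_ker_coprime n (A : 'M[F]_n) g u : coprimep g u ->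
  \rank (kermx (hmx A (g * u))) =
  (\rank (kermx (hmx A g)) + \rank (kermx (hmx A u)))%N.
Proof.
move=> gu; rewrite (kermx_hmxM A gu) mxrank_disjoint_sum //.
apply/eqP/rowV0P => v; rewrite sub_capmx => /andP[/sub_kermxP v1 /sub_kermxP v2].
exact: hmx_coprime_eq0 gu v1 v2.
Qed.

(* The bound [w * corank <= s] forces [F^s] to be free over [F[X]/(f^w)]. *)
Lemma rank_uniserial s (y : 'M[F]_s) f g u H w k :
  (0 < w)%N -> f = g * u -> coprimep g u -> hmx y (f ^+ w) = 0 ->
  (\rank (kermx (hmx y f)) * w <= s)%N ->
  char_poly y = g ^+ (w * k) * H -> g \is monic -> H \is monic ->
  coprimep g H ->
  ((size g).-1 * k <= \rank (hmx y (f ^+ w.-1 * u)))%N.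
Proof.
move=> w0 fE gu yf rkf chi gm Hm gH.
have guw i j : coprimep (g ^+ i) (u ^+ j) by rewrite coprimep_expl ?coprimep_expr.
set kg := \rank (kermx (hmx y g)); set ku := \rank (kermx (hmx y u)).
set kw := \rank (kermx (hmx y (g ^+ w))).
have rkf' : ((kg + ku) * w <= s)%N by rewrite /kg /ku -rank_ker_coprime // -fE.
have kuw : (s <= kw + w * ku)%N.
  have <- : \rank (kermx (hmx y (f ^+ w))) = s.
    by rewrite yf mxrank_ker mxrank0 subn0.
  by rewrite fE exprMn rank_ker_coprime // leq_add2l rank_ker_hmx_exp.
have kgw : ((size g).-1 * (w * k) <= kw)%N.
  have <- : \rank (kermx (hmx y (g ^+ (w * k)))) = ((size g).-1 * (w * k))%N.
    rewrite (rank_ker_factor chi) ?monic_exp // ?coprimep_expl //.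
    by rewrite size_exp.
  apply: mxrankS; apply/sub_kermxP.
  apply: (hmx_coprime_eq0 (A := y) (guw (w * k)%N w)).
    by rewrite -mulmxA hmx_comm mulmxA mulmx_ker mul0mx.
  by rewrite -mulmxA -hmxM -exprMn -fE yf mulmx0.
pose V := kermx (hmx y (g ^+ w)).
have low : (kw <= \rank (hmx y (f ^+ w.-1 * u)) + w.-1 * kg)%N.
  rewrite -[kw](mxrank_mul_ker V (hmx y (f ^+ w.-1 * u))); apply: leq_add.
    exact: mxrankM_maxr.
  apply: leq_trans (rank_ker_hmx_exp y g w.-1); apply: mxrankS.
  set W := (_ :&: _)%MS; apply/sub_kermxP.
  have Wg : W *m hmx y (g ^+ w) = 0 by apply/sub_kermxP; exact: capmxSl.
  have Wf : W *m hmx y (f ^+ w.-1 * u) = 0 by apply/sub_kermxP; exact: capmxSr.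
  apply: (hmx_coprime_eq0 (A := y) (guw w w)).
    by rewrite -mulmxA hmx_comm mulmxA Wg mul0mx.
  rewrite -mulmxA -hmxM -[in X in hmx y X](prednK w0) exprSr mulrA -exprMn -fE.
  exact: Wf.
(* The inequalities [kuw] and [rkf'] give [w kg <= kw]. Multiplying [low] by [w] then leaves [w]
   times the rank at least [w kw - (w - 1) kw = kw], and [kgw] concludes. *)
rewrite -(leq_pmul2l w0); move: (size g).-1 (\rank _) low kgw kuw rkf' w0 => d r.
rewrite -/kg -/ku -/kw; move: kg ku kw; clear; case: w => // w kg ku kw /=.
by nia.
Qed.

(** As [m] is nonzero in [F], so is its divisor [e]; [X^e - 1] is separable and contains [g] at most
    once. *)
Lemma monic_irreducible_split g e m : g \is monic -> irreducible_poly g ->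
  m%:R != 0 :> F -> (0 < m)%N -> (e %| m)%N ->
  exists H : {poly F},
    [/\ 'X^e - 1 = g ^+ (g %| 'X^e - 1)%R * H, H \is monic & coprimep g H].
Proof.
move=> gm gi mF m0 em; have e0 := dvdn_gt0 m0 em.
have [gX|gX] := boolP (g %| _); last first.
  exists ('X^e - 1); rewrite expr0 mul1r Xn_sub1_monic //; split=> //.
  by rewrite irreducible_poly_coprime.
have [H HE] := dvdpP _ _ gX; exists H; rewrite expr1 mulrC; split=> //.
  by rewrite -(monicMr _ gm) -HE Xn_sub1_monic.
have eF : e%:R != 0 :> F.
  by apply: contraNneq mF => eF; rewrite -(divnK em) natrM eF mulr0.
by apply: (separable_coprime (separable_Xn_sub_1 eF)); rewrite HE mulrC.
Qed.

Lemma prod_irreducible_split g l m : g \is monic -> irreducible_poly g ->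
  m%:R != 0 :> F -> (0 < m)%N -> all (fun e => e %| m)%N l ->
  exists H : {poly F}, [/\ \prod_(e <- l) ('X^e - 1) =
    g ^+ count (fun e => g %| 'X^e - 1)%R l * H, H \is monic & coprimep g H].
Proof.
move=> gm gi mF m0; elim: l => [|e l IH] /=.
  by exists 1; rewrite big_nil mulr1 monic1 coprimep1.
move=> /andP[em /IH[H [HE Hm gH]]].
have [H' [HE' Hm' gH']] := monic_irreducible_split gm gi mF m0 em.
exists (H' * H); rewrite big_cons HE {1}HE' monicMl // coprimepMr gH gH'.
by split=> //; rewrite exprD mulrACA.
Qed.

End KernelRanks.

(** Euclid on exponents in one step: if [u e = v d + gcd], then [X^(u e) - X^(v d)] is [X^(v d)]
    times [X^gcd - 1], and [X] is invertible modulo [c]. *)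
Lemma dvdp_Xn_sub1_gcd (K : fieldType) (c : {poly K}) e d : (0 < e)%N ->
  c %| 'X^e - 1 -> c %| 'X^d - 1 -> c %| 'X^(gcdn e d) - 1.
Proof.
move=> e0 ce cd; case: (egcdnP d e0) => u v uv _.
have cX : coprimep c 'X^(v * d).
  apply: coprimep_expr; apply: coprimep_dvdr ce _.
  rewrite coprimepX /root !hornerE expr0n gtn_eqF // sub0r.
  by rewrite oppr_eq0 oner_eq0.
have cu : c %| 'X^(u * e) - 1.
  by apply: dvdp_trans ce _; rewrite mulnC -geoE dvdp_mulr.
have cv : c %| 'X^(v * d) - 1.
  by apply: dvdp_trans cd _; rewrite mulnC -geoE dvdp_mulr.
rewrite -(Gauss_dvdpr _ cX).
have -> : 'X^(v * d) * ('X^(gcdn e d) - 1) =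
    ('X^(u * e) - 1) - ('X^(v * d) - 1) :> {poly K}.
  by rewrite uv exprD; ring.
exact: dvdp_sub.
Qed.

Section SublatticeCharPoly.
Variable R : idomainType.
Hypotheses (pidR : pid R) (char0 : [pchar R] =i pred0).
Local Notation K := {fraction R}.
Local Notation toK := (@tofrac R).

(** Over the fraction field [h] and [G] have the same kernel on [A]: [h] is prime to [H], and since
    [A^n = 1] with [X^n - 1] separable, a vector killed by a power of [h] is killed by [h]. *)
Lemma kernel_char_poly N (A : 'M[R]_N) n (h h' G H : {poly R}) k r
    (E : 'M[R]_(r, N)) (B : 'M[R]_r) :
  (0 < n)%N -> A ^+ n = 1 -> h * h' = 'X^n - 1 -> char_poly A = G * H ->
  G \is monic -> H \is monic -> map_poly toK G %| map_poly toK h ^+ k ->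
  coprimep (map_poly toK H) (map_poly toK h) ->
  kernel_basis A h E -> E *m A = B *m E -> char_poly B = G.
Proof.
move=> n0 An hh' chi Gm Hm Gh cHh kE EA.
have [Efree EK] := kernel_basis_fraction kE.
set AK := map_mx toK A in EK *; set hK := map_poly toK h in Gh cHh EK *.
set h'K := map_poly toK h'.
have hhK : hK * h'K = 'X^n - 1.
  by rewrite -rmorphM /= hh' rmorphB /= map_polyXn rmorph1.
have chiK : char_poly AK = map_poly toK G * map_poly toK H.
  by rewrite -map_char_poly chi rmorphM.
have GmK : map_poly toK G \is monic by apply: monic_map.
have HmK : map_poly toK H \is monic by apply: monic_map.
have chh : coprimep hK h'K.
  have sep := separable_Xn_sub1_fraction char0 n0.
  by apply: (separable_coprime sep); rewrite hhK.
have cGH : coprimep (map_poly toK G) (map_poly toK H).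
  by apply: coprimep_dvdr Gh _; rewrite coprimep_expl // coprimep_sym.
have EG : (map_mx toK E :=: kermx (hmx AK (map_poly toK G)))%MS.
  apply: eqmx_trans EK _; apply/eqmxP; apply/andP; split; apply/sub_kermxP.
    apply: (hmx_coprime_eq0 (A := AK) cHh).
      rewrite -mulmxA -hmxM -chiK Cayley_Hamilton_hmx; exact: mulmx0.
    by rewrite -mulmxA hmx_comm mulmxA mulmx_ker mul0mx.
  have AKn : hmx AK (hK * h'K) = 0.
    rewrite hhK -(map_polyXn toK) -(rmorph1 (map_poly toK)) -rmorphB -map_hmx /=.
    by rewrite hmx_Xn_sub1 An subrr map_mx0.
  apply: (hmx_coprime_eq0 (A := AK) (coprimep_expl k chh)).
    have Gk : kermx (hmx AK (map_poly toK G)) *m hmx AK (hK ^+ k) = 0.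
      by apply: hmx_dvd_eq0 Gh _; exact: mulmx_ker.
    by rewrite -mulmxA hmx_comm mulmxA Gk mul0mx.
  by rewrite -mulmxA -hmxM AKn mulmx0.
have EAK : map_mx toK E *m AK = map_mx toK B *m map_mx toK E.
  by rewrite -!map_mxM EA.
have := char_poly_ker_factor chiK GmK HmK cGH Efree EG EAK.
by rewrite -map_char_poly => /tofrac_poly_inj.
Qed.

Lemma dvdp_big_exp (I : Type) (l : seq I) (Q : I -> {poly K}) (h : {poly K}) :
  (forall i, Q i %| h) -> \prod_(i <- l) Q i %| h ^+ size l.
Proof.
move=> Qh; elim: l => [|i l IH]; first by rewrite big_nil dvd1p.
by rewrite big_cons exprS dvdp_mul.
Qed.

(* The case [h = X^d - 1], where the factor of [X^e - 1] lying over [h] is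
   [X^(gcd e d) - 1]. *)
Lemma cyclic_kernel_char_poly N (A : 'M[R]_N) n d l r
    (E : 'M[R]_(r, N)) (B : 'M[R]_r) :
  (0 < n)%N -> A ^+ n = 1 -> (d %| n)%N -> all (fun e => e %| n)%N l ->
  char_poly A = \prod_(e <- l) ('X^e - 1) ->
  kernel_basis A ('X^d - 1) E -> E *m A = B *m E ->
  char_poly B = \prod_(e <- l) ('X^(gcdn e d) - 1).
Proof.
move=> n0 An dn ln chi kE EA; have d0 := dvdn_gt0 n0 dn.
have chi' : char_poly A = \prod_(e <- l) ('X^(gcdn e d) - 1) *
    \prod_(e <- l) geo R (gcdn e d) (e %/ gcdn e d).
  rewrite chi -big_split; apply: eq_bigr => e _ /=.
  by rewrite geoE mulnC divnK // dvdn_gcdl.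
have e0 e : e \in l -> (0 < e)%N by move=> /(allP ln)/(dvdn_gt0 n0).
have hh : ('X^d - 1) * geo R d (n %/ d) = 'X^n - 1 by rewrite geoE mulnC divnK.
apply: (kernel_char_poly (k := size l) n0 An hh chi' _ _ _ _ kE EA).
- apply: monic_prod => e _; apply: Xn_sub1_monic; by rewrite gcdn_gt0 d0 orbT.
- rewrite big_seq; apply: monic_prod => e /e0 e1; apply: geo_monic.
    by rewrite gcdn_gt0 d0 orbT.
  by rewrite divn_gt0 ?gcdn_gt0 ?d0 ?orbT // dvdn_leq // dvdn_gcdl.
- rewrite rmorph_prod; apply: dvdp_big_exp => e.
  rewrite !rmorphB !rmorph1 /= !map_polyXn -{2}(divnK (dvdn_gcdr e d)) mulnC.
  by rewrite -geoE dvdp_mulr.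
rewrite rmorph_prod big_seq; elim/big_ind: _ => [||e el]; first exact: coprime1p.
  by move=> x y cx cy; rewrite coprimepMl cx.
rewrite /= map_geo rmorphB rmorph1 /= map_polyXn; apply/coprimepP => c cg cX.
have eE : (gcdn e d * (e %/ gcdn e d) = e)%N by rewrite mulnC divnK // dvdn_gcdl.
have cop : coprimep ('X^(gcdn e d) - 1) (geo K (gcdn e d) (e %/ gcdn e d)).
  have sep := separable_Xn_sub1_fraction char0 (e0 e el).
  by apply: (separable_coprime sep); rewrite geoE eE.
move/coprimepP: cop; apply=> //; apply: dvdp_Xn_sub1_gcd cX => //; first exact: e0.
by rewrite -[X in 'X^X]eE -geoE dvdp_mull.
Qed.

End SublatticeCharPoly.

Lemma gcdn_pfactor_mul p e m a j : prime p -> ~~ (p %| m)%N -> (0 < e)%N ->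
  (e %| m * p ^ a)%N ->
  gcdn e (m * p ^ j) = (gcdn e m * p ^ minn (logn p e) j)%N.
Proof.
move=> pp pm e0 en; have [e' cpe' eE] := pfactor_coprime pp e0.
set c := logn p e in eE *.
have cpm : coprime p m by rewrite prime_coprime.
have e'm : (e' %| m)%N.
  rewrite -(@Gauss_dvdl e' m (p ^ a)) ?coprimeXr // 1?coprime_sym //.
  by apply: dvdn_trans en; rewrite eE dvdn_mulr.
have [q qE] := dvdnP e'm.
have key i : gcdn e (m * p ^ i) = (e' * p ^ minn c i)%N.
  rewrite eE qE (_ : q * e' * p ^ i = e' * (q * p ^ i))%N; last first.
    by rewrite mulnA [(e' * q)%N]mulnC.
  rewrite -muln_gcdr Gauss_gcdr; last first.
    by rewrite coprimeXl //; apply: coprime_dvdr cpm; rewrite qE dvdn_mulr.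
  have [ci|ic] := leqP c i.
    by congr (_ * _)%N; apply/gcdn_idPl; rewrite dvdn_exp2l.
  by congr (_ * _)%N; apply/gcdn_idPr; rewrite dvdn_exp2l // ltnW.
by have := key 0%N; rewrite minn0 expn0 !muln1 => ->; exact: key.
Qed.

(** Surjectivity of reduction on the invariants of each subgroup generated by a power [sigma ^ d]:
    the only trace of flabbiness that the matrix argument retains. *)
Definition liftable (R : idomainType) (F : fieldType) (rho : {rmorphism R -> F})
    (n N : nat) (A : 'M[R]_N) : Prop :=
  forall d, (d %| n)%N -> forall vb : 'rV[F]_N,
    vb *m hmx (map_mx rho A) ('X^d - 1) = 0 ->
    exists v : 'rV[R]_N, v *m hmx A ('X^d - 1) = 0 /\ map_mx rho v = vb.

Section LocalRank.
Variable R : idomainType.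
Hypotheses (pidR : pid R) (char0 : [pchar R] =i pred0).
Variables (F : fieldType) (rho : {rmorphism R -> F}) (t : R).
Hypothesis res : residue_at rho t.
Variables (n N : nat) (A : 'M[R]_N) (l : seq nat).
Hypotheses (n0 : (0 < n)%N) (An : A ^+ n = 1).
Hypothesis ln : all (fun e => e %| n)%N l.
Hypothesis chi : char_poly A = \prod_(e <- l) ('X^e - 1).
Hypothesis Alift : liftable rho n A.
Local Notation K := {fraction R}.
Local Notation toK := (@tofrac R).
Let Ab := map_mx rho A.

Lemma map_Xn_sub1 (S T : nzRingType) (f : {rmorphism S -> T}) d :
  map_poly f ('X^d - 1) = 'X^d - 1.
Proof. by rewrite rmorphB rmorph1 /= map_polyXn. Qed.

Let lpos e : e \in l -> (0 < e)%N.
Proof. by move=> /(allP ln)/(dvdn_gt0 n0). Qed.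

Lemma kernel_residue d r (E : 'M[R]_(r, N)) : (d %| n)%N ->
  kernel_basis A ('X^d - 1) E ->
  (map_mx rho E :=: kermx (hmx Ab ('X^d - 1)))%MS.
Proof.
move=> dn kE; apply/eqmxP; apply/andP; split.
  apply/sub_kermxP; rewrite -(map_Xn_sub1 rho) -map_hmx -map_mxM.
  by rewrite (kernel_basis_eq0 kE) map_mx0.
apply/rV_subP => vb /sub_kermxP /(Alift dn)[v [v0 <-]].
by have [_ /(_ v)[/(_ v0)[w ->] _]] := kE; rewrite map_mxM submxMl.
Qed.

(** Liftability identifies the kernel mod [t] with the reduction of the kernel lattice, whose rank
    is computed over the fraction field. *)
Lemma rank_kernel_residue d : (d %| n)%N ->
  \rank (kermx (hmx Ab ('X^d - 1))) =
    (size (\prod_(e <- l) ('X^(gcdn e d) - 1 : {poly R}))).-1.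
Proof.
move=> dn; have [r [E [B [kE EA]]]] := kernel_lattice pidR A ('X^d - 1).
rewrite -(kernel_residue dn kE) (eqP (kernel_basis_residue res kE)).
rewrite -(cyclic_kernel_char_poly char0 n0 An dn ln chi kE EA).
by rewrite size_char_poly.
Qed.

Section Factor.
Variables (m : nat) (g : {poly F}).
Hypotheses (m0 : (0 < m)%N) (mF : m%:R != 0 :> F).
Hypotheses (gm : g \is monic) (gi : irreducible_poly g) (gX : g %| 'X^m - 1).
Let u := ('X^m - 1 : {poly F}) %/ g.

Let fE : 'X^m - 1 = g * u.
Proof. by rewrite mulrC divpK. Qed.

Let cgu : coprimep g u.
Proof. by apply: (separable_coprime (separable_Xn_sub_1 mF)); rewrite fE. Qed.

Let dvd_gcd e : (0 < e)%N -> (g %| 'X^(gcdn e m) - 1) = (g %| 'X^e - 1).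
Proof.
move=> e0; apply/idP/idP => [ge|ge]; last exact: dvdp_Xn_sub1_gcd.
apply: dvdp_trans ge _.
by rewrite -[X in _ %| 'X^X - 1](divnK (dvdn_gcdl e m)) mulnC -geoE dvdp_mulr.
Qed.

Let gcd_split (s : seq nat) : {subset s <= l} -> exists H : {poly F},
  [/\ \prod_(e <- s) ('X^(gcdn e m) - 1) =
        g ^+ count (fun e => g %| 'X^e - 1) s * H,
      H \is monic & coprimep g H].
Proof.
move=> sl.
have [|H [HE Hm gH]] := @prod_irreducible_split _ g [seq gcdn e m | e <- s] m gm gi mF m0.
  by rewrite all_map; apply/allP => e _; exact: dvdn_gcdr.
exists H; split=> //; move: HE; rewrite big_map => ->; congr (g ^+ _ * _).
by rewrite count_map; apply: eq_in_count => e /sl/lpos /=; exact: dvd_gcd.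
Qed.

(** Since [m] is nonzero in [F], the kernel of [X^m - 1] is semisimple, which is the case [w = 1] of
    [rank_uniserial]. The multiplicity of [g] is read off the characteristic polynomial of the
    lifted kernel, as [g] divides [X^(gcd e m) - 1] exactly when it divides [X^e - 1]. *)
Lemma local_rank_unramified : (m %| n)%N ->
  ((size g).-1 * count (fun e => g %| 'X^e - 1)%R l <=
   \rank (kermx (hmx Ab ('X^m - 1)) *m hmx Ab u))%N.
Proof.
move=> mn; have [r [E [B [kE EA]]]] := kernel_lattice pidR A ('X^m - 1).
have EF := kernel_residue mn kE.
have Efree := kernel_basis_residue res kE.
rewrite -(eqmxMr _ EF).
have EAF : map_mx rho E *m Ab = map_mx rho B *m map_mx rho E by rewrite -!map_mxM EA.
rewrite (hmx_intertwine _ EAF) mxrankMfree // -(mul1r u) -[X in X * u](expr0 ('X^m - 1)).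
have chiB := cyclic_kernel_char_poly char0 n0 An mn ln chi kE EA.
have [H [HE Hm gH]] := @gcd_split l (fun _ => id).
have B0 : hmx (map_mx rho B) (('X^m - 1) ^+ 1) = 0.
  apply: (row_free_inj Efree); rewrite -(hmx_intertwine _ EAF) mul0mx expr1.
  by apply/sub_kermxP; rewrite EF.
apply: (rank_uniserial (ltn0Sn 0) fE cgu B0 _ _ gm Hm gH).
  by rewrite muln1 rank_leq_row.
rewrite mul1n -HE -map_char_poly chiB rmorph_prod.
by apply: eq_bigr => e _; rewrite /= map_Xn_sub1.
Qed.

Section Ramified.
Variables (p a b : nat) (p' : R).
Hypotheses (pp : prime p) (t0 : t != 0) (pE : p%:R = t * p') (rp' : rho p' != 0).
Hypotheses (nE : n = (m * p ^ a)%N) (ba : (b < a)%N).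
Let d := (m * p ^ b.+1)%N.
Let d' := (m * p ^ b)%N.
Let w := (p ^ b.+1 - p ^ b)%N.
(** The quotient of [X^(gcd e d) - 1] by [X^(gcd e d') - 1], that is, the part of [X^e - 1] lying
    over [geo S d' p]. The explicit form makes sense over every ring and commutes with reduction.
    The complementary factor of [X^e - 1] is [Hc]. *)
Let Q (S : nzRingType) e : {poly S} :=
  if (b < logn p e)%N then geo S (gcdn e m * p ^ b) p else 1.

Let p0 : (0 < p)%N. Proof. exact: prime_gt0. Qed.

Let pm : ~~ (p %| m)%N.
Proof. by rewrite (dvdn_pcharf (residue_pchar res pp pE)). Qed.

Let w0 : (0 < w)%N.
Proof. by rewrite subn_gt0 ltn_exp2l // prime_gt1. Qed.

Let dn : (d %| n)%N.
Proof. by rewrite nE dvdn_pmul2l // dvdn_exp2l. Qed.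

Let d'd : (d' * p)%N = d.
Proof. by rewrite /d /d' expnSr mulnA. Qed.

Let d'n : (d' %| n)%N.
Proof. by apply: dvdn_trans dn; rewrite -d'd dvdn_mulr. Qed.

Let d0 : (0 < d)%N. Proof. exact: dvdn_gt0 dn. Qed.
Let d'0 : (0 < d')%N. Proof. exact: dvdn_gt0 d'n. Qed.

Let gcdE (S : comNzRingType) e : e \in l ->
  'X^(gcdn e d) - 1 = ('X^(gcdn e d') - 1) * Q S e.
Proof.
move=> el; have e0 := lpos el; have en : (e %| m * p ^ a)%N by rewrite -nE (allP ln).
rewrite /Q /d /d' !(gcdn_pfactor_mul _ pp pm e0 en).
case: ltnP => [be|eb]; last by rewrite !(minn_idPl _) ?mulr1 // leqW.
by rewrite !(minn_idPr _) ?geoE -?mulnA -?expnSr // ltnW.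
Qed.

Let Hc (S : nzRingType) e : {poly S} :=
  ('X^(gcdn e d') - 1) * geo S (gcdn e d) (e %/ gcdn e d).

Let QH (S : comNzRingType) e : e \in l -> 'X^e - 1 = Q S e * Hc S e.
Proof.
move=> el; rewrite /Hc mulrA [Q S e * _]mulrC -gcdE // geoE mulnC divnK //.
exact: dvdn_gcdl.
Qed.

Let mapQ (S T : nzRingType) (f : {rmorphism S -> T}) e : map_poly f (Q S e) = Q T e.
Proof. by rewrite /Q; case: ltnP => _; rewrite ?map_geo ?rmorph1. Qed.

Let mapHc (S T : nzRingType) (f : {rmorphism S -> T}) e :
  map_poly f (Hc S e) = Hc T e.
Proof. by rewrite /Hc rmorphM /= map_geo map_Xn_sub1. Qed.

Let Qmonic e : e \in l -> Q R e \is monic.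
Proof.
move=> el; rewrite /Q; case: ltnP => _; last exact: monic1.
by rewrite geo_monic // muln_gt0 gcdn_gt0 (lpos el) expn_gt0 p0.
Qed.

Let Hmonic e : e \in l -> Hc R e \is monic.
Proof.
by move=> el; rewrite -(monicMl _ (Qmonic el)) -QH // Xn_sub1_monic ?lpos.
Qed.

Let cQH e : e \in l -> coprimep (Q K e) (Hc K e).
Proof.
move=> el; have sep := separable_Xn_sub1_fraction char0 (lpos el).
by apply: (separable_coprime sep); rewrite -QH.
Qed.

Let cPsi : coprimep ('X^d' - 1) (geo K d' p).
Proof.
have sep := separable_Xn_sub1_fraction char0 d0.
by apply: (separable_coprime sep); rewrite geoE d'd.
Qed.

Let dvdX (c : {poly K}) i j : (i %| j)%N -> c %| 'X^i - 1 -> c %| 'X^j - 1.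
Proof. by move=> /divnK <- cX; apply: dvdp_trans cX _; rewrite mulnC -geoE dvdp_mulr. Qed.

Let QPsi e : e \in l -> Q K e %| geo K d' p.
Proof.
move=> el; have e0 := lpos el.
have Qd : Q K e %| 'X^(gcdn e d) - 1 by rewrite gcdE // dvdp_mull.
suff cop : coprimep (Q K e) ('X^d' - 1).
  rewrite -(Gauss_dvdpr _ cop) geoE d'd.
  by apply: dvdX Qd; exact: dvdn_gcdr.
apply/coprimepP => c cQ cX.
have gd0 : (0 < gcdn e d)%N by rewrite gcdn_gt0 e0.
have sep := separable_Xn_sub1_fraction char0 gd0.
have /coprimepP cop : coprimep ('X^(gcdn e d') - 1) (Q K e).
  by apply: (separable_coprime sep); rewrite -gcdE.
apply: cop => //.
have -> : gcdn e d' = gcdn (gcdn e d) d'.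
  rewrite -gcdnA; congr gcdn; apply/esym/gcdn_idPr.
  by rewrite -d'd dvdn_mulr.
by apply: dvdp_Xn_sub1_gcd cX => //; apply: dvdp_trans cQ Qd.
Qed.

Let HPsi e : e \in l -> coprimep (Hc K e) (geo K d' p).
Proof.
move=> el; have e0 := lpos el; apply/coprimepP => c cH cP.
have cXe : c %| 'X^e - 1 by rewrite (QH K el) dvdp_mull.
have cXd : c %| 'X^d - 1 by rewrite -d'd -geoE dvdp_mull.
have := dvdp_Xn_sub1_gcd e0 cXe cXd; rewrite gcdE // Gauss_dvdpl; last first.
  by apply: coprimep_dvdr cH _; rewrite coprimep_sym cQH.
move=> cX; move/coprimepP: cPsi; apply=> //.
by apply: dvdX cX; exact: dvdn_gcdr.
Qed.

Let psi_kernel_char_poly r (E : 'M[R]_(r, N)) (B : 'M[R]_r) :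
  kernel_basis A (geo R d' p) E -> E *m A = B *m E ->
  char_poly B = \prod_(e <- l) Q R e.
Proof.
move=> kE EA.
have chi' : char_poly A = (\prod_(e <- l) Q R e) * \prod_(e <- l) Hc R e.
  by rewrite chi -big_split; apply: eq_big_seq => e; exact: QH.
have hh : geo R d' p * (('X^d' - 1) * geo R d (n %/ d)) = 'X^n - 1.
  by rewrite mulrCA mulrA geoE d'd geoE mulnC divnK.
apply: (kernel_char_poly char0 (k := size l) n0 An hh chi' _ _ _ _ kE EA).
- by rewrite big_seq; apply: monic_prod => e; exact: Qmonic.
- by rewrite big_seq; apply: monic_prod => e; exact: Hmonic.
- rewrite rmorph_prod map_geo (eq_bigr (fun e => Q K e)) => [|e _]; last exact: mapQ.
  rewrite big_seq big_mkcond /=; apply: dvdp_big_exp => e.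
  by case: ifP => [/QPsi //|_]; exact: dvd1p.
- rewrite rmorph_prod map_geo big_seq.
  elim/big_ind: _ => [||e el]; first exact: coprime1p.
    by move=> x y cx cy; rewrite coprimepMl cx.
  by rewrite /= mapHc HPsi.
Qed.

(** Let [E] be the kernel lattice of [geo R d' p]. The corank bound lets [rank_uniserial] apply to
    its reduction, where [g] has multiplicity [w] for each exponent counted. This transfers to the
    kernel of [A^d - 1] because [A^d' - 1] maps that kernel mod [t] onto the reduction of [E]. *)
Lemma local_rank_ramified :
  ((size g).-1 * count (fun e => (b < logn p e)%N && (g %| 'X^e - 1)%R) l <=
   \rank (kermx (hmx Ab ('X^d - 1)) *m hmx Ab (('X^d - 1) %/ g)))%N.
Proof.
have pF := residue_pchar res pp pE.
have [r [E [B [kE EA]]]] := kernel_lattice pidR A (geo R d' p).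
have chiB := psi_kernel_char_poly kE EA; have [Einj Eker] := kE.
have Efree := kernel_basis_residue res kE.
have EAF : map_mx rho E *m Ab = map_mx rho B *m map_mx rho E by rewrite -!map_mxM EA.
have B0 : hmx B (geo R d' p) = 0.
  apply/row_matrixP => i; rewrite row0; apply: Einj.
  by rewrite -row_mul -(hmx_intertwine _ EA) (kernel_basis_eq0 kE) row0.
have geoF : geo F d' p = ('X^m - 1) ^+ w by rewrite geo_pchar.
have B0F : hmx (map_mx rho B) (('X^m - 1) ^+ w) = 0.
  by rewrite -geoF -(map_geo rho) -map_hmx B0 map_mx0.
have corank := ramified_corank res t0 pp pE rp' B0.
pose s := [seq e <- l | (b < logn p e)%N].
have [|H [HE Hm gH]] := @gcd_split s.
  by move=> e; rewrite mem_filter => /andP[].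
have chiBF : char_poly (map_mx rho B) =
    g ^+ (w * count (fun e => g %| 'X^e - 1)%R s) * H ^+ w.
  rewrite mulnC exprM -exprMn -HE -map_char_poly chiB rmorph_prod /= big_filter.
  rewrite -prodrXl [RHS]big_mkcond /=; apply: eq_bigr => e _; rewrite mapQ /Q.
  by case: ifP => // _; rewrite geo_pchar // gcdn_gt0 m0 orbT.
have := rank_uniserial w0 fE cgu B0F corank chiBF gm (monic_exp _ Hm)
  (coprimep_expr _ gH).
rewrite count_filter => le1; apply: leq_trans (leq_trans le1 _).
  rewrite leq_mul2l; apply/orP; right; rewrite sub_count // => e /=.
  by rewrite andbC.
(* The image of [V] under [A^d' - 1] lies in the reduction of [E] because vectors of [V] lift to
   kernel vectors over [R]. It is all of it by dimension: [V] exceeds the kernel of [A^d' - 1] by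
   exactly [r], the rank of [E]. *)
pose V := kermx (hmx Ab ('X^d - 1)).
have geoAb : ('X^d' - 1) * geo F d' p = 'X^d - 1 by rewrite geoE d'd.
have VE : (V *m hmx Ab ('X^d' - 1) <= map_mx rho E)%MS.
  apply/row_subP => i; rewrite row_mul.
  have /(Alift dn)[v [v0 <-]] : row i V *m hmx Ab ('X^d - 1) = 0.
    by rewrite -row_mul mulmx_ker row0.
  have [w' wE] : exists w', v *m hmx A ('X^d' - 1) = w' *m E.
    by apply/Eker; rewrite -mulmxA -hmxM geoE d'd.
  by rewrite -(map_Xn_sub1 rho) -map_hmx -map_mxM wE map_mxM submxMl.
have rankV : (r <= \rank (V *m hmx Ab ('X^d' - 1)))%N.
  have H1 := mxrank_mul_ker V (hmx Ab ('X^d' - 1)).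
  have H2 : (\rank (V :&: kermx (hmx Ab ('X^d' - 1))) <=
             \rank (kermx (hmx Ab ('X^d' - 1))))%N by rewrite mxrankS ?capmxSr.
  have H3 : (\rank V = \rank (kermx (hmx Ab ('X^d' - 1))) + r)%N.
    rewrite !rank_kernel_residue // (eq_big_seq _ (@gcdE R)) big_split -chiB /=.
    have pm1 : \prod_(e <- l) ('X^(gcdn e d') - 1) \is @monic R.
      by apply: monic_prod => e _; rewrite Xn_sub1_monic // gcdn_gt0 d'0 orbT.
    rewrite size_monicM ?monic_neq0 ?char_poly_monic // size_char_poly addnS /=.
    have := size_poly_gt0 (\prod_(e <- l) ('X^(gcdn e d') - 1 : {poly R})).
    rewrite (monic_neq0 pm1); move: (size _) => x; clear; case: x => //.
  move: H1 H2; rewrite H3; set w1 := \rank (V *m _); set w2 := \rank (kermx _).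
  by move: (\rank (V :&: _)%MS) w1 w2; clear; lia.
have EV : (map_mx rho E <= V *m hmx Ab ('X^d' - 1))%MS.
  rewrite -(geq_leqif (mxrank_leqif_sup VE)).
  exact: leq_trans (rank_leq_row _) rankV.
have fw : ('X^d - 1) %/ g = ('X^d' - 1) * (('X^m - 1) ^+ w.-1 * u).
  suff -> : 'X^d - 1 = ('X^d' - 1) * (('X^m - 1) ^+ w.-1 * u) * g.
    by rewrite mulpK // monic_neq0.
  rewrite -geoAb geoF -!mulrA; congr (_ * _).
  by rewrite -{1}(prednK w0) exprSr [u * g]mulrC -fE.
rewrite fw (hmxM Ab) mulmxA.
apply: leq_trans (mxrankS (submxMr _ EV)).
by rewrite (hmx_intertwine _ EAF) mxrankMfree.
Qed.

End Ramified.
End Factor.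
End LocalRank.

(** * Direct sums of cyclic modules *)

Lemma irreducible_pfactor (F : fieldType) (f g : {poly F}) :
  f != 0 -> irreducible_poly g -> exists k h, f = g ^+ k * h /\ coprimep g h.
Proof.
move=> + gi; have [s le_s] := ubnP (size f); elim: s f le_s => // s IH f le_s f0.
have [gf|gf] := boolP (g %| f); last first.
  exists 0%N, f; rewrite expr0 mul1r; split=> //.
  by rewrite irreducible_poly_coprime.
have [q fE] := dvdpP _ _ gf.
have q0 : q != 0 by apply: contraNneq f0 => q0; rewrite fE q0 mul0r.
have g0 := irredp_neq0 gi.
have [|//|k [h [qE gh]]] := IH q.
  rewrite -ltnS; apply: leq_ltn_trans le_s; rewrite fE size_mul //.
  have := gi.1; move: q0; rewrite -size_poly_gt0; move: (size q) (size g).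
  by move=> x y; clear; lia.
by exists k.+1, h; split=> //; rewrite fE qE exprS; ring.
Qed.

Section CyclicSummands.
Variables (F : fieldType) (N : nat) (A : 'M[F]_N) (k : nat).
Variables (d ord : 'I_k -> nat).
Hypothesis d_gt0 : forall i, (0 < d i)%N.
Let f i : {poly F} := 'X^(d i) - 1.

Hypothesis rankA : forall i g, g \is monic -> irreducible_poly g -> g %| f i ->
  ((size g).-1 * #|[set j | (ord i <= ord j)%N && (g %| f j)%R]| <=
   \rank (kermx (hmx A (f i)) *m hmx A (f i %/ g)))%N.

Let f0 i : f i != 0. Proof. exact: Xn_sub1_neq0. Qed.

(** The [v i], for [i] in [S], generate inside [F^N] a direct sum of the cyclic modules [F[X]/(f
    i)]. *)
Definition cyclically_independent (S : {set 'I_k}) (v : 'I_k -> 'rV[F]_N) :=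
  (forall i, i \in S -> v i *m hmx A (f i) = 0) /\
  (forall c : 'I_k -> {poly F}, \sum_(i in S) v i *m hmx A (c i) = 0 ->
     forall i, i \in S -> f i %| c i).

Section Step.
Variables (S : {set 'I_k}) (v : 'I_k -> 'rV[F]_N) (i : 'I_k).
Hypotheses (indS : cyclically_independent S v) (iS : i \notin S).
Hypothesis iord : forall j, j \in S -> (ord i <= ord j)%N.

Let W (x : 'rV[F]_N) : Prop :=
  exists c : 'I_k -> {poly F}, x = \sum_(j in S) v j *m hmx A (c j).

Let WM x q : W x -> W (x *m hmx A q).
Proof.
move=> [c ->]; exists (fun j => c j * q); rewrite mulmx_suml.
by apply: eq_bigr => j _; rewrite hmxM mulmxA.
Qed.

Let Wcoprime x g h : coprimep g h -> x *m hmx A g = 0 -> W (x *m hmx A h) -> W x.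
Proof.
move=> /Bezout_eq1_coprimepP[[a b] /= ab] xg xh.
have -> : x = x *m hmx A h *m hmx A b.
  rewrite -mulmxA -hmxM -[LHS]mulmx1 -(hmx1 A) -ab hmxD mulmxDr.
  by rewrite [a * g]mulrC [b * h]mulrC !hmxM mulmxA xg mul0mx add0r.
exact: WM.
Qed.

(** Otherwise the image of [(f i / g)(A)] on the kernel of [f i] lies in the g-torsion of [W]. As
    [W] is a direct sum, this torsion is spanned by the multiples of the [v j (f j / g)] for [j] in
    [J], so its dimension is at most [deg g * #|J|]. But [J] misses the index [i] counted in
    [rankA]. *)
Let exists_outside g : g \is monic -> irreducible_poly g -> g %| f i ->
  exists x, x *m hmx A (f i) = 0 /\ ~ W (x *m hmx A (f i %/ g)).
Proof.
move=> gm gi gf; apply: contrapT => nx.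
have xW x : x *m hmx A (f i) = 0 -> W (x *m hmx A (f i %/ g)).
  by move=> xf; apply: contrapT => nW; apply: nx; exists x.
pose q j : {poly F} := f j %/ g.
pose D := (size g).-1.
pose Kr j := \matrix_(r < D) (v j *m hmx A (q j) *m hmx A 'X^r).
pose J := [set j in S | g %| f j].
pose Z := (\sum_(j in J) <<Kr j>>)%MS.
have rZ : (\rank Z <= D * #|J|)%N.
  rewrite mulnC -sum_nat_const /Z; elim/big_rec2: _ => [|j B a _ IHr].
    by rewrite mxrank0.
  apply: leq_trans (mxrank_adds_leqif _ _).1 _; apply: leq_add => //.
  by rewrite mxrank_gen rank_leq_row.
have MZ : (kermx (hmx A (f i)) *m hmx A (f i %/ g) <= Z)%MS.
  apply/row_subP => r; rewrite row_mul; set x := row r _.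
  have xf : x *m hmx A (f i) = 0 by rewrite -row_mul mulmx_ker row0.
  have [c cE] := xW x xf.
  have cf : \sum_(j in S) v j *m hmx A (c j * g) = 0.
    transitivity (x *m hmx A (f i %/ g) *m hmx A g).
      rewrite cE mulmx_suml; apply: eq_bigr => j _; by rewrite hmxM mulmxA.
    by rewrite -mulmxA -hmxM divpK // xf.
  rewrite cE; apply: summx_sub => j jS.
  have fc := indS.2 _ cf j jS.
  have [gfj|gfj] := boolP (g %| f j); last first.
    have cop : coprimep (f j) g by rewrite coprimep_sym irreducible_poly_coprime.
    rewrite (hmx_dvd_eq0 (p := f j)) ?sub0mx ?(indS.1 j jS) //.
    by rewrite -(Gauss_dvdpl _ cop).
  have jJ : j \in J by rewrite inE jS.
  apply: submx_trans (sumsmx_sup j jJ (submx_refl _)); rewrite genmxE.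
  have fjE : f j = q j * g by rewrite divpK.
  have [c' c'E] : exists c' : {poly F}, c j = q j * c'.
    move: fc; rewrite fjE dvdp_mul2r ?irredp_neq0 // => /dvdpP[c' ->].
    by exists c'; rewrite mulrC.
  have vg : v j *m hmx A (q j) *m hmx A g = 0.
    by rewrite -mulmxA -hmxM -fjE indS.1.
  rewrite c'E hmxM mulmxA (divp_eq c' g) hmxD mulmxDr mulrC hmxM mulmxA vg.
  rewrite mul0mx add0r.
  have sz : (size (c' %% g)%R <= D)%N.
    rewrite -ltnS prednK; first by rewrite ltn_modp irredp_neq0.
    exact: ltnW gi.1.
  rewrite -(poly_rV_K sz) /rVpoly poly_def hmx_sum mulmx_sumr.
  apply: summx_sub => r' _; rewrite hmxZ -scalemxAr scalemx_sub //.
  have -> : v j *m hmx A (q j) *m hmx A 'X^r' = row r' (Kr j) by rewrite rowK.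
  exact: row_sub.
have := leq_trans (rankA gm gi gf) (leq_trans (mxrankS MZ) rZ).
have D0 : (0 < D)%N by have := gi.1; rewrite /D; case: (size g) => [|[]].
rewrite leq_pmul2l // leqNgt => /negP; apply.
apply: proper_card; apply/properP; split.
  by apply/fintype.subsetP => j; rewrite !inE => /andP[/iord -> ->].
by exists i; rewrite !inE ?leqnn ?gf // (negPf iS).
Qed.

(** One vector serving all prime factors of [e] at once, by induction on the degree of [e]; the
    module need not be cyclic, so primary components are combined. *)
Let exists_good e : e %| f i -> exists x, x *m hmx A (f i) = 0 /\
  forall g, g \is monic -> irreducible_poly g -> g %| e ->
    ~ W (x *m hmx A (f i %/ g)).
Proof.
have [s le_s] := ubnP (size e); elim: s e le_s => // s IH e le_s ef.
have [e1|e1] := leqP (size e) 1.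
  exists 0; split=> [|g gm gi ge]; first by rewrite mul0mx.
  have e0 : e != 0 by apply: contraNneq (f0 i) => e0; rewrite -dvd0p -e0.
  have := leq_trans (dvdp_leq e0 ge) e1; have := gi.1.
  by move: (size g) => x; clear; lia.
have [g [gm gi ge]] := monic_irreducible_factor e1.
have g0 := irredp_neq0 gi.
have e0 : e != 0 by apply: contraNneq (f0 i) => e0; rewrite -dvd0p -e0.
have [e' eE] := dvdpP _ _ ge.
have e'0 : e' != 0 by apply: contraNneq e0 => e'0; rewrite eE e'0 mul0r.
have [||x [xf xP]] := IH e'.
- rewrite -ltnS; apply: leq_ltn_trans le_s; rewrite eE size_mul //.
  have := gi.1; move: e'0; rewrite -size_poly_gt0; move: (size e') (size g).
  by move=> y z; clear; lia.
- by apply: dvdp_trans ef; rewrite eE dvdp_mulr.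
have monic_eq g1 : g1 \is monic -> irreducible_poly g1 -> g1 %| e ->
    g1 = g \/ g1 %| e'.
  move=> g1m g1i; rewrite eE => g1e.
  have [|ng] := boolP (g1 %| e'); [by right|left].
  move: g1e; rewrite Gauss_dvdpr ?irreducible_poly_coprime // => g1g.
  apply/eqP; rewrite -eqp_monic //; apply: gi.2 => //.
  by rewrite gtn_eqF // g1i.1.
have [ge'|nge'] := boolP (g %| e').
  exists x; split=> // g1 g1m g1i /(monic_eq _ g1m g1i)[->|]; exact: xP.
have gf : g %| f i := dvdp_trans ge ef.
have [z [zf zW]] := exists_outside gm gi gf.
have [K [h [fE gh]]] := irreducible_pfactor (f0 i) gi.
have ffac g1 : g1 %| f i -> f i = f i %/ g1 * g1 by move=> ?; rewrite divpK.
have K0 : (0 < K)%N.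
  rewrite lt0n; apply/eqP => K0; move: gh; rewrite irreducible_poly_coprime //.
  by move: gf; rewrite fE K0 expr0 mul1r => ->.
(* Here [f i = g^K h]. After [f i / g] the term in [x] becomes a multiple of [f i] and dies; after
   [f i / g1] with [g1] different from [g], the term in [z] dies because [g1] divides [h]. What
   remains is multiplied by [h], respectively [g^K], which is invertible on the torsion
   concerned. *)
exists (x *m hmx A (g ^+ K) + z *m hmx A h); split.
  rewrite mulmxDl -!mulmxA ![hmx A _ *m hmx A (f i)]hmx_comm !mulmxA.
  by rewrite xf zf !mul0mx addr0.
have gcase : ~ W ((x *m hmx A (g ^+ K) + z *m hmx A h) *m hmx A (f i %/ g)).
  move=> Wg; apply: zW; apply: (Wcoprime gh).
    by rewrite -mulmxA -hmxM divpK.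
  suff -> : z *m hmx A (f i %/ g) *m hmx A h =
     (x *m hmx A (g ^+ K) + z *m hmx A h) *m hmx A (f i %/ g) by [].
  rewrite mulmxDl -[x *m _ *m _]mulmxA -hmxM -(prednK K0) exprS mulrAC.
  rewrite [g * _]mulrC -ffac // hmxM mulmxA xf mul0mx add0r.
  by rewrite -!mulmxA hmx_comm.
move=> g1 g1m g1i /(monic_eq _ g1m g1i)[->|g1e'] //.
have g1e : g1 %| e by rewrite eE dvdp_mulr.
have g1f : g1 %| f i := dvdp_trans g1e ef.
have cg1 : coprimep g1 g.
  rewrite irreducible_poly_coprime //; apply: contra nge' => g1g.
  have /eqp_dvdl <- : g1 %= g; last by [].
  by apply: gi.2 => //; rewrite gtn_eqF // g1i.1.
have g1h : g1 %| h.
  by rewrite -(Gauss_dvdpr _ (coprimep_expr K cg1)) -fE.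
move=> Wg; apply: (xP g1 g1m g1i g1e'); apply: (Wcoprime (coprimep_expr K cg1)).
  by rewrite -mulmxA -hmxM divpK.
suff -> : x *m hmx A (f i %/ g1) *m hmx A (g ^+ K) =
   (x *m hmx A (g ^+ K) + z *m hmx A h) *m hmx A (f i %/ g1) by [].
rewrite mulmxDl -[z *m _ *m _]mulmxA -hmxM.
have -> : h * (f i %/ g1) = f i * (h %/ g1).
  rewrite -{1}(divpK g1h) [in RHS](ffac g1) //; ring.
rewrite hmxM mulmxA zf mul0mx addr0.
by rewrite -!mulmxA hmx_comm.
Qed.

(** If [x c] lies in [W], so does [x gcd(c, f i)]. Were this gcd a proper divisor of [f i], it would
    divide some [f i / g] with [g] irreducible, against the choice of [x]. *)
Lemma cyclically_independent_step : exists v', cyclically_independent (i |: S) v'.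
Proof.
have [x [xf xP]] := exists_good (dvdpp (f i)).
have xc c : W (x *m hmx A c) -> f i %| c.
  move=> Wc; have [[a b] /= ab] := Bezoutp c (f i).
  pose c0 := gcdp c (f i).
  have Wc0 : W (x *m hmx A c0).
    have /dvdpP[r rE] : a * c + b * f i %| c0 by rewrite (eqp_dvdl _ ab).
    rewrite rE [r * _]mulrC hmxM mulmxA; apply: WM.
    rewrite hmxD mulmxDr ![_ * c]mulrC ![_ * f i]mulrC !hmxM !mulmxA xf mul0mx.
    by rewrite addr0; apply: WM.
  have c0f : c0 %| f i by apply: dvdp_gcdr.
  have [q qE] := dvdpP _ _ c0f.
  have [q1|q1] := leqP (size q) 1.
    apply: dvdp_trans (dvdp_gcdl c (f i)); rewrite -/c0 qE (size1_polyC q1) mul_polyC.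
    rewrite dvdpZl // -polyC_eq0 -size1_polyC //.
    by apply: contraNneq (f0 i) => q0; rewrite qE q0 mul0r.
  have [g [gm gi gq]] := monic_irreducible_factor q1.
  exfalso; apply: (xP g gm gi); first by rewrite qE dvdp_mulr.
  have -> : f i %/ g = c0 * (q %/ g).
    by rewrite qE -{1}(divpK gq) mulrAC mulpK ?irredp_neq0 // mulrC.
  by rewrite hmxM mulmxA; apply: WM.
exists (fun j => if j == i then x else v j).
have vS j : j \in S -> (if j == i then x else v j) = v j.
  by move=> jS; case: eqP jS => // -> iS'; case/negP: iS.
split=> [j|c].
  by rewrite in_setU1; case: eqP => [-> //|_ /= jS]; apply: indS.1.
rewrite big_setU1 //= eqxx => sum0.
have sumS : \sum_(j in S) (if j == i then x else v j) *m hmx A (c j) =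
    \sum_(j in S) v j *m hmx A (c j).
  by apply: eq_bigr => j jS; rewrite vS.
rewrite sumS in sum0.
have ci : f i %| c i.
  apply: xc; exists (fun j => - c j); apply/eqP; rewrite -subr_eq0 -sumrN.
  apply/eqP; rewrite -[RHS]sum0; congr (_ + _); apply: eq_bigr => j _.
  by rewrite hmxN mulmxN opprK.
move: sum0; rewrite (hmx_dvd_eq0 ci xf) add0r => sum0 j.
rewrite in_setU1 => /orP[/eqP -> //|]; exact: indS.2.
Qed.

End Step.

(** An index of least [ord] is removed from the set, so it is treated after all the others: the
    earlier generators then have [ord] at least as large, as the step requires. *)
Lemma exists_cyclically_independent : exists v, cyclically_independent [set: 'I_k]%SET v.
Proof.
suff all_sets (S : {set 'I_k}) : exists v, cyclically_independent S v by [].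
have [s] := ubnP #|S|; elim: s S => // s IH S Ss.
have [->|/set0Pn[i0 i0S]] := eqVneq S finset.set0.
  by exists (fun=> 0); split=> [i|c _ i]; rewrite finset.in_set0.
have [i iS' imin] := @arg_minnP _ i0 (mem S) ord i0S.
have iS : i \in S := iS'.
have [|v vS] := IH (S :\ i).
  by rewrite (cardsD1 i S) iS in Ss; rewrite -ltnS.
have [||v' v'S] := @cyclically_independent_step (S :\ i) v i vS.
- by rewrite finset.in_setD1 eqxx.
- by move=> j; rewrite finset.in_setD1 => /andP[_ /imin].
by exists v'; rewrite -(finset.setD1K iS).
Qed.

End CyclicSummands.

Lemma count_nth_card (P : pred nat) (l : seq nat) :
  count P l = #|[set j : 'I_(size l) | P (nth 0%N l j)]|.
Proof.
rewrite -sum1_count (big_nth 0%N) big_mkord -sum1_card.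
by apply: eq_bigl => j; rewrite inE.
Qed.

Definition orbit_index (l : seq nat) : finType :=
  {i : 'I_(size l) & 'I_(nth 0%N l i)}.

Section OrbitMatrix.
Variables (l : seq nat).
Local Notation T := (orbit_index l).
Local Notation d i := (nth 0%N l i).

(** The rows are the vectors [v_i A^r] with [r < d_i], indexed by dependent pairs [(i, r)]. *)
Definition orbit_mx (S : comNzRingType) N (A : 'M[S]_N) (v : 'I_(size l) -> 'rV[S]_N) :
    'M[S]_(#|T|, N) :=
  \matrix_(s < #|T|) (v (tag (enum_val s)) *m hmx A 'X^(tagged (enum_val s))).

Lemma map_orbit_mx (S S' : comNzRingType) (rho : {rmorphism S -> S'}) N
    (A : 'M[S]_N) v :
  map_mx rho (orbit_mx A v) = orbit_mx (map_mx rho A) (fun i => map_mx rho (v i)).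
Proof.
by apply/row_matrixP => s; rewrite -map_row !rowK map_mxM map_hmx map_polyXn.
Qed.

Lemma orbit_mx_sum (S : comNzRingType) N (A : 'M[S]_N) K (e : 'I_K -> S)
    (v : 'I_K -> 'I_(size l) -> 'rV[S]_N) :
  orbit_mx A (fun i => \sum_j e j *: v j i) = \sum_j e j *: orbit_mx A (v j).
Proof.
apply/row_matrixP => s; rewrite rowK mulmx_suml linear_sum.
by apply: eq_bigr => j _; rewrite linearZ /= rowK scalemxAl.
Qed.

Lemma orbit_mx_permuted (S : comNzRingType) N (A : 'M[S]_N)
    (v : 'I_(size l) -> 'rV[S]_N) :
  (forall i, v i *m hmx A ('X^(d i) - 1) = 0) ->
  forall s, exists s', row s (orbit_mx A v) *m A = row s' (orbit_mx A v).
Proof.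
move=> vP s; rewrite rowK -mulmxA -[X in _ *m (_ *m X)](hmxX A) -hmxM -exprSr.
case: (enum_val s) => i r /=.
have [ri|ri] := ltnP r.+1 (d i).
  exists (enum_rank (Tagged (fun i : 'I_(size l) => 'I_(d i)) (Ordinal ri))).
  by rewrite rowK enum_rankK.
have di0 : (0 < d i)%N by apply: leq_ltn_trans (leq0n r) (ltn_ord r).
exists (enum_rank (Tagged (fun i : 'I_(size l) => 'I_(d i)) (Ordinal di0))).
rewrite rowK enum_rankK /=; have -> : r.+1 = d i.
  by apply/eqP; rewrite eqn_leq ri ltn_ord.
by apply/eqP; rewrite -subr_eq0 -mulmxBr -hmxB vP.
Qed.

(** A linear relation among the rows is a family of polynomials [c i] of degree less than [d i];
    independence makes [X^(d i) - 1] divide [c i], which is therefore zero. *)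
Lemma orbit_mx_free (F : fieldType) N (A : 'M[F]_N) v :
  all (fun e => 0 < e)%N l ->
  cyclically_independent A (fun i : 'I_(size l) => d i) [set: 'I_(size l)]%SET v ->
  row_free (orbit_mx A v).
Proof.
move=> l0 [_ ind]; rewrite -kermx_eq0; apply/rowV0P => w /sub_kermxP wX.
pose W (t : T) := w 0 (enum_rank t).
pose c (i : 'I_(size l)) : {poly F} :=
  \sum_(r < d i) W (Tagged (fun i : 'I_(size l) => 'I_(d i)) r) *: 'X^r.
have sumc : \sum_(i in [set: 'I_(size l)]%SET) v i *m hmx A (c i) = 0.
  rewrite -[RHS]wX mulmx_sum_row.
  rewrite [RHS](reindex (@enum_rank T)) /=; last exact: onW_bij (enum_rank_bij T).
  under [RHS]eq_bigr => t _ do rewrite rowK enum_rankK.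
  rewrite (eq_bigl xpredT) => [|i]; last by rewrite inE.
  under eq_bigr => i _ do rewrite hmx_sum mulmx_sumr.
  rewrite (sig_big_dep _ (fun _ _ => true)) /=; apply: eq_bigr => -[i r] _ /=.
  by rewrite hmxZ scalemxAr.
have c0 i : c i = 0.
  have /ind /(_ i) := sumc; rewrite finset.in_setT => /(_ isT) dvd.
  apply/eqP/negPn/negP => c0.
  have di0 : (0 < d i)%N by apply: (allP l0); apply: mem_nth.
  have := dvdp_leq c0 dvd; rewrite size_XnsubC // leqNgt ltnS => /negP; apply.
  rewrite /c (leq_trans (size_sum _ _ _)) //; apply/bigmax_leqP => r _.
  by rewrite (leq_trans (size_scale_leq _ _)) // size_polyXn.
apply/rowP => s; rewrite mxE -(enum_valK s) -/(W _).
case: (enum_val s) => i r; have := congr1 (fun q : {poly F} => q`_r) (c0 i).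
rewrite coef0 /c coef_sum (bigD1 r) //= coefZ coefXn eqxx mulr1 big1 ?addr0 //.
move=> r' r'r; rewrite coefZ coefXn eq_sym -val_eqE in r'r *.
by rewrite (negPf r'r) mulr0.
Qed.

End OrbitMatrix.

Section LocalGenerators.
Variable R : idomainType.
Hypotheses (pidR : pid R) (char0 : [pchar R] =i pred0).
Variables (F : fieldType) (rho : {rmorphism R -> F}) (t : R).
Hypothesis res : residue_at rho t.
Variables (n N : nat) (A : 'M[R]_N) (l : seq nat).
Hypotheses (n0 : (0 < n)%N) (An : A ^+ n = 1).
Hypothesis ln : all (fun e => e %| n)%N l.
Hypothesis chi : char_poly A = \prod_(e <- l) ('X^e - 1).
Hypothesis Alift : liftable rho n A.
Hypothesis ram : forall p, prime p -> (p %| n)%N -> rho p%:R = 0 ->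
  t != 0 /\ exists2 p', p%:R = t * p' & rho p' != 0.
Local Notation d i := (nth 0%N l i).
Let Ab := map_mx rho A.

Let dn i : (i < size l)%N -> (d i %| n)%N.
Proof. by move=> il; apply: (allP ln); apply: mem_nth. Qed.

Let d0 i : (i < size l)%N -> (0 < d i)%N.
Proof. by move=> /dn/(dvdn_gt0 n0). Qed.

(** The polynomial [(X^D - 1)/(X^e - 1)] maps the kernel of [A^D - 1] into that of [A^e - 1]. A
    lower bound at [D = m p^b] thus descends to every exponent dividing it. *)
Lemma rank_ker_quotient (g : {poly F}) e D : (e %| D)%N -> (0 < e)%N ->
  g %| 'X^e - 1 ->
  (\rank (kermx (hmx Ab ('X^D - 1)) *m hmx Ab (('X^D - 1) %/ g)) <=
   \rank (kermx (hmx Ab ('X^e - 1)) *m hmx Ab (('X^e - 1) %/ g)))%N.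
Proof.
move=> eD e0 ge; have g0 : g != 0.
  by apply: contraTneq ge => ->; rewrite dvd0p Xn_sub1_neq0.
have DE : 'X^D - 1 = ('X^e - 1) * geo F e (D %/ e).
  by rewrite geoE mulnC divnK.
have -> : ('X^D - 1) %/ g = geo F e (D %/ e) * (('X^e - 1) %/ g).
  by rewrite DE -{1}(divpK ge) mulrAC mulpK // mulrC.
rewrite hmxM mulmxA; apply: mxrankS; apply: submxMr; apply/sub_kermxP.
by rewrite -mulmxA -hmxM mulrC -DE mulmx_ker.
Qed.

Lemma local_generators : exists V : 'I_(size l) -> 'rV[R]_N,
  (forall i, V i *m hmx A ('X^(d i) - 1) = 0) /\
  row_free (map_mx rho (orbit_mx A V)).
Proof.
suff [v [vker vind]] : exists v, cyclically_independent Ab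
    (fun i : 'I_(size l) => d i) [set: 'I_(size l)]%SET v.
  have /choice[V VP] (i : 'I_(size l)) : exists V : 'rV[R]_N,
      V *m hmx A ('X^(d i) - 1) = 0 /\ map_mx rho V = v i.
    by apply: Alift; [exact: dn|apply: vker; rewrite finset.in_setT].
  exists V; split=> [i|]; first by case: (VP i).
  rewrite map_orbit_mx; apply: orbit_mx_free.
    exact/allP/(fun e el => dvdn_gt0 n0 (allP ln e el)).
  have -> : (fun i => map_mx rho (V i)) = v by apply/funext => i; case: (VP i).
  by split.
have [nF|nF] := eqVneq (n%:R : F) 0; last first.
  apply: (@exists_cyclically_independent _ _ _ _ _ (fun=> 0%N)) => [i|i g gm gi gX].
    exact: d0.
  have gn : g %| 'X^n - 1.
    by apply: dvdp_trans gX _; rewrite -(divnK (dn (ltn_ord i))) mulnC -geoE dvdp_mulr.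
  apply: leq_trans (rank_ker_quotient (dn (ltn_ord i)) (d0 (ltn_ord i)) gX).
  have := local_rank_unramified pidR char0 res n0 An ln chi Alift n0 nF gm gi gn (dvdnn n).
  by rewrite count_nth_card.
have [p pp [pn pF]] : exists2 p, prime p & (p %| n)%N /\ p%:R = 0 :> F.
  move: nF n0; elim/ltn_ind: n => q IH qF q0.
  have [q1|q1] := leqP q 1.
    have qE : q = 1%N by apply/eqP; rewrite eqn_leq q1.
    by move: qF; rewrite qE => /eqP; rewrite oner_eq0.
  have pq := pdiv_dvd q; have ppr := pdiv_prime q1.
  have [pF|pF] := eqVneq ((pdiv q)%:R : F) 0; first by exists (pdiv q).
  have qE : (q = q %/ pdiv q * pdiv q)%N by rewrite divnK.
  have [|||p pp [pd p0]] := IH (q %/ pdiv q)%N.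
  - by rewrite ltn_Pdiv // prime_gt1.
  - by move: qF; rewrite {1}qE natrM => /eqP; rewrite mulf_eq0 (negPf pF) orbF => /eqP.
  - by rewrite divn_gt0 ?prime_gt0 // dvdn_leq.
  - by exists p => //; split=> //; rewrite qE dvdn_mulr.
have [t0 [p' pE rp']] := ram pp pn (etrans (rmorph_nat rho p) pF).
have pchF : p \in [pchar F] by rewrite inE pp pF eqxx.
have [m cpm nE] := pfactor_coprime pp n0; set a := logn p n in nE.
have m0 : (0 < m)%N by move: n0; rewrite {1}nE muln_gt0 => /andP[].
have mF : m%:R != 0 :> F by rewrite -(dvdn_pcharf pchF) -prime_coprime.
(* The p-adic valuation of the exponents serves as [ord], since the rank bound at [d i] counts only
   exponents of at least that valuation. *)
apply: (@exists_cyclically_independent _ _ _ _ _ (fun i => logn p (d i))) =>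
  [i|i g gm gi gX].
  exact: d0.
set b := logn p (d i).
have di0 := d0 (ltn_ord i).
have [e cpe dE] := pfactor_coprime pp di0; rewrite -/b in dE.
have em : (e %| m)%N.
  rewrite -(@Gauss_dvdl e m (p ^ a)) -?nE; last by rewrite coprimeXr // coprime_sym.
  by apply: dvdn_trans (dn (ltn_ord i)); rewrite dE dvdn_mulr.
have dD : (d i %| m * p ^ b)%N by rewrite dE dvdn_mul.
have gm' : g %| 'X^m - 1.
  have gmb : g %| 'X^(m * p ^ b) - 1.
    by apply: dvdp_trans gX _; rewrite -(divnK dD) mulnC -geoE dvdp_mulr.
  rewrite -[_ %| _]negbK -irreducible_poly_coprime //; apply/negP => cop.
  have := coprimep_expr (p ^ b) cop.
  by rewrite Xn_sub1_Frobenius // irreducible_poly_coprime // gmb.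
apply: leq_trans (rank_ker_quotient dD di0 gX).
have ba : (b <= a)%N by rewrite /a dvdn_leq_log // dn.
(* For [b = 0] every exponent is counted and the semisimple bound at [m] applies. Otherwise the
   ramified bound is used at level [b' = b - 1], where [b' < logn p e] means [b <= logn p e]. *)
case bE : b ba => [|b'] ba.
  rewrite expn0 muln1.
  have mn : (m %| n)%N by rewrite nE dvdn_mulr.
  have := local_rank_unramified pidR char0 res n0 An ln chi Alift m0 mF gm gi gm' mn.
  by rewrite count_nth_card.
have := local_rank_ramified pidR char0 res n0 An ln chi Alift m0 mF gm gi gm' pp t0 pE rp' nE ba.
by rewrite count_nth_card.
Qed.

End LocalGenerators.

(** * Gluing over the maximal ideals *)

Lemma prod_Xn_sub1_size (R : idomainType) (l : seq nat) :
  all (fun e => 0 < e)%N l ->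
  size (\prod_(e <- l) ('X^e - 1 : {poly R})) = (sumn l).+1.
Proof.
elim: l => [|e l IH] /=; first by rewrite big_nil size_poly1.
move=> /andP[e0 l0]; rewrite big_cons size_monicM ?Xn_sub1_monic //.
  by rewrite IH // size_XnsubC // addSn /= addnS.
by rewrite -size_poly_gt0 IH.
Qed.

Lemma card_orbit_index l : #|orbit_index l| = sumn l.
Proof.
rewrite card_tagged; congr sumn.
rewrite -[RHS](mkseq_nth 0%N) /mkseq -val_enum_ord -map_comp.
by apply: eq_map => i; rewrite card_ord.
Qed.

Lemma unramified_residue (R : idomainType) (F : fieldType)
    (rho : {rmorphism R -> F}) t p :
  [pchar R] =i pred0 -> unramified R p -> prime p -> residue_at rho t ->
  rho p%:R = 0 -> t != 0 /\ exists2 p', p%:R = t * p' & rho p' != 0.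
Proof.
move=> char0 unr pp [_ rho0] /rho0[p' pE].
have p0 : p%:R != 0 :> R.
  by rewrite (iffLR (pcharf0P R) char0) -lt0n prime_gt0.
split; first by apply: contraNneq p0 => t0; rewrite pE t0 mul0r.
exists p' => //; apply/eqP => /rho0[q qE]; rewrite qE in pE.
have := unramified_squarefree unr p0 pE.
move=> /(rmorph_unit rho); rewrite (_ : rho t = 0) ?unitr0 //.
by apply/rho0; exists 1; rewrite mulr1.
Qed.

Lemma unramified_unramified_at (R : idomainType) p :
  dedekind R -> semilocal R -> [pchar R] =i pred0 -> prime p ->
  unramified R p -> unramified_at R p.
Proof.
move=> dR sR char0 pp unr; have [nR _ _] := dR; have [pN _] := unr.
have [m mm mp] := nonunit_maximal nR pN.
have [F [rho [t [res rhoE]]]] := maximal_ideal_residue dR sR mm.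
have /(unramified_residue char0 unr pp res)[t0 [p' pE rp']] : rho p%:R = 0 by apply/rhoE.
by exists F, rho, t, p'; split.
Qed.

Theorem permuted_basis (R : idomainType) n N (A : 'M[R]_N) (l : seq nat) :
  dedekind R -> semilocal R -> [pchar R] =i pred0 -> (0 < n)%N ->
  (forall p, prime p -> (p %| n)%N -> unramified R p) ->
  A ^+ n = 1 -> all (fun e => e %| n)%N l ->
  char_poly A = \prod_(e <- l) ('X^e - 1) ->
  (forall (F : fieldType) (rho : {rmorphism R -> F}) t,
     residue_at rho t -> liftable rho n A) ->
  exists X : 'M[R]_N, X \in unitmx /\
    forall s, exists s', row s X *m A = row s' X.
Proof.
move=> dR sR char0 n0 unr An ln chi Alift.
have pidR : pid R by move=> I; apply: semilocal_dedekind_principal.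
have l0 : all (fun e => 0 < e)%N l.
  by apply/allP => e /(allP ln)/(dvdn_gt0 n0).
(* The degree of the characteristic polynomial shows that the orbit matrix is square; substituting
   its index count for [N] avoids casts. *)
have NE : #|orbit_index l| = N.
  rewrite card_orbit_index; apply: succn_inj.
  by rewrite -(prod_Xn_sub1_size R l0) -chi size_char_poly.
case: _ / NE A An chi Alift => A An chi Alift.
have [K [mx [e [mxM mxE e1 e0]]]] := semilocal_CRT sR.
have /choice[V VP] j : exists V : 'I_(size l) -> 'rV[R]_#|orbit_index l|,
    (forall i, V i *m hmx A ('X^(nth 0%N l i) - 1) = 0) /\
    ~ mx j (\det (orbit_mx A V)).
  have [F [rho [t [res rhoE]]]] := maximal_ideal_residue dR sR (mxM j).
  have [|V [VA Vfree]] :=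
      local_generators pidR char0 res n0 An ln chi (Alift F rho t res).
    by move=> p pp pn; apply: unramified_residue (unr p pp pn) pp res.
  exists V; split=> // /rhoE; rewrite -det_map_mx; apply/eqP.
  by rewrite -unitfE -unitmxE -row_free_unit.
pose W i := \sum_j e j *: V j i.
have WP i : W i *m hmx A ('X^(nth 0%N l i) - 1) = 0.
  rewrite mulmx_suml big1 // => j _.
  by rewrite -scalemxAl (VP j).1 scaler0.
exists (orbit_mx A W); split; last exact: orbit_mx_permuted WP.
rewrite unitmxE; have [nR _ _] := dR; apply: notin_maximal_unit nR _ => m.
move=> /[dup] mm /mxE[j mj]; rewrite mj; have := (VP j).2.
have [F [rho [t [res rhoE]]]] := maximal_ideal_residue dR sR (mxM j).
rewrite -!rhoE -!det_map_mx.
suff -> : map_mx rho (orbit_mx A W) = map_mx rho (orbit_mx A (V j)) by [].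
rewrite orbit_mx_sum map_mx_sum (bigD1 j) //= big1 ?addr0 => [|i ij].
  rewrite map_mxZ (_ : rho (e j) = 1) ?scale1r //.
  by apply/eqP; rewrite eq_sym -subr_eq0 -(rmorph1 rho) -rmorphB; apply/eqP/rhoE/e1.
by rewrite map_mxZ (_ : rho (e i) = 0) ?scale0r //; apply/rhoE/e0.
Qed.

(** * Lattices over the group algebra of a cyclic group *)

Lemma hmx_block_diag (R : comNzRingType) m n (A : 'M[R]_m) (B : 'M[R]_n) p :
  hmx (block_mx A 0 0 B) p = block_mx (hmx A p) 0 0 (hmx B p).
Proof.
elim/poly_ind: p => [|p c IH]; first by rewrite !hmx0 block_mx0.
rewrite !hmxD !hmxM !hmxX !hmxC IH mulmx_block !mulmx0 !mul0mx !addr0 !add0r.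
by rewrite [X in _ + X](scalar_mx_block m n c) add_block_mx !addr0.
Qed.

Lemma liftable_block_diag (R : idomainType) (F : fieldType)
    (rho : {rmorphism R -> F}) n m1 m2 (A : 'M[R]_m1) (B : 'M[R]_m2) :
  liftable rho n A -> liftable rho n B -> liftable rho n (block_mx A 0 0 B).
Proof.
move=> lA lB d dn vb; rewrite map_block_mx !map_mx0 !hmx_block_diag.
rewrite -[vb]hsubmxK mul_row_block !mulmx0 addr0 add0r -[RHS]row_mx0.
move=> /eq_row_mx[/(lA d dn)[v [v0 vE]] /(lB d dn)[w [w0 wE]]].
exists (row_mx v w); rewrite map_row_mx vE wE; split=> //.
by rewrite mul_row_block !mulmx0 addr0 add0r v0 w0 row_mx0.
Qed.

(* A vector fixed mod [t] by a permutation is constant mod [t] on its orbits. *)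
Lemma liftable_permuted (R : idomainType) (F : fieldType)
    (rho : {rmorphism R -> F}) (t : R) n k (B : 'M[R]_k) :
  residue_at rho t -> (0 < n)%N -> B ^+ n = 1 ->
  (forall i, exists j, row i B = delta_mx 0 j) -> liftable rho n B.
Proof.
move=> [surj _] n0 Bn rowB; have [s sP] := choice rowB.
have powB e i : row i (B ^+ e) = delta_mx 0 (iter e s i).
  elim: e i => [|e IH] i; first by rewrite expr0 row1.
  by rewrite exprSr row_mul IH -rowE sP.
have s_inj e : (e %| n)%N -> injective (iter e s).
  move=> /dvdnP[q qE] i j ij.
  have iterq x : iter n s x = iter ((q.-1) * e) s (iter e s x).
    rewrite -iterD -[X in (_ + X)%N]mul1n -mulnDl addn1 prednK ?qE //.
    by move: n0; rewrite qE muln_gt0 => /andP[].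
  have iter_id x : iter n s x = x.
    have := powB n x; rewrite Bn row1 => /rowP/(_ x); rewrite !mxE !eqxx /=.
    by case: eqP => // _ /eqP; rewrite oner_eq0.
  by rewrite -(iter_id i) -(iter_id j) !iterq ij.
have [l lP] := choice surj.
move=> d dn vb; set tau := iter d s; have tau_inj := s_inj d dn.
have mulB (S : comNzRingType) (f : {rmorphism R -> S}) (v : 'rV[S]_k) i :
    (v *m map_mx f (B ^+ d)) 0 (tau i) = v 0 i.
  rewrite mxE (bigD1 i) //= big1 ?addr0 => [|j ji].
    have := congr1 (fun r : 'rV_k => r 0 (tau i)) (powB d i).
    by rewrite !mxE => ->; rewrite !eqxx rmorph1 mulr1.
  have := congr1 (fun r : 'rV_k => r 0 (tau i)) (powB d j).
  rewrite !mxE => ->; rewrite eqxx /= (inj_eq tau_inj) eq_sym (negPf ji).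
  by rewrite rmorph0 mulr0.
rewrite -(map_Xn_sub1 rho) -map_hmx hmx_Xn_sub1 map_mxB map_mx1 mulmxBr mulmx1.
move/eqP; rewrite subr_eq0 => /eqP vbP.
have vb_tau i : vb 0 (tau i) = vb 0 i by rewrite -{1}vbP mulB.
(* Each coordinate is lifted at the chosen representative of its orbit, so the lift is exactly
   invariant and not only invariant mod [t]. *)
exists (\row_i l (vb 0 (froot tau i))); split; last first.
  apply/rowP => i; rewrite !mxE lP.
  have [m ->] : exists m, froot tau i = iter m tau i.
    by exists (findex tau i (froot tau i)); rewrite iter_findex // connect_root.
  by elim: m => //= m IH; rewrite vb_tau.
rewrite mulmxBr mulmx1; apply/eqP; rewrite subr_eq0; apply/eqP/rowP => j.
have [g tauK gK] := injF_bij tau_inj; rewrite -(gK j).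
have := mulB R idfun (\row_i l (vb 0 (froot tau i))) (g j).
rewrite map_mx_id // => ->; rewrite !mxE; congr (l (vb 0 _)).
by apply/eqP; rewrite root_connect ?fconnect1 //; apply: fconnect_sym.
Qed.

Section GroupModules.
Variables (R : idomainType) (gT : finGroupType).
Local Notation A := (group_alg R gT).

Implicit Type M : lmodType A.

(** Restriction of scalars to [R], on an alias so that the two module structures do not compete. *)
Definition base_mod (M : lmodType A) : Type := M.
HB.instance Definition _ M := GRing.Zmodule.on (base_mod M).

Section BaseMod.
Variable M : lmodType A.
Definition base_scale (r : R) (x : base_mod M) : base_mod M := (r%:A : A) *: (x : M).

Fact base_scaleA a b v : base_scale a (base_scale b v) = base_scale (a * b) v.
Proof. by rewrite /base_scale scalerA -scalerAl mul1r scalerA. Qed.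
Fact base_scale1 : left_id 1 base_scale.
Proof. by move=> v; rewrite /base_scale !scale1r. Qed.
Fact base_scaleDr : right_distributive base_scale +%R.
Proof. by move=> a u v; rewrite /base_scale scalerDr. Qed.
Fact base_scaleDl v : {morph base_scale^~ v : a b / a + b}.
Proof. by move=> a b; rewrite /base_scale !scalerDl. Qed.

HB.instance Definition _ := GRing.Zmodule_isLmodule.Build R (base_mod M)
  base_scaleA base_scale1 base_scaleDr base_scaleDl.
End BaseMod.

Section Coordinates.
Variables (M : lmodType A) (N : nat) (e : 'I_N -> M).

Definition coords (v : 'rV[R]_N) : M := \sum_j ((v 0 j)%:A : A) *: e j.

Lemma coordsD u v : coords (u + v) = coords u + coords v.
Proof.
by rewrite /coords -big_split; apply: eq_bigr => j _; rewrite mxE !scalerDl.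
Qed.

Lemma coordsZ r v : coords (r *: v) = (r%:A : A) *: coords v.
Proof.
rewrite /coords scaler_sumr; apply: eq_bigr => j _.
by rewrite mxE scalerA -scalerAl mul1r scalerA.
Qed.

Lemma coordsB u v : coords (u - v) = coords u - coords v.
Proof.
by rewrite coordsD -[in LHS](scaleN1r v) coordsZ !scaleN1r.
Qed.

Lemma coords_surj x : R_basis e -> exists v, coords v = x.
Proof.
move=> /(_ x)[c [cx _]]; exists (\row_j c j); rewrite /coords cx.
by apply: eq_bigr => j _; rewrite mxE.
Qed.

Lemma coords_inj : R_basis e -> injective coords.
Proof.
move=> eB u v uv; have [c [_ cU]] := eB (coords u).
have cE (w : 'rV[R]_N) : coords w = coords u -> c = [ffun j => w 0 j].
  by move=> wu; apply: cU; rewrite -wu; apply: eq_bigr => j _; rewrite ffunE.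
apply/rowP => j; have := cE u erefl; rewrite (cE v (esym uv)) => /ffunP/(_ j).
by rewrite !ffunE.
Qed.

Lemma coords0 : coords 0 = 0.
Proof. by rewrite /coords big1 // => j _; rewrite mxE !scale0r. Qed.

Lemma coords_R_basis :
  (forall x, exists v, coords v = x) -> injective coords -> R_basis e.
Proof.
move=> surj inj x; have [v <-] := surj x.
exists [ffun j => v 0 j]; split=> [|c vc].
  by apply: eq_bigr => j _; rewrite ffunE.
suff -> : v = \row_j c j by apply/ffunP => j; rewrite ffunE mxE.
by apply: inj; rewrite vc; apply: eq_bigr => j _; rewrite mxE.
Qed.

End Coordinates.

Lemma R_basis_coords M N (e : 'I_N -> M) (f : 'I_N -> M) (X : 'M[R]_N) :
  R_basis e -> X \in unitmx -> (forall s, f s = coords e (row s X)) -> R_basis f.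
Proof.
move=> eB Xu fX.
have fE v : coords f v = coords e (v *m X).
  rewrite mulmx_sum_row (big_morph _ (coordsD e) (coords0 e)).
  by apply: eq_bigr => i _; rewrite fX coordsZ.
apply: coords_R_basis => [x|u v].
  by have [v <-] := coords_surj x eB; exists (v *m invmx X); rewrite fE mulmxKV.
by rewrite !fE => /(coords_inj eB)/(can_inj (mulmxK Xu)).
Qed.

(** The translates of finitely many module generators by the group generate over [R]. *)
Lemma lattice_R_basis M : pid R -> lattice M ->
  exists (N : nat) (e : 'I_N -> M), R_basis e.
Proof.
move=> pidR [[k [e eM]] tM].
have tfM (r : R) (v : base_mod M) : r *: v = 0 -> r = 0 \/ v = 0 by apply: tM.
pose f (s : 'I_#|{: 'I_k * gT}|) : base_mod M :=
  grp_elt R (enum_val s).2 *: e (enum_val s).1.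
have [|N [h [hgen hfree]]] := torsion_free_basis pidR tfM (e := f).
  move=> v; have [c vE] := eM v.
  exists (fun s => c (enum_val s).1 (enum_val s).2); rewrite vE.
  rewrite -(big_enum_val (A := predT) (fun x : 'I_k * gT =>
    (c x.1 x.2) *: (grp_elt R x.2 *: e x.1 : base_mod M))) /=.
  rewrite -(pair_bigA _ (fun i g => (c i g) *: (grp_elt R g *: e i : base_mod M))) /=.
  apply: eq_bigr => i _; rewrite {1}[c i]group_algE scaler_suml.
  apply: eq_bigr => g _; rewrite -[RHS]/((c i g)%:A *: (grp_elt R g *: e i)).
  by rewrite scalerA -scalerAl mul1r.
exists N, h => x; have [c xE] := hgen x.
exists [ffun i => c i]; split=> [|c' c'x].
  by rewrite {1}xE; apply: eq_bigr => i _; rewrite ffunE.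
apply/ffunP => i; rewrite ffunE; apply/eqP; rewrite -subr_eq0; apply/eqP.
apply: (hfree (fun i => c i - c' i)).
under eq_bigr => j _ do rewrite scalerBl.
by rewrite sumrB -xE {1}c'x subrr.
Qed.

Variable sg : gT.
Hypothesis sgG : [set: gT]%g = <[sg]>%g.
Let n := #|[set: gT]%g|.
Local Notation sigma := (grp_elt R sg).

Lemma generator_order : #[sg]%g = n.
Proof. by rewrite /n sgG. Qed.

Lemma sigmaX k : grp_elt R (sg ^+ k)%g = sigma ^+ k.
Proof. by elim: k => [|k IH] //; rewrite expgS exprS grp_eltM IH. Qed.

Lemma generator_exp g : exists k, g = (sg ^+ k)%g.
Proof. by apply/cycleP; rewrite -sgG finset.in_setT. Qed.

(** Row vectors are used throughout: [sigma] acts on coordinates by right multiplication with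
    [B]. *)
Definition acts_by M N (e : 'I_N -> M) (B : 'M[R]_N) : Prop :=
  forall i, sigma *: e i = coords e (row i B).

Lemma sigma_coords M N (e : 'I_N -> M) B v : acts_by e B ->
  sigma *: coords e v = coords e (v *m B).
Proof.
move=> eB; rewrite mulmx_sum_row (big_morph _ (coordsD e) (coords0 e)).
rewrite {1}/coords scaler_sumr; apply: eq_bigr => j _.
by rewrite coordsZ -eB !scalerA -scalerAl mul1r -scalerAr mulr1.
Qed.

Lemma sigmaX_coords M N (e : 'I_N -> M) B k v : acts_by e B ->
  sigma ^+ k *: coords e v = coords e (v *m B ^+ k).
Proof.
move=> eB; elim: k v => [|k IH] v; first by rewrite !expr0 scale1r mulmx1.
by rewrite exprSr exprS -scalerA (sigma_coords _ eB) IH mulmxA.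
Qed.

Lemma exists_acts_by M N (e : 'I_N -> M) : R_basis e -> exists B, acts_by e B.
Proof.
move=> eB; have /choice[b bP] i : exists v, sigma *: e i = coords e v.
  by have [v vE] := coords_surj (sigma *: e i) eB; exists v.
by exists (\matrix_i b i) => i; rewrite rowK.
Qed.

Lemma acts_by_order M N (e : 'I_N -> M) B :
  R_basis e -> acts_by e B -> B ^+ n = 1.
Proof.
move=> eB eA; apply/row_matrixP => i; rewrite !rowE; apply: (coords_inj eB).
by rewrite -sigmaX_coords // -sigmaX -generator_order expg_order scale1r mulmx1.
Qed.

(** A connecting homomorphism made explicit. Lift [vb] to [v]; then [v (B^d - 1) = t u]. For [H]
    generated by [sigma ^ d], the norm kills [t u], hence [u] by torsion-freeness. Flabbiness puts
    [u] in the augmentation submodule, which for cyclic [H] is the image of [sigma ^ d - 1]; so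
    [u = w (B^d - 1)], and [v - t w] is the required lift. *)
Lemma flabby_liftable M N (e : 'I_N -> M) B (F : fieldType)
    (rho : {rmorphism R -> F}) t :
  R_basis e -> acts_by e B -> torsion_free M -> flabby M -> residue_at rho t ->
  liftable rho n B.
Proof.
move=> eB eA tM fM res d dn vb vb0.
have [v vE] := residue_lift_mx vb res.
have [|u uE] := @residue_mx_eq0 _ _ _ _ _ _ (v *m hmx B ('X^d - 1)) res.
  by rewrite map_mxM map_hmx map_Xn_sub1 vE.
have [t0|t0] := eqVneq t 0.
  by exists v; split=> //; rewrite uE t0 scale0r.
pose tau := (sg ^+ d)%g; pose H := <[tau]>%G.
have coordsX w : coords e (w *m hmx B ('X^d - 1)) = (sigma ^+ d - 1) *: coords e w.
  by rewrite hmx_Xn_sub1 mulmxBr mulmx1 coordsB -sigmaX_coords // scalerBl scale1r.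
have normu : norm_kernel H M (coords e u).
  rewrite /norm_kernel /=.
  have : (t%:A : A) *: \sum_(g in H) grp_elt R g *: coords e u = 0.
    rewrite scaler_sumr.
    under eq_bigr => g _.
      rewrite scalerA -scalerAl mul1r -[t *: grp_elt R g]mulr1 -scalerAl scalerAr.
      rewrite -scalerA -coordsZ -uE coordsX scalerA mulrBr mulr1 -sigmaX -grp_eltM.
      rewrite scalerBl; over.
    rewrite sumrB; apply/eqP; rewrite subr_eq0; apply/eqP.
    rewrite [RHS](reindex_inj (mulIg tau)) /=; apply: eq_bigl => g.
    by rewrite groupMr // cycle_id.
  by case/tM => // t0'; rewrite t0' eqxx in t0.
have [y _ yE] := fM H _ normu.
have /choice[q qP] g : exists q : A, g \in H -> grp_elt R g - 1 = (sigma ^+ d - 1) * q.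
  have [|gH] := boolP (g \in H); last by exists 0.
  move=> /cycleP[j ->]; rewrite /tau -expgM sigmaX exprM.
  by eexists; rewrite subrX1.
have [w wE] := coords_surj (\sum_(g in H) q g *: y g) eB.
have uw : u = w *m hmx B ('X^d - 1).
  apply: (coords_inj eB); rewrite coordsX wE -yE scaler_sumr.
  by apply: eq_bigr => g gH; rewrite qP // scalerA.
exists (v - t *: w); split.
  by rewrite mulmxBl uE uw -scalemxAl subrr.
have [_ rho0] := res.
rewrite map_mxB map_mxZ (_ : rho t = 0) ?scale0r ?subr0 //.
by apply/rho0; exists 1; rewrite mulr1.
Qed.

Lemma coords_pair M1 M2 N1 N2 (e1 : 'I_N1 -> M1) (e2 : 'I_N2 -> M2) v :
  coords (pair_family e1 e2) v = (coords e1 (lsubmx v), coords e2 (rsubmx v)).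
Proof.
rewrite /coords (pair_familyE e1 e2 (fun j => _%:A)).
by congr (_, _); apply: eq_bigr => j _; rewrite mxE.
Qed.

Lemma R_basis_pair M1 M2 N1 N2 (e1 : 'I_N1 -> M1) (e2 : 'I_N2 -> M2) :
  R_basis e1 -> R_basis e2 -> R_basis (pair_family e1 e2).
Proof.
move=> b1 b2; apply: coords_R_basis => [[x y]|u v].
  have [v <-] := coords_surj x b1; have [w <-] := coords_surj y b2.
  by exists (row_mx v w); rewrite coords_pair row_mxKl row_mxKr.
rewrite !coords_pair => -[/(coords_inj b1) uvl /(coords_inj b2) uvr].
by rewrite -[u]hsubmxK uvl uvr hsubmxK.
Qed.

Lemma acts_by_pair M1 M2 N1 N2 (e1 : 'I_N1 -> M1) (e2 : 'I_N2 -> M2) B1 B2 :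
  acts_by e1 B1 -> acts_by e2 B2 ->
  acts_by (pair_family e1 e2) (block_mx B1 0 0 B2).
Proof.
move=> a1 a2 i; rewrite coords_pair -[i]splitK /pair_family.
case: (fintype.split i) => j; rewrite unsplitK -[LHS]/(_, _) scaler0.
  by rewrite a1 block_mxEv rowKu row_row_mx row_mxKl row_mxKr row0 coords0.
by rewrite a2 block_mxEv rowKd row_row_mx row_mxKl row_mxKr row0 coords0.
Qed.

Lemma R_basis_torsion_free M N (e : 'I_N -> M) : R_basis e -> torsion_free M.
Proof.
move=> eB r x; have [v <-] := coords_surj x eB; rewrite -coordsZ -(coords0 e).
move=> /(coords_inj eB)/eqP; rewrite scalemx_eq0 => /orP[/eqP|/eqP ->]; first by left.
by right; rewrite coords0.
Qed.

Lemma R_basis_lattice M N (e : 'I_N -> M) : R_basis e -> lattice M.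
Proof.
move=> eB; split; last exact: R_basis_torsion_free eB.
exists N, e => x; have [v <-] := coords_surj x eB.
by exists (fun j => (v 0 j)%:A).
Qed.

Lemma permutation_lattice_sigma M N (e : 'I_N -> M) :
  R_basis e -> (forall i, exists j, sigma *: e i = e j) -> permutation_lattice M.
Proof.
move=> eB eP; split; first exact: R_basis_lattice eB.
exists N, e; split=> // g i; have [k ->] := generator_exp g; rewrite sigmaX.
elim: k => [|k [j IH]]; first by exists i; rewrite expr0 scale1r.
by have [j' jE] := eP j; exists j'; rewrite exprS -scalerA IH.
Qed.

Section RepMod.
Variables (k : nat) (rep : gT -> 'M[R]_k).
Hypotheses (rep1 : rep 1%g = 1%:M)
  (repM : forall g h, rep (g * h)%g = rep h *m rep g).

(** The two laws are arguments of the type so that the module structure can be inferred from it.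
    Acting on the right of row vectors reverses products, whence the form of [repM]. *)
Definition rep_mod of rep 1%g = 1%:M
  & (forall g h, rep (g * h)%g = rep h *m rep g) : Type := 'rV[R]_k.
Local Notation V := (rep_mod rep1 repM).
HB.instance Definition _ := GRing.Zmodule.copy V 'rV[R]_k.

Definition rep_scale (a : A) (v : V) : V :=
  \sum_(g : gT) a g *: ((v : 'rV[R]_k) *m rep g).

Fact rep_scaleA a b v : rep_scale a (rep_scale b v) = rep_scale (a * b) v.
Proof.
rewrite /rep_scale; under [RHS]eq_bigr => g _ do rewrite ffunE scaler_suml.
rewrite [RHS]exchange_big /=; apply: eq_bigr => h _.
rewrite [RHS](reindex_inj (mulgI h)) /= mulmx_suml scaler_sumr.
apply: eq_bigr => g _.
by rewrite mulKg repM mulmxA -scalemxAl scalerA.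
Qed.

Fact rep_scale1 : left_id 1 rep_scale.
Proof.
move=> v; rewrite /rep_scale (bigD1 1%g) //= big1 => [|g /negPf g1].
  by rewrite ffunE eqxx scale1r rep1 mulmx1 addr0.
by rewrite ffunE g1 scale0r.
Qed.

Fact rep_scaleDr : right_distributive rep_scale +%R.
Proof.
move=> a u v; rewrite /rep_scale -big_split; apply: eq_bigr => g _ /=.
by rewrite mulmxDl scalerDr.
Qed.

Fact rep_scaleDl v : {morph rep_scale^~ v : a b / a + b}.
Proof.
move=> a b; rewrite /rep_scale -big_split; apply: eq_bigr => g _ /=.
by rewrite ffunE scalerDl.
Qed.

HB.instance Definition _ := GRing.Zmodule_isLmodule.Build A V
  rep_scaleA rep_scale1 rep_scaleDr rep_scaleDl.

Lemma rep_mod_elt g (v : V) : grp_elt R g *: v = (v : 'rV[R]_k) *m rep g.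
Proof.
rewrite -[LHS]/(rep_scale _ _) /rep_scale (bigD1 g) //= big1 => [|h /negPf hg].
  by rewrite ffunE eqxx scale1r addr0.
by rewrite ffunE hg scale0r.
Qed.

Lemma rep_mod_scale r (v : V) : (r%:A : A) *: v = r *: (v : 'rV[R]_k).
Proof.
rewrite -[LHS]/(rep_scale _ _) /rep_scale (bigD1 1%g) //= big1 => [|h /negPf h1].
  by rewrite !ffunE eqxx rep1 mulmx1 addr0 -[r *: 1]/(r * 1) mulr1.
by rewrite !ffunE h1 scaler0 scale0r.
Qed.

Definition rep_mod_basis (i : 'I_k) : V := delta_mx 0 i.

Lemma rep_mod_coords v : coords rep_mod_basis v = v.
Proof.
rewrite [RHS](row_sum_delta v); apply: eq_bigr => j _; exact: rep_mod_scale.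
Qed.

Lemma rep_mod_R_basis : R_basis rep_mod_basis.
Proof.
apply: coords_R_basis => [x|u v]; last by rewrite !rep_mod_coords.
by exists x; exact: rep_mod_coords.
Qed.

End RepMod.

(** The matrix attached to [sg ^ j] is [B ^ j], which is well defined because [B ^ n = 1]. *)
Lemma cyclic_rep_mod k (B : 'M[R]_k) : B ^+ n = 1 ->
  exists (P : lmodType A) (e : 'I_k -> P), R_basis e /\ acts_by e B.
Proof.
move=> Bn; have [lg lgP] := choice generator_exp.
pose rep g := B ^+ lg g.
have repE g j : g = (sg ^+ j)%g -> rep g = B ^+ j.
  move=> gE; have /eqP : (sg ^+ lg g = sg ^+ j)%g by rewrite -gE -lgP.
  rewrite eq_expg_mod_order generator_order => /eqP lgj.
  by rewrite /rep -(expr_mod _ Bn) lgj expr_mod.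
have rep1 : rep 1%g = 1%:M by rewrite (repE _ 0%N) ?expr0.
have repM g h : rep (g * h)%g = rep h *m rep g.
  rewrite (repE (g * h)%g (lg h + lg g)%N) ?exprD //.
  by rewrite addnC expgD -!lgP.
exists (rep_mod rep1 repM), (rep_mod_basis rep1 repM).
split=> [|i]; first exact: rep_mod_R_basis.
by rewrite rep_mod_elt rep_mod_coords (repE sg 1%N) ?expr1 // -rowE.
Qed.

Lemma companion_Xn_sub1_row d (i : 'I_(size ('X^d - 1 : {poly R})%R).-1) : (0 < d)%N ->
  exists j, row i (companionmx ('X^d - 1 : {poly R})) = delta_mx 0 j.
Proof.
move=> d0.
have sE : (size ('X^d - 1 : {poly R})%R).-1 = d by rewrite size_XnsubC.
have s0 : (0 < (size ('X^d - 1 : {poly R})%R).-1)%N by rewrite sE.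
have [il|il] := ltnP i.+1 (size ('X^d - 1 : {poly R})%R).-1.
  by exists (Ordinal il); rewrite rowE mulmx_delta_companion.
have ie : i = (size ('X^d - 1 : {poly R})%R).-1.-1 :> nat.
  by apply: succn_inj; rewrite (prednK s0); apply/eqP; rewrite eqn_leq il ltn_ord.
exists (Ordinal s0); apply/rowP => j; rewrite !mxE ie eqxx /=.
have jd : (j < d)%N by apply: leq_trans (ltn_ord j) _; rewrite sE.
by rewrite coefB coefXn coef1 -val_eqE /= (ltn_eqF jd) sub0r opprK eqxx.
Qed.

(** Each [d] contributes the lattice on which the generator acts by the companion matrix of
    [X^d - 1], a cyclic permutation of [d] basis vectors; the list contributes their direct sum. *)
Lemma permutation_lattice_list (l : seq nat) :
  all (fun d => d %| n)%N l ->
  exists (P : lmodType A) (N : nat) (e : 'I_N -> P) (B : 'M[R]_N),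
  [/\ permutation_lattice P, R_basis e, acts_by e B,
      forall (F : fieldType) (rho : {rmorphism R -> F}) t,
        residue_at rho t -> liftable rho n B &
      char_poly B = \prod_(d <- l) ('X^d - 1)].
Proof.
have n0 : (0 < n)%N by rewrite cardG_gt0.
elim: l => [_|d l IH /= /andP[dn /IH[P2 [N2 [e2 [B2 [pP2 eB2 aB2 lB2 chi2]]]]]]].
  have eB : R_basis (fun _ : 'I_0 => 0 : zero_lattice R gT).
    move=> m; exists [ffun=> 0].
    split; first by rewrite [LHS]zero_lattice_eq0 [RHS]zero_lattice_eq0.
    by move=> c _; apply/ffunP => -[].
  exists (zero_lattice R gT), 0%N, (fun=> 0), 0; split=> //.
  - exact: permutation_lattice0.
  - by case.
  - move=> F rho t _ d _ vb _; exists 0.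
    by split; rewrite ?mul0mx // [LHS]thinmx0 [RHS]thinmx0.
  - by rewrite big_nil /char_poly det_mx00.
have d0 := dvdn_gt0 n0 dn; pose C := companionmx ('X^d - 1 : {poly R}).
have chiC : char_poly C = 'X^d - 1 by rewrite companionmxK // Xn_sub1_monic.
have Cd : C ^+ d = 1.
  have := Cayley_Hamilton_hmx C; rewrite chiC hmx_Xn_sub1.
  by move/eqP; rewrite subr_eq0 => /eqP.
have Cn : C ^+ n = 1 by rewrite -(divnK dn) mulnC exprM Cd expr1n.
have rowC i : exists j, row i C = delta_mx 0 j by apply: companion_Xn_sub1_row.
have [P1 [e1 [eB1 aB1]]] := cyclic_rep_mod Cn.
have pP1 : permutation_lattice P1.
  apply: (permutation_lattice_sigma eB1) => i.
  have [j rj] := rowC i; exists j; rewrite aB1 rj.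
  rewrite /coords (bigD1 j) //= big1 ?addr0 => [|k kj].
    by rewrite mxE !eqxx !scale1r.
  by rewrite mxE eqxx (negPf kj) !scale0r.
exists (P1 * P2)%type, _, (pair_family e1 e2), (block_mx C 0 0 B2); split.
- exact: permutation_lattice_sum.
- exact: R_basis_pair.
- exact: acts_by_pair.
- move=> F rho t res; apply: liftable_block_diag; last exact: lB2 res.
  exact: liftable_permuted res n0 Cn rowC.
- by rewrite char_poly_block_diag chiC chi2 big_cons.
Qed.

End GroupModules.

(** The list [l1] obtained from the characteristic polynomial of the generator dictates [P]; adding
    it turns that polynomial into the product over [l2], and liftability passes to the sum since
    permutation lattices have it too. *)
Theorem flabby_sum_permutation (R : idomainType) (gT : finGroupType)
    (M : lmodType (group_alg R gT)) :
  cyclic [set: gT]%g -> dedekind R -> semilocal R -> [pchar R] =i pred0 ->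
  (forall p, prime p -> (p %| #|[set: gT]%g|)%N -> unramified R p) ->
  lattice M -> flabby M ->
  exists2 P : lmodType (group_alg R gT),
    permutation_lattice P & permutation_lattice (M * P)%type.
Proof.
move=> /cyclicP[sg sgG] dR sR char0 unr lM fM; set n := #|_| in unr.
have n0 : (0 < n)%N by rewrite /n cardG_gt0.
have pidR : pid R by move=> I; apply: semilocal_dedekind_principal.
have unrA p : prime p -> (p %| n)%N -> unramified_at R p.
  by move=> pp pn; apply: unramified_unramified_at => //; apply: unr.
have [N [e eB]] := lattice_R_basis pidR lM.
have [B eA] := exists_acts_by sg eB.
have Bn : B ^+ n = 1 := acts_by_order sgG eB eA.
have [l1 [l2 [l1n l2n chiB]]] :
    stably_cyclic n (map_poly (@tofrac R) (char_poly B)).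
  (* The exponent is the rank [N]: from [B^n = 1], the characteristic polynomial divides
     [(X^n - 1)^N]. *)
  apply: (@stably_cyclic_dvd _ _ pidR char0 n0 unrA _ N).
    by rewrite monic_map // char_poly_monic.
  have [|Q QE] := @char_poly_dvd_annihilator R N B ('X^n - 1).
    by rewrite hmx_Xn_sub1 Bn subrr.
  by rewrite -(map_Xn_sub1 (@tofrac R)) -rmorphXn /= QE rmorphM /= dvdp_mulr.
have [P [k [f [C [pP fB fA Clift chiC]]]]] := permutation_lattice_list R sgG l1n.
pose D := block_mx B 0 0 C; pose h := pair_family e f.
have hB : R_basis h by apply: R_basis_pair.
have hA : acts_by sg h D by apply: acts_by_pair.
have Dn : D ^+ n = 1 := acts_by_order sgG hB hA.
have chiD : char_poly D = \prod_(d <- l2) ('X^d - 1).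
  apply: tofrac_poly_inj; rewrite char_poly_block_diag chiC rmorphM !rmorph_prod /=.
  rewrite -[RHS](eq_bigr _ (fun d _ => esym (map_Xn_sub1 (@tofrac R) d))) -chiB.
  by congr (_ * _); apply: eq_bigr => d _; apply: map_Xn_sub1.
have Dlift (F : fieldType) (rho : {rmorphism R -> F}) t :
    residue_at rho t -> liftable rho n D.
  move=> res; apply: liftable_block_diag _ (Clift _ _ _ res).
  exact: flabby_liftable eB eA lM.2 fM res.
have [X [Xu XD]] := permuted_basis dR sR char0 n0 unr Dn l2n chiD Dlift.
exists P => //; pose x s := coords h (row s X).
have xB : R_basis x by apply: R_basis_coords hB Xu _.
apply: (permutation_lattice_sigma sgG xB) => s; have [s' XE] := XD s.
by exists s'; rewrite /x (sigma_coords _ hA) XE.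
Qed.

Theorem theorem5p4 (n : nat) (gT : finGroupType) (R : idomainType)
    (pi_cyclic : cyclic [set: gT]%g) (pi_order : #|[set: gT]%g| = n)
    (R_dedekind : dedekind R) (R_semilocal : semilocal R)
    (R_char0 : [pchar R] =i pred0)
    (R_nonunit : forall p : nat, prime p -> (p %| n)%N ->
       p%:R \isn't a @GRing.unit R)
    (R_unram : forall p : nat, prime p -> (p %| n)%N -> unramified R p) :
  (forall x : flabby_class_monoid R gT, x = fc_zero) /\
  (forall M : lmodType (group_alg R gT), lattice M -> flabby M ->
     exists P1 P2 : lmodType (group_alg R gT),
       [/\ permutation_lattice P1, permutation_lattice P2 &
           lmod_iso (M * P1)%type P2]).
Proof.
have key (M : lmodType (group_alg R gT)) : lattice M -> flabby M ->
    exists2 P : lmodType (group_alg R gT),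
      permutation_lattice P & permutation_lattice (M * P)%type.
  by apply: flabby_sum_permutation => // p; rewrite pi_order; apply: R_unram.
split=> [x|M lM fM].
  have [M ->] := flabby_class_surj x.
  have [P pP pMP] := key M (@fl_lattice _ _ M) (@fl_flabby _ _ M).
  apply/flabby_classP; exists P, (M * P)%type; split=> //.
  exact/lmod_iso_sym/lmod_iso_sum0.
have [P pP pMP] := key M lM fM.
by exists P, (M * P)%type; split=> //; apply: lmod_iso_refl.
Qed.
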